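(* In smooth regions the WENO-E scheme with nonlinear weights is a fifth-order approximation of the third derivative: if $v(x)=g(u(x))$ is smooth around the stencils used, then $$\frac{\hat G_{i+\frac12}-\hat G_{i-\frac12}}{\Delta x^3}=g(u)_{xxx}\big|_{x=x_i}+\mathcal{O}(\Delta x^5)\qquad(\Delta x\to0),$$ where $\hat G_{i\pm\frac12}=\sum_{m=0}^2\omega_m^{\pm}\,\hat G^{(m)}_{i\pm\frac12}$ are the WENO-E numerical fluxes.
   Context: Grid: uniform with step $\Delta x>0$, $x_j=x_i+(j-i)\Delta x$, $x_{i+\frac12}=x_i+\frac{\Delta x}2$. Write $v(x)=g(u(x))$ and $v_j=v(x_j)$. ''Smooth around the stencils'' means smooth on an open interval containing the points involved; $\mathcal{O}(\cdot)$ is understood as $\Delta x\to0$ with $x_i$ and $v$ fixed. Let $\lambda\neq0$ be a fixed parameter, $\lambda\in\mathbb{R}$ or $\lambda\in\sqrt{-1}\,\mathbb{R}$, and put $$\Gamma_7=\mathrm{span}\{1,x,x^2,e^{\lambda x},e^{-\lambda x},\cos\lambda x,\sin\lambda x\},\qquad \Gamma_5=\mathrm{span}\{1,x,x^2,e^{\lambda x},e^{-\lambda x}\}.$$ For a function $q$ define the triple average $$(Mq)(x)=\frac1{\Delta x^3}\int_{x-\frac{\Delta x}2}^{x+\frac{\Delta x}2}\int_{\eta-\frac{\Delta x}2}^{\eta+\frac{\Delta x}2}\int_{\xi-\frac{\Delta x}2}^{\xi+\frac{\Delta x}2}q(\theta)\,d\theta\,d\xi\,d\eta .$$ Big-stencil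 coefficients. Let $q\in\Gamma_7$ be the function with $(Mq)(x_j)=v_j$ for $j=i-2,\dots,i+4$. The coefficients $C_0,\dots,C_6$ (depending only on $\lambda\Delta x$) are defined by $$q(x_{i+\frac32})-2q(x_{i+\frac12})+q(x_{i-\frac12})=\sum_{k=0}^6C_k\,v_{i-2+k}.$$ Substencil fluxes. For $m=0,1,2$ let $S_m=\{x_{i-2+m},\dots,x_{i+2+m}\}$ and let $q_m\in\Gamma_5$ be the function with $(Mq_m)(x_j)=v_j$ for $x_j\in S_m$. Set $$\hat G^{(m)}_{i+\frac12}=q_m(x_{i+\frac32})-2q_m(x_{i+\frac12})+q_m(x_{i-\frac12})=\sum_{k=0}^4C^m_k\,v_{i-2+m+k},$$ which also defines the coefficients $C^m_k$. (All these functions and coefficients are well defined for $\Delta x$ small.) The flux $\hat G^{(m)}_{i-\frac12}$ is obtained by shifting every grid index by $-1$. Ideal weights: $$d_0=\frac{C_0}{C^0_0},\qquad d_1=\frac{C_1-d_0C^0_1}{C^1_0},\qquad d_2=\frac{C_2-d_0C^0_2-d_1C^1_1}{C^2_0}.$$ They satisfy $d_0+d_1+d_2=1$ and converge to $\frac4{15},\frac12,\frac7{30}$ respectively as $\Delta x\to0$. Undivided differences at $x_{i+\frac12}$: $$\begin{aligned} \mathcal D_0^3&=\mathcal D_1^3=-v_{i-1}+3v_i-3v_{i+1}+v_{i+2},\\ \mathcal D_2^3&=-2v_i+7v_{i+1}-9v_{i+2}+5v_{i+3}-v_{i+4},\\ \mathcal D_m^4&=v_{i-2+m}-4v_{i-1+m}+6v_{i+m}-4v_{i+1+m}+v_{i+2+m},\quad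 m=0,1,2. \end{aligned}$$ Smoothness indicators: $\beta_m=|\mathcal D_m^3|+|\mathcal D_m^4|$ for $m=0,1,2$, and $\zeta=|\beta_0-\beta_2|$. Nonlinear weights: $$\omega_m^+=\frac{\alpha_m}{\sum_{j=0}^2\alpha_j},\qquad \alpha_m=d_m\left(1+\frac{\zeta}{\beta_m+\Delta x^2}\right),\qquad m=0,1,2.$$ The weights $\omega_m^-$ are given by the same formula with every grid index shifted by $-1$. *)

(* Defs.v *)
From Stdlib Require Import Reals ZArith ClassicalEpsilon.
From Coquelicot Require Import Coquelicot.
Open Scope R_scope.

(* Stdlib's classical reals with Coquelicot.

   The parameter lam may be real or purely imaginary, so the spaces Gamma_5 and
   Gamma_7 consist of complex-valued functions of a real variable and are spans
   over C.  For real data the interpolants below are real-valued. *)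

Definition Cexp (z : C) : C :=
  (exp (Re z) * cos (Im z), exp (Re z) * sin (Im z)).
Definition Ccos (z : C) : C := ((Cexp (Ci * z) + Cexp (- (Ci * z))) / 2)%C.
Definition Csin (z : C) : C :=
  ((Cexp (Ci * z) - Cexp (- (Ci * z))) / (2 * Ci))%C.

Definition Gamma5 (lam : C) (q : R -> C) : Prop :=
  exists a0 a1 a2 a3 a4 : C, forall x : R,
    q x = (a0 + a1 * x + a2 * (x * x)
           + a3 * Cexp (lam * x) + a4 * Cexp (- (lam * x)))%C.

Definition Gamma7 (lam : C) (q : R -> C) : Prop :=
  exists a0 a1 a2 a3 a4 a5 a6 : C, forall x : R,
    q x = (a0 + a1 * x + a2 * (x * x)
           + a3 * Cexp (lam * x) + a4 * Cexp (- (lam * x))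
           + a5 * Ccos (lam * x) + a6 * Csin (lam * x))%C.

Definition CInt (f : R -> C) (a b : R) : C :=
  RInt (V := C_R_CompleteNormedModule) f a b.

Definition triple_avg (h : R) (q : R -> C) (x : R) : C :=
  (CInt (fun eta =>
     CInt (fun xi =>
       CInt q (xi - h / 2) (xi + h / 2))
     (eta - h / 2) (eta + h / 2))
   (x - h / 2) (x + h / 2) / RtoC (h ^ 3))%C.

(* Grid indices are relative to the base index i: [node h xi j] is x_{i+j},
   where xi = x_i.  Shifting every index by -1 amounts to replacing xi by
   xi - h. *)
Definition node (h xi : R) (j : Z) : R := xi + IZR j * h.

(* q(x_{i+3/2}) - 2 q(x_{i+1/2}) + q(x_{i-1/2}) *)
Definition second_diff (h xi : R) (q : R -> C) : C :=
  (q (xi + 3 / 2 * h)%R - 2 * q (xi + h / 2)%R + q (xi - h / 2)%R)%C.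

(* The function q of the space G with (M q)(x_j) = v_j at the N+1 nodes
   x_{i+lo}, ..., x_{i+lo+N}.  This is a definite description: the value is
   unspecified when the interpolation problem has no solution. *)
Definition interpolant (G : (R -> C) -> Prop) (h xi : R) (lo : Z) (N : nat)
    (v : R -> R) : R -> C :=
  epsilon (inhabits (fun _ : R => RtoC 0))
    (fun q => G q /\
       forall k : nat, (k <= N)%nat ->
         triple_avg h q (node h xi (lo + Z.of_nat k))
         = RtoC (v (node h xi (lo + Z.of_nat k)))).

(* The coefficients c_0, ..., c_N expressing the second difference of the
   interpolant in terms of arbitrary grid data; entries of index above N are
   irrelevant. *)
Definition stencil_coef (G : (R -> C) -> Prop) (h xi : R) (lo : Z) (N : nat) :
    nat -> C :=
  epsilon (inhabits (fun _ : nat => RtoC 0))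
    (fun c => forall v : R -> R,
       second_diff h xi (interpolant G h xi lo N v)
       = sum_n (fun k : nat =>
                  (c k * RtoC (v (node h xi (lo + Z.of_nat k))))%C) N).

Definition bigC (lam : C) (h xi : R) : nat -> C :=
  stencil_coef (Gamma7 lam) h xi (-2) 6.

Definition subC (lam : C) (h xi : R) (m : nat) : nat -> C :=
  stencil_coef (Gamma5 lam) h xi (-2 + Z.of_nat m) 4.

Definition subflux (lam : C) (v : R -> R) (h xi : R) (m : nat) : C :=
  second_diff h xi (interpolant (Gamma5 lam) h xi (-2 + Z.of_nat m) 4 v).

Definition d0 (lam : C) (h xi : R) : C :=
  (bigC lam h xi 0 / subC lam h xi 0 0)%C.
Definition d1 (lam : C) (h xi : R) : C :=
  ((bigC lam h xi 1 - d0 lam h xi * subC lam h xi 0 1) / subC lam h xi 1 0)%C.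
Definition d2 (lam : C) (h xi : R) : C :=
  ((bigC lam h xi 2 - d0 lam h xi * subC lam h xi 0 2
    - d1 lam h xi * subC lam h xi 1 1) / subC lam h xi 2 0)%C.

Definition ideal_weight (lam : C) (h xi : R) (m : nat) : C :=
  match m with
  | 0%nat => d0 lam h xi
  | 1%nat => d1 lam h xi
  | _ => d2 lam h xi
  end.

Definition D3 (v : R -> R) (h xi : R) (m : nat) : R :=
  let w (j : Z) := v (node h xi j) in
  match m with
  | 0%nat | 1%nat => - w (-1)%Z + 3 * w 0%Z - 3 * w 1%Z + w 2%Z
  | _ => - 2 * w 0%Z + 7 * w 1%Z - 9 * w 2%Z + 5 * w 3%Z - w 4%Z
  end.

Definition D4 (v : R -> R) (h xi : R) (m : nat) : R :=
  let w (j : Z) := v (node h xi (j + Z.of_nat m)) in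
  w (-2)%Z - 4 * w (-1)%Z + 6 * w 0%Z - 4 * w 1%Z + w 2%Z.

Definition beta (v : R -> R) (h xi : R) (m : nat) : R :=
  Rabs (D3 v h xi m) + Rabs (D4 v h xi m).

Definition zeta (v : R -> R) (h xi : R) : R :=
  Rabs (beta v h xi 0 - beta v h xi 2).

Definition alpha (lam : C) (v : R -> R) (h xi : R) (m : nat) : C :=
  (ideal_weight lam h xi m
   * RtoC (1 + zeta v h xi / (beta v h xi m + h ^ 2)))%C.

Definition omega (lam : C) (v : R -> R) (h xi : R) (m : nat) : C :=
  (alpha lam v h xi m / sum_n (fun j : nat => alpha lam v h xi j) 2)%C.

(* The numerical flux at x_{i+1/2}; the one at x_{i-1/2} is [Ghat lam v h (xi - h)]. *)
Definition Ghat (lam : C) (v : R -> R) (h xi : R) : C :=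
  sum_n (fun m : nat => (omega lam v h xi m * subflux lam v h xi m)%C) 2.

Definition smooth_on (a b : R) (f : R -> R) : Prop :=
  forall (n : nat) (x : R), a < x < b -> ex_derive_n f n x.

(* Main.v *)
Require Import Defs.
From Stdlib Require Import Reals Lra Lia List Arith ClassicalEpsilon FunctionalExtensionality.
From Coquelicot Require Import Coquelicot.
Open Scope R_scope.

(* If [Q''' = q] then [M q] is the third central difference of [Q] divided by
   [h^3], so the interpolation problems become collocation problems for sums
   [A0 + A1 k + A2 k^2 + sum_l B_l w_l^k], which are uniquely solvable for
   small [h].  Hence the stencil coefficients [c] are characterized by exactness on
   the space.  Testing exactness on functions that agree with [x^n / n!] up to
   [O(x^(n+2))] for [Gamma5] and [O(x^(n+4))] for [Gamma7] gives the moments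
   [sum_k c_k j_k^n] up to errors [O(h^2)], resp. [O(h^4)], and an integer
   Vandermonde system turns this into bounds for the coefficients.  The defect
   [C - sum_m d_m C^m] vanishes on the first three nodes and reproduces
   [1 - sum_m d_m] times the exact flux on [Gamma5]; both must be zero for small
   [h].  The big-stencil flux
   difference then has error [O(h^8)] by Taylor expansion.  The substencil fluxes
   agree up to [O(h^5)], and [zeta = O(h^5)] while the denominators are at least
   [h^2], so the nonlinear weights move the flux by [O(h^3) O(h^5)]. *)

(** * Collocation with exponentials *)

(** Requiring [lam] to be real or imaginary makes [lam^2] real, and the exponents [lam], [-lam],
    [i lam], [-i lam] share one real positive fourth power. So [x^n / n!] extends to a real series
    in steps of 2, resp. 4, that stays in the span; this step is the order of the moment errors. In
    the limit the moments are 0, 0, 2, 3, 2 for every stencil, followed by 0, -1 for the big one.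
    These integers carry the consistency: they give the three substencil fluxes one common expansion
    up to [h^4], and they cancel degrees 4 to 7 in the big flux difference. Interpolants and
    coefficients are given by choice, so they are reached only through uniqueness. The same
    uniqueness shows that the coefficients are real and independent of the base point, which allows
    the fluxes at the two interfaces to be subtracted. The obstacle with the ideal weights is that
    only three of the seven coefficient equations define them. The other four equations and the sum
    rule are recovered together from exactness on [Gamma5]. *)

Lemma Cexp_plus (z w : C) : Cexp (z + w)%C = (Cexp z * Cexp w)%C.
Proof.
  destruct z as [a b], w as [c d]; unfold Cexp, Cmult; simpl.
  rewrite exp_plus, cos_plus, sin_plus; f_equal; ring.
Qed.

Lemma Cexp_0 : Cexp 0 = 1.
Proof. unfold Cexp; simpl; rewrite exp_0, cos_0, sin_0; apply injective_projections; simpl; ring. Qed.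

Lemma Cexp_pow (z : C) (n : nat) : (Cexp z ^ n)%C = Cexp (z * INR n).
Proof.
  induction n as [|n IH].
  - simpl; rewrite <- Cexp_0; f_equal; ring.
  - rewrite Cpow_S, IH, <- Cexp_plus, S_INR, RtoC_plus; f_equal; ring.
Qed.

(** The strip of half-width 1 is a convenient choice: since [1 < PI/2], the sine vanishes in it only
    at 0, and then [exp] of the real part decides. *)
Lemma Cexp_eq_1 (z : C) : Rabs (Im z) < 1 -> Cexp z = 1 -> z = 0.
Proof.
  destruct z as [a b]; simpl; intros Hb H; injection H; simpl; intros H2 H1.
  assert (He := exp_pos a).
  assert (Hs : sin b = 0) by (apply Rmult_integral in H2; destruct H2; lra).
  apply Rabs_def2 in Hb.
  assert (Hpi := PI2_1).
  assert (b = 0).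
  { destruct (Rtotal_order b 0) as [Hn | [Hz | Hp]]; auto; exfalso.
    - assert (0 < sin (- b)) by (apply sin_gt_0; lra).
      rewrite sin_neg in *; lra.
    - assert (0 < sin b) by (apply sin_gt_0; lra); lra. }
  subst b; rewrite cos_0, Rmult_1_r in H1.
  assert (a = 0) by (apply exp_inv; rewrite exp_0; exact H1).
  subst a; reflexivity.
Qed.

Lemma Cexp_inj (z w : C) : Rabs (Im z - Im w) < 1 -> Cexp z = Cexp w -> z = w.
Proof.
  intros Hi H.
  assert (H0 : (z - w)%C = 0).
  { apply Cexp_eq_1; [destruct z, w; exact Hi |].
    unfold Cminus; rewrite Cexp_plus, H, <- Cexp_plus, <- Cexp_0; f_equal; ring. }
  replace z with (z - w + w)%C by ring; rewrite H0; ring.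
Qed.

Lemma Cminus_neq_0 (z w : C) : z <> w -> (z - w <> 0)%C.
Proof.
  intros H E; apply H.
  replace z with (z - w + w)%C by ring; rewrite E; ring.
Qed.

(** Coefficients are indexed by position, values by exponent. A statement about [esum ls b f] for
    all [f] thus speaks of the coefficients on [ls] without extracting them; vanishing for every [f]
    stands for zero coefficients. *)
Fixpoint esum (ls : list C) (b : nat -> C) (f : C -> C) : C :=
  match ls with
  | nil => 0
  | l :: ls' => (b 0%nat * f l + esum ls' (fun n => b (S n)) f)%C
  end.

Lemma esum_ext (ls : list C) (b : nat -> C) (f g : C -> C) :
  (forall l, In l ls -> f l = g l) -> esum ls b f = esum ls b g.
Proof.
  revert b; induction ls as [|l ls IH]; intros b H; simpl; auto.
  rewrite (H l) by (left; auto).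
  rewrite IH; auto; intros; apply H; right; auto.
Qed.

Lemma esum_lin (ls : list C) (b : nat -> C) (c d : C) (f g : C -> C) :
  esum ls b (fun l => c * f l + d * g l)%C
  = (c * esum ls b f + d * esum ls b g)%C.
Proof.
  revert b; induction ls as [|l ls IH]; intros b; simpl; [ring|].
  rewrite IH; ring.
Qed.

Lemma esum_scal (ls : list C) (b : nat -> C) (c : C) (f : C -> C) :
  esum ls b (fun l => c * f l)%C = (c * esum ls b f)%C.
Proof.
  revert b; induction ls as [|l ls IH]; intros b; simpl; [ring|].
  rewrite IH; ring.
Qed.

Lemma esum_coef_lin (ls : list C) (b b' : nat -> C) (c d : C) (f : C -> C) :
  esum ls (fun n => c * b n + d * b' n)%C f
  = (c * esum ls b f + d * esum ls b' f)%C.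
Proof.
  revert b b'; induction ls as [|l ls IH]; intros b b'; simpl; [ring|].
  rewrite (IH (fun n => b (S n)) (fun n => b' (S n))); ring.
Qed.

Lemma esum_rescale (ls : list C) (b : nat -> C) (g : C -> C) :
  exists b', forall f, esum ls b' f = esum ls b (fun l => g l * f l)%C.
Proof.
  revert b; induction ls as [|l ls IH]; intros b; [exists b; reflexivity|].
  destruct (IH (fun n => b (S n))) as [b' H].
  exists (fun n => match n with O => (b O * g l)%C | S n => b' n end).
  intros f; simpl; rewrite <- (H f); change (fun n => b' n) with b'; ring.
Qed.

(** Vandermonde solvability by induction on the nodes: the operator sending [y k] to
    [y (S k) - w l * y k] removes the node [w l] and multiplies the coefficient of each other node
    [w m] by [w m - w l], which is nonzero. *)
Lemma esum_pow_exists (w : C -> C) (ls : list C) :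
  ForallOrdPairs (fun l l' => w l <> w l') ls ->
  forall y : nat -> C, exists b,
    forall k, (k < length ls)%nat -> esum ls b (fun l => w l ^ k)%C = y k.
Proof.
  induction 1 as [|l ls Hl Hls IH]; intros y.
  - exists (fun _ => RtoC 0); simpl; intros; lia.
  - rewrite Forall_forall in Hl.
    destruct (IH (fun k => y (S k) - w l * y k)%C) as [b1 Hb1].
    destruct (esum_rescale ls b1 (fun m => / (w m - w l))%C) as [b2 Hb2].
    exists (fun n => match n with
                     | O => (y O - esum ls b2 (fun l => w l ^ 0))%C
                     | S n => b2 n end).
    (* The head coefficient was chosen to match [y 0]; the first-order recurrence with ratio [w l],
       satisfied by both sides, carries the match upwards. *)
    induction k as [|k IHk]; intros Hk; [simpl; change (fun n => b2 n) with b2; ring|].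
    assert (Hkl : (k < length ls)%nat) by (simpl in Hk; lia).
    simpl in Hk; specialize (IHk ltac:(simpl; lia)); specialize (Hb1 k Hkl).
    cbn [esum] in *; change (fun n => b2 n) with b2 in *.
    rewrite (esum_ext ls b2 (fun l => w l ^ S k)%C
      (fun m => w l * (w m ^ k) + 1 * ((w m - w l) * w m ^ k))%C)
      by (intros; simpl; ring).
    rewrite esum_lin, (Hb2 (fun m => (w m - w l) * w m ^ k)%C).
    rewrite (esum_ext ls b1 _ (fun m => w m ^ k)%C).
    + rewrite Hb1.
      replace (y (S k)) with (w l * y k + (y (S k) - w l * y k))%C by ring.
      rewrite <- IHk, Cpow_S; ring.
    + intros m Hm; assert (w m - w l <> 0)%C by (apply Cminus_neq_0; intros E; apply (Hl m Hm); auto).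
      field; auto.
Qed.

Lemma esum_pow_unique (w : C -> C) (ls : list C) :
  ForallOrdPairs (fun l l' => w l <> w l') ls ->
  forall b : nat -> C,
    (forall k, (k < length ls)%nat -> esum ls b (fun l => w l ^ k)%C = 0) ->
    forall f, esum ls b f = 0.
Proof.
  induction 1 as [|l ls Hl Hls IH]; intros b H f; [reflexivity|].
  rewrite Forall_forall in Hl.
  set (b1 := fun n => b (S n)).
  destruct (esum_rescale ls b1 (fun m => (w m - w l))%C) as [b2 Hb2].
  assert (H2 : forall f, esum ls b2 f = 0).
  { apply IH; intros k Hk; rewrite Hb2.
    rewrite (esum_ext ls b1 _ (fun m => 1 * (w m ^ S k) + (- w l) * (w m ^ k))%C)
      by (intros; simpl; ring).
    rewrite esum_lin.
    assert (E1 := H (S k) ltac:(simpl; lia)).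
    assert (E0 := H k ltac:(simpl; lia)).
    cbn [esum] in E0, E1; fold b1 in E0, E1.
    replace (esum ls b1 (fun m => w m ^ k))%C
      with (b 0%nat * w l ^ k + esum ls b1 (fun m => w m ^ k) - b 0%nat * w l ^ k)%C by ring.
    replace (esum ls b1 (fun m => w m ^ S k))%C
      with (b 0%nat * w l ^ S k + esum ls b1 (fun m => w m ^ S k) - b 0%nat * w l ^ S k)%C by ring.
    rewrite E0, E1, Cpow_S; ring. }
  assert (H1 : forall f, esum ls b1 f = 0).
  { intros g; rewrite <- (H2 (fun m => g m / (w m - w l))%C), Hb2.
    apply esum_ext; intros m Hm; assert (w m - w l <> 0)%C by (apply Cminus_neq_0; intros E; apply (Hl m Hm); auto).
    field; auto. }
  assert (E0 := H 0%nat ltac:(simpl; lia)).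
  cbn [esum] in E0 |- *; fold b1 in E0 |- *; rewrite H1 in *.
  replace (b 0%nat) with (b 0%nat * w l ^ 0 + 0)%C by (simpl; ring).
  rewrite E0; ring.
Qed.

Definition pseq (ls : list C) (w : C -> C) (a0 a1 a2 : C) (b : nat -> C)
    (k : nat) : C :=
  (a0 + a1 * INR k + a2 * (INR k * INR k) + esum ls b (fun l => w l ^ k))%C.

(** Quadratics behave as a triple node at 1: the third difference kills them and multiplies a node
    [w] by [(w - 1)^3]. This reduces the mixed problem to the pure Vandermonde one. *)
Lemma pseq_diff3 (ls : list C) (w : C -> C) (a0 a1 a2 : C) (b : nat -> C) (k : nat) :
  let y := pseq ls w a0 a1 a2 b in
  (y (3 + k)%nat - 3 * y (2 + k)%nat + 3 * y (1 + k)%nat - y k)%C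
  = esum ls b (fun l => (w l - 1) ^ 3 * w l ^ k)%C.
Proof.
  cbv zeta; unfold pseq.
  rewrite (esum_ext ls b (fun l => (w l - 1) ^ 3 * w l ^ k)%C
    (fun l => 1 * (1 * (w l ^ (3 + k)) + (-3) * (w l ^ (2 + k)))
              + 1 * (3 * (w l ^ (1 + k)) + (-1) * (w l ^ k)))%C)
    by (intros; cbn [Nat.add]; rewrite !Cpow_S; ring).
  rewrite !esum_lin; rewrite !plus_INR, !RtoC_plus; simpl INR.
  rewrite ?RtoC_plus; ring.
Qed.

Lemma diff3_quadratic (n : nat) (z : nat -> C) :
  (forall k, (k < n)%nat -> (z (3 + k)%nat - 3 * z (2 + k)%nat + 3 * z (1 + k)%nat - z k)%C = 0) ->
  exists a0 a1 a2 : C, forall k, (k < n + 3)%nat ->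
    z k = (a0 + a1 * INR k + a2 * (INR k * INR k))%C.
Proof.
  intros H.
  (* The quadratic through the first three values; the recurrence then forces the later ones. *)
  exists (z O), ((- 3 * z O + 4 * z 1%nat - z 2%nat) / 2)%C,
    ((z O - 2 * z 1%nat + z 2%nat) / 2)%C.
  assert (H2 : RtoC 2 <> 0) by (intros E; injection E; lra).
  assert (HI : forall k, (k < n)%nat ->
     z (3 + k)%nat = (3 * z (2 + k)%nat - 3 * z (1 + k)%nat + z k)%C).
  { intros k Hk.
    replace (z (3 + k)%nat) with (z (3 + k)%nat - 3 * z (2 + k)%nat + 3 * z (1 + k)%nat - z k
      + (3 * z (2 + k)%nat - 3 * z (1 + k)%nat + z k))%C by ring.
    rewrite H by auto; ring. }
  induction k as [[|[|[|k]]] IH] using (well_founded_induction lt_wf); intros Hk.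
  - simpl; field; auto.
  - simpl; field; auto.
  - simpl; rewrite RtoC_plus; field; auto.
  - change (S (S (S k))) with (3 + k)%nat in *.
    rewrite (HI k) by lia.
    rewrite (IH (2 + k)%nat), (IH (1 + k)%nat), (IH k) by lia.
    rewrite !plus_INR; simpl INR; rewrite !RtoC_plus; field; auto.
Qed.

Lemma pseq_exists (w : C -> C) (ls : list C)
    (w_inj : ForallOrdPairs (fun l l' => w l <> w l') ls)
    (w_neq_1 : forall l, In l ls -> w l <> 1) (y : nat -> C) :
  exists a0 a1 a2 b, forall k, (k < length ls + 3)%nat ->
    pseq ls w a0 a1 a2 b k = y k.
Proof.
  destruct (esum_pow_exists w ls w_inj
    (fun k => y (3 + k)%nat - 3 * y (2 + k)%nat + 3 * y (1 + k)%nat - y k)%C) as [b1 Hb1].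
  (* The exponential part is fixed by third differences alone; what remains of [y] has zero third
     differences and is therefore quadratic. *)
  destruct (esum_rescale ls b1 (fun l => / (w l - 1) ^ 3)%C) as [b Hb].
  set (s := pseq ls w 0 0 0 b).
  destruct (diff3_quadratic (length ls) (fun k => y k - s k)%C) as (a0 & a1 & a2 & Ha).
  { intros k Hk.
    assert (E := pseq_diff3 ls w 0 0 0 b k); cbv zeta in E; fold s in E.
    rewrite Hb in E.
    rewrite (esum_ext ls b1 _ (fun l => w l ^ k)%C) in E
      by (intros; field; apply Cminus_neq_0; auto).
    rewrite Hb1 in E by auto.
    replace (y (3 + k)%nat - s (3 + k)%nat - 3 * (y (2 + k)%nat - s (2 + k)%nat) +
       3 * (y (1 + k)%nat - s (1 + k)%nat) - (y k - s k))%C with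
      (y (3 + k)%nat - 3 * y (2 + k)%nat + 3 * y (1 + k)%nat - y k
       - (s (3 + k)%nat - 3 * s (2 + k)%nat + 3 * s (1 + k)%nat - s k))%C by ring.
    rewrite E; ring. }
  exists a0, a1, a2, b; intros k Hk.
  replace (y k) with (y k - s k + s k)%C by ring.
  rewrite Ha by auto; unfold s, pseq; ring.
Qed.

Lemma pseq_unique (w : C -> C) (ls : list C)
    (w_inj : ForallOrdPairs (fun l l' => w l <> w l') ls)
    (w_neq_1 : forall l, In l ls -> w l <> 1)
    (a0 a1 a2 : C) (b : nat -> C) :
  (forall k, (k < length ls + 3)%nat -> pseq ls w a0 a1 a2 b k = 0) ->
  a0 = 0 /\ a1 = 0 /\ a2 = 0 /\ forall f, esum ls b f = 0.
Proof.
  intros H.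
  assert (Hb : forall f, esum ls b f = 0).
  { destruct (esum_rescale ls b (fun l => (w l - 1) ^ 3)%C) as [b1 Hb1].
    assert (H1 : forall f, esum ls b1 f = 0).
    { apply (esum_pow_unique w ls w_inj); intros k Hk.
      rewrite Hb1, <- (pseq_diff3 ls w a0 a1 a2), !H by lia; ring. }
    intros f; rewrite <- (H1 (fun l => f l / (w l - 1) ^ 3)%C), Hb1.
    apply esum_ext; intros l Hl; field; apply Cminus_neq_0; auto. }
  assert (E0 := H 0%nat ltac:(lia)).
  assert (E1 := H 1%nat ltac:(lia)).
  assert (E2 := H 2%nat ltac:(lia)).
  unfold pseq in *; rewrite Hb in *; simpl in *.
  rewrite RtoC_plus in E2.
  assert (H2 : RtoC 2 <> 0) by (intros E; injection E; lra).
  assert (A0 : a0 = 0) by (rewrite <- E0; ring).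
  assert (A2 : a2 = 0).
  { replace a2 with (((a0 + a1 * (1 + 1) + a2 * ((1 + 1) * (1 + 1)) + 0)
      - 2 * (a0 + a1 * 1 + a2 * (1 * 1) + 0) + a0) / 2)%C by (field; auto).
    rewrite E1, E2, A0; field; auto. }
  repeat split; auto.
  rewrite <- E1, A0, A2; ring.
Qed.

(** * Triple averages *)

(** Differentiation is componentwise, so that the real derivative rules and the real fundamental
    theorem of calculus apply to each part. *)
Definition is_cderive (Q q : R -> C) : Prop :=
  forall x, is_derive (fun t => Re (Q t)) x (Re (q x))
         /\ is_derive (fun t => Im (Q t)) x (Im (q x)).

Lemma is_cderive_ext (Q Q' q q' : R -> C) :
  (forall x, Q x = Q' x) -> (forall x, q x = q' x) ->
  is_cderive Q q -> is_cderive Q' q'.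
Proof.
  intros HQ Hq H x; destruct (H x) as [H1 H2]; rewrite <- Hq; split.
  - eapply is_derive_ext; [|apply H1]; intros; simpl; rewrite HQ; reflexivity.
  - eapply is_derive_ext; [|apply H2]; intros; simpl; rewrite HQ; reflexivity.
Qed.

Lemma is_cderive_lin (Q1 q1 Q2 q2 : R -> C) (c d : C) :
  is_cderive Q1 q1 -> is_cderive Q2 q2 ->
  is_cderive (fun x => c * Q1 x + d * Q2 x)%C (fun x => c * q1 x + d * q2 x)%C.
Proof.
  intros H1 H2 x; destruct (H1 x) as [A1 B1], (H2 x) as [A2 B2].
  split; simpl.
  - apply (is_derive_ext (fun t => fst c * Re (Q1 t) - snd c * Im (Q1 t)
             + (fst d * Re (Q2 t) - snd d * Im (Q2 t)))); [reflexivity|].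
    apply @is_derive_plus; apply @is_derive_minus; apply is_derive_scal; assumption.
  - apply (is_derive_ext (fun t => fst c * Im (Q1 t) + snd c * Re (Q1 t)
             + (fst d * Im (Q2 t) + snd d * Re (Q2 t)))); [reflexivity|].
    apply @is_derive_plus; apply @is_derive_plus; apply is_derive_scal; assumption.
Qed.

Lemma is_cderive_shift (Q q : R -> C) (s : R) :
  is_cderive Q q -> is_cderive (fun x => Q (x + s)) (fun x => q (x + s)).
Proof.
  intros H x; destruct (H (x + s)) as [H1 H2]; split.
  - replace (Re (q (x + s))) with (scal 1 (Re (q (x + s)))) by apply Rmult_1_l.
    apply (is_derive_comp (fun t => Re (Q t)) (fun x => x + s)); [exact H1|].
    auto_derive; auto.
  - replace (Im (q (x + s))) with (scal 1 (Im (q (x + s)))) by apply Rmult_1_l.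
    apply (is_derive_comp (fun t => Im (Q t)) (fun x => x + s)); [exact H2|].
    auto_derive; auto.
Qed.

Lemma is_cderive_RtoC (F f : R -> R) :
  (forall x, is_derive F x (f x)) -> is_cderive (fun x => RtoC (F x)) (fun x => RtoC (f x)).
Proof.
  intros H x; split; simpl; [apply H|].
  apply is_derive_ext with (fun _ => 0); [reflexivity|apply @is_derive_const].
Qed.

Lemma is_cderive_Cexp (l : C) :
  is_cderive (fun x => Cexp (l * x)%C) (fun x => l * Cexp (l * x))%C.
Proof.
  destruct l as [u v]; intros x; split; unfold Cexp; simpl; auto_derive; auto; unfold Rminus; ring.
Qed.

Lemma is_cderive_esum (ls : list C) (b : nat -> C) (F f : C -> R -> C) :
  (forall l, In l ls -> is_cderive (F l) (f l)) ->
  is_cderive (fun x => esum ls b (fun l => F l x)) (fun x => esum ls b (fun l => f l x)).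
Proof.
  revert b; induction ls as [|l ls IH]; intros b H; simpl.
  - apply (is_cderive_RtoC (fun _ => 0) (fun _ => 0)); intros x; apply @is_derive_const.
  - apply (is_cderive_ext
      (fun x => b O * F l x + 1 * esum ls (fun n => b (S n)) (fun l => F l x))%C _
      (fun x => b O * f l x + 1 * esum ls (fun n => b (S n)) (fun l => f l x))%C);
      [intros; ring | intros; ring |].
    apply is_cderive_lin; [apply H; left; auto|].
    apply IH; intros; apply H; right; auto.
Qed.

(** The derivative [q'] enters to make the integrand [q] continuous, as the fundamental theorem
    requires. *)
Lemma CInt_cderive (Q q q' : R -> C) (a b : R) :
  is_cderive Q q -> is_cderive q q' -> CInt q a b = (Q b - Q a)%C.
Proof.
  intros H H'; unfold CInt; apply (is_RInt_unique (V := C_R_CompleteNormedModule)).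
  replace (Q b - Q a)%C
    with ((minus (Re (Q b)) (Re (Q a)), minus (Im (Q b)) (Im (Q a))) : C)
    by (destruct (Q b), (Q a); reflexivity).
  apply (is_RInt_fct_extend_pair (U := R_NormedModule) (V := R_NormedModule) q).
  - apply (is_RInt_derive (V := R_CompleteNormedModule) (fun t => Re (Q t)) (fun t => Re (q t))).
    + intros x _; apply H.
    + intros x _; apply (ex_derive_continuous (V := R_NormedModule)).
      exists (Re (q' x)); apply H'.
  - apply (is_RInt_derive (V := R_CompleteNormedModule) (fun t => Im (Q t)) (fun t => Im (q t))).
    + intros x _; apply H.
    + intros x _; apply (ex_derive_continuous (V := R_NormedModule)).
      exists (Im (q' x)); apply H'.
Qed.

Definition diff3 (h : R) (Q : R -> C) (x : R) : C :=
  (Q (x + 3 / 2 * h)%R - 3 * Q (x + h / 2)%R + 3 * Q (x - h / 2)%R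
   - Q (x - 3 / 2 * h)%R)%C.

Lemma triple_avg_primitive (h : R) (Q3 Q2 Q1 q q' : R -> C) (x : R) :
  is_cderive Q3 Q2 -> is_cderive Q2 Q1 -> is_cderive Q1 q -> is_cderive q q' ->
  triple_avg h q x = (diff3 h Q3 x / RtoC (h ^ 3))%C.
Proof.
  intros H3 H2 H1 H0; unfold triple_avg; f_equal.
  assert (HD : forall F f, is_cderive F f ->
    is_cderive (fun t => F (t + h / 2)%R - F (t - h / 2)%R)%C
               (fun t => f (t + h / 2)%R - f (t - h / 2)%R)%C).
  { intros F f HF.
    apply (is_cderive_ext (fun t => 1 * F (t + h / 2)%R + (-1) * F (t + - (h / 2))%R)%C _
      (fun t => 1 * f (t + h / 2)%R + (-1) * f (t + - (h / 2))%R)%C);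
      [intros; unfold Rminus; ring | intros; unfold Rminus; ring |].
    apply is_cderive_lin; apply is_cderive_shift; exact HF. }
  assert (E1 : (fun xi : R => CInt q (xi - h / 2) (xi + h / 2))
    = (fun t => Q1 (t + h / 2)%R - Q1 (t - h / 2)%R)%C).
  { apply functional_extensionality; intros t.
    apply (CInt_cderive _ _ q'); assumption. }
  rewrite E1.
  assert (E2 : (fun eta : R => CInt (fun t => Q1 (t + h / 2)%R - Q1 (t - h / 2)%R)%C
      (eta - h / 2) (eta + h / 2))
    = (fun s => (Q2 (s + h / 2 + h / 2)%R - Q2 (s + h / 2 - h / 2)%R)
        - (Q2 (s - h / 2 + h / 2)%R - Q2 (s - h / 2 - h / 2)%R))%C).
  { apply functional_extensionality; intros t.
    rewrite (CInt_cderive _ _ _ _ _ (HD _ _ H2) (HD _ _ H1)); reflexivity. }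
  rewrite E2.
  rewrite (CInt_cderive _ _ _ _ _ (HD _ _ (HD _ _ H3)) (HD _ _ (HD _ _ H2))).
  unfold diff3.
  replace (x + h / 2 + h / 2 + h / 2)%R with (x + 3 / 2 * h)%R by field.
  replace (x + h / 2 + h / 2 - h / 2)%R with (x + h / 2)%R by field.
  replace (x + h / 2 - h / 2 + h / 2)%R with (x + h / 2)%R by field.
  replace (x + h / 2 - h / 2 - h / 2)%R with (x - h / 2)%R by field.
  replace (x - h / 2 + h / 2 + h / 2)%R with (x + h / 2)%R by field.
  replace (x - h / 2 + h / 2 - h / 2)%R with (x - h / 2)%R by field.
  replace (x - h / 2 - h / 2 + h / 2)%R with (x - h / 2)%R by field.
  replace (x - h / 2 - h / 2 - h / 2)%R with (x - 3 / 2 * h)%R by field.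
  ring.
Qed.

(** * Spans of quadratics and exponentials, and the action of the triple average on them *)

Definition expspan (ls : list C) (q : R -> C) : Prop :=
  exists (a0 a1 a2 : C) (b : nat -> C), forall x : R,
    q x = (a0 + a1 * x + a2 * (x * x) + esum ls b (fun l => Cexp (l * x)))%C.

Lemma expspan_ext (ls : list C) (q q' : R -> C) :
  (forall x, q x = q' x) -> expspan ls q -> expspan ls q'.
Proof.
  intros E (a0 & a1 & a2 & b & H); exists a0, a1, a2, b.
  intros; rewrite <- E; apply H.
Qed.

Lemma expspan_lin (ls : list C) (q q' : R -> C) (c d : C) :
  expspan ls q -> expspan ls q' -> expspan ls (fun x => c * q x + d * q' x)%C.
Proof.
  intros (a0 & a1 & a2 & b & H) (a0' & a1' & a2' & b' & H').
  exists (c * a0 + d * a0')%C, (c * a1 + d * a1')%C, (c * a2 + d * a2')%C,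
    (fun n => c * b n + d * b' n)%C.
  intros x; rewrite H, H', esum_coef_lin; ring.
Qed.

Lemma expspan_shift (ls : list C) (q : R -> C) (s : R) :
  expspan ls q -> expspan ls (fun x => q (x + s)).
Proof.
  intros (a0 & a1 & a2 & b & H).
  destruct (esum_rescale ls b (fun l => Cexp (l * s))) as [b' Hb'].
  exists (a0 + a1 * s + a2 * (s * s))%C, (a1 + 2 * a2 * s)%C, a2, b'.
  intros x; rewrite H, Hb', RtoC_plus.
  rewrite (esum_ext ls b (fun l => Cexp (l * (x + s)))%C
    (fun l => Cexp (l * s) * Cexp (l * x))%C)
    by (intros; rewrite <- Cexp_plus; f_equal; ring).
  ring.
Qed.

Lemma expspan_quadratic (ls : list C) (a0 a1 a2 : C) :
  expspan ls (fun x => a0 + a1 * x + a2 * (x * x))%C.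
Proof.
  exists a0, a1, a2, (fun _ => RtoC 0).
  intros x; rewrite <- (Cplus_0_r (a0 + a1 * x + a2 * (x * x))) at 1; f_equal.
  generalize (fun l => Cexp (l * x)); intros f.
  induction ls as [|l ls IH]; simpl; [reflexivity|].
  rewrite <- IH; ring.
Qed.

Lemma Gamma5_expspan (lam : C) (q : R -> C) :
  Gamma5 lam q <-> expspan (lam :: (- lam)%C :: nil) q.
Proof.
  assert (E : forall x : R, (- (lam * x))%C = (- lam * x)%C) by (intros; ring).
  split.
  - intros (a0 & a1 & a2 & a3 & a4 & H).
    exists a0, a1, a2, (fun n => match n with O => a3 | _ => a4 end).
    intros x; rewrite H; simpl; rewrite E; ring.
  - intros (a0 & a1 & a2 & b & H).
    exists a0, a1, a2, (b 0%nat), (b 1%nat).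
    intros x; rewrite H; simpl; rewrite E; ring.
Qed.

Lemma Ci_neq_0 : Ci <> 0.
Proof. intros E; injection E; lra. Qed.

Lemma C2_neq_0 : RtoC 2 <> 0.
Proof. intros E; injection E; lra. Qed.

Lemma Gamma7_expspan (lam : C) (q : R -> C) :
  Gamma7 lam q
  <-> expspan (lam :: (- lam)%C :: (Ci * lam)%C :: (- (Ci * lam))%C :: nil) q.
Proof.
  assert (E1 : forall x : R, (- (lam * x))%C = (- lam * x)%C) by (intros; ring).
  assert (E2 : forall x : R, (Ci * (lam * x))%C = (Ci * lam * x)%C) by (intros; ring).
  assert (E3 : forall x : R, (- (Ci * lam * x))%C = (- (Ci * lam) * x)%C) by (intros; ring).
  assert (H2 := C2_neq_0). assert (Hi := Ci_neq_0).
  split.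
  - intros (a0 & a1 & a2 & a3 & a4 & a5 & a6 & H).
    exists a0, a1, a2, (fun n => match n with O => a3 | 1%nat => a4
       | 2%nat => (a5 / 2 + a6 / (2 * Ci)) | _ => (a5 / 2 - a6 / (2 * Ci)) end)%C.
    intros x; rewrite H; unfold Ccos, Csin; simpl; rewrite E1, E2, E3; field; auto.
  - intros (a0 & a1 & a2 & b & H).
    exists a0, a1, a2, (b 0%nat), (b 1%nat), (b 2%nat + b 3%nat)%C,
      (Ci * (b 2%nat - b 3%nat))%C.
    intros x; rewrite H; unfold Ccos, Csin; simpl; rewrite E1, E2, E3; field; auto.
Qed.

(* The eigenvalue of [M] on [exp (l x)]. *)
Definition avg_factor (h : R) (l : C) : C :=
  ((Cexp (l * (h / 2)%R) - Cexp (- l * (h / 2)%R)) ^ 3 / (l * h) ^ 3)%C.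

(** The averaging is diagonal on exponentials and fixes affine functions; each of the three averages
    adds [h^2/12] to a square, whence the term [h^2/4]. Centering at [x0] lets node values be read
    off as powers. *)
Lemma triple_avg_expspan (ls : list C) (h x0 : R) (a0 a1 a2 : C) (b : nat -> C)
    (q : R -> C) :
  h <> 0 -> (forall l, In l ls -> l <> 0) ->
  (forall x, q x = (a0 + a1 * (x - x0)%R + a2 * ((x - x0) * (x - x0))%R
                    + esum ls b (fun l => Cexp (l * (x - x0)%R)))%C) ->
  forall x, triple_avg h q x
    = (a0 + a2 * (h ^ 2 / 4)%R + a1 * (x - x0)%R + a2 * ((x - x0) * (x - x0))%R
       + esum ls b (fun l => avg_factor h l * Cexp (l * (x - x0)%R)))%C.
Proof.
  intros Hh Hls Hq x.
  (* One template for [q], its derivative and its three primitives: only the functions replacing 1,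
     t, t^2 and the multiplier of each exponential change. *)
  set (F := fun (p p1 p2 : R -> R) (e : C -> C) (x : R) =>
    (1 * (a0 * p (x - x0)%R + a1 * p1 (x - x0)%R)
     + 1 * (a2 * p2 (x - x0)%R
            + 1 * esum ls b (fun l => e l * Cexp (l * (x - x0)%R))))%C).
  assert (HF : forall p p' p1 p1' p2 p2' e e',
    (forall x, is_derive p x (p' x)) -> (forall x, is_derive p1 x (p1' x)) ->
    (forall x, is_derive p2 x (p2' x)) -> (forall l, In l ls -> e' l = e l * l)%C ->
    is_cderive (F p p1 p2 e) (F p' p1' p2' e')).
  { intros p p' p1 p1' p2 p2' e e' Hp Hp1 Hp2 He.
    assert (HS : forall (g g' : R -> R), (forall x, is_derive g x (g' x)) ->
      is_cderive (fun x => RtoC (g (x - x0))) (fun x => RtoC (g' (x - x0)))).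
    { intros g g' Hg; apply (is_cderive_shift (fun x => RtoC (g x))
        (fun x => RtoC (g' x)) (- x0)), is_cderive_RtoC; exact Hg. }
    apply is_cderive_lin; apply is_cderive_lin; try (apply HS; assumption).
    apply is_cderive_esum; intros l Hl.
    apply (is_cderive_ext (fun x => e l * Cexp (l * (x - x0)%R) + 0 * Cexp (l * (x - x0)%R))%C _
      (fun x => e l * (l * Cexp (l * (x - x0)%R)) + 0 * (l * Cexp (l * (x - x0)%R)))%C).
    - intros; ring.
    - intros y; rewrite He by auto; ring.
    - apply is_cderive_lin;
      apply (is_cderive_shift (fun x => Cexp (l * x)%C)
        (fun x => l * Cexp (l * x))%C (- x0)), is_cderive_Cexp. }
  rewrite (triple_avg_primitive h
    (F (fun t => t ^ 3 / 6) (fun t => t ^ 4 / 24) (fun t => t ^ 5 / 60) (fun l => / l ^ 3)%C)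
    (F (fun t => t ^ 2 / 2) (fun t => t ^ 3 / 6) (fun t => t ^ 4 / 12) (fun l => / l ^ 2)%C)
    (F (fun t => t) (fun t => t ^ 2 / 2) (fun t => t ^ 3 / 3) (fun l => / l)%C)
    q
    (F (fun t => 0) (fun t => 1) (fun t => 2 * t) (fun l => l)%C)).
  - unfold diff3, F.
    assert (Hh' : RtoC h <> 0) by (intros E; apply Hh; injection E; auto).
    set (G := fun (t : R) (l : C) => (/ l ^ 3 * Cexp (l * (t - x0)%R))%C).
    rewrite (esum_ext ls b (fun l => avg_factor h l * Cexp (l * (x - x0)%R))%C
      (fun l => / h ^ 3 * (1 * (1 * G (x + 3 / 2 * h)%R l + (-3) * G (x + h / 2)%R l)
              + 1 * (3 * G (x - h / 2)%R l + (-1) * G (x - 3 / 2 * h)%R l)))%C).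
    + rewrite esum_scal, !esum_lin; fold (G (x + 3 / 2 * h)) (G (x + h / 2)) (G (x - h / 2)) (G (x - 3 / 2 * h)).
      unfold Rminus, Rdiv; repeat (rewrite ?RtoC_plus, ?RtoC_opp, ?RtoC_mult, ?RtoC_pow);
      rewrite ?RtoC_inv by lra.
      field; repeat split; auto; intros E; injection E; lra.
    + intros l Hl; unfold G, avg_factor.
      assert (Hl0 := Hls l Hl).
      set (A := Cexp (l * (h / 2)%R)); set (A' := Cexp (- l * (h / 2)%R)).
      assert (HA : (A * A')%C = 1)
        by (unfold A, A'; rewrite <- Cexp_plus, <- Cexp_0; f_equal; ring).
      assert (S1 : forall t, Cexp (l * (t + h / 2)%R) = (Cexp (l * t) * A)%C)
        by (intros; unfold A; rewrite <- Cexp_plus, RtoC_plus; f_equal; ring).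
      assert (S2 : forall t, Cexp (l * (t - h / 2)%R) = (Cexp (l * t) * A')%C)
        by (intros; unfold A'; rewrite <- Cexp_plus, RtoC_minus; f_equal; ring).
      replace (x + 3 / 2 * h - x0) with (x - x0 + h / 2 + h / 2 + h / 2) by field.
      replace (x + h / 2 - x0) with (x - x0 + h / 2) by field.
      replace (x - h / 2 - x0) with (x - x0 - h / 2) by field.
      replace (x - 3 / 2 * h - x0) with (x - x0 - h / 2 - h / 2 - h / 2) by field.
      rewrite !S1, !S2.
      replace ((A - A') ^ 3)%C with (A ^ 3 - 3 * (A * A') * A + 3 * (A * A') * A' - A' ^ 3)%C by ring.
      rewrite HA; field; auto.
  - apply HF; try (intros y; auto_derive; auto; field).
    intros l Hl; field; auto.
  - apply HF; try (intros y; auto_derive; auto; field).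
    intros l Hl; field; auto.
  - apply (is_cderive_ext (F (fun t => t) (fun t => t ^ 2 / 2) (fun t => t ^ 3 / 3) (fun l => / l)%C)
      _ (F (fun t => 1) (fun t => t) (fun t => t ^ 2) (fun l => 1)%C)).
    + reflexivity.
    + intros y; rewrite Hq; unfold F.
      rewrite (esum_ext ls b (fun l => 1 * Cexp _)%C (fun l => Cexp (l * (y - x0)%R)))
        by (intros; ring).
      replace ((y - x0) ^ 2) with ((y - x0) * (y - x0)) by ring; ring.
    + apply HF; try (intros y; auto_derive; auto; field).
      intros l Hl; field; auto.
  - apply (is_cderive_ext (F (fun t => 1) (fun t => t) (fun t => t ^ 2) (fun l => 1)%C) _
      (F (fun t => 0) (fun t => 1) (fun t => 2 * t) (fun l => l)%C)).
    + intros y; rewrite Hq; unfold F.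
      rewrite (esum_ext ls b (fun l => 1 * Cexp _)%C (fun l => Cexp (l * (y - x0)%R)))
        by (intros; ring).
      replace ((y - x0) ^ 2) with ((y - x0) * (y - x0)) by ring; ring.
    + reflexivity.
    + apply HF; try (intros y; auto_derive; auto; field).
      intros l Hl; ring.
Qed.

(** * Interpolants and stencil coefficients *)

(** The bound 1/2 keeps [(l - l') * h] in the strip where [Cexp] is injective. Hence the nodes
    [Cexp (l * h)] are distinct and different from 1, and no averaging factor vanishes. *)
Definition admissible (ls : list C) (h : R) : Prop :=
  0 < h /\ NoDup ls /\ forall l, In l ls -> l <> 0 /\ Rabs (Im l) * h < 1 / 2.

Lemma RtoC_neq_0 (x : R) : x <> 0 -> RtoC x <> 0.
Proof. intros H E; apply H; injection E; auto. Qed.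

Lemma NoDup_ForallOrdPairs (w : C -> C) (ls : list C) :
  NoDup ls -> (forall l l', In l ls -> In l' ls -> w l = w l' -> l = l') ->
  ForallOrdPairs (fun l l' => w l <> w l') ls.
Proof.
  induction 1 as [|l ls Hl Hnd IH]; intros Hw; constructor.
  - apply Forall_forall; intros l' Hl' E; apply Hl.
    rewrite (Hw l l'); simpl; auto.
  - apply IH; intros; apply Hw; simpl; auto.
Qed.

Lemma Im_mult_real (l : C) (h : R) : Im (l * h)%C = Im l * h.
Proof. destruct l; simpl; ring. Qed.

Lemma admissible_nodes_inj (ls : list C) (h : R) : admissible ls h ->
  ForallOrdPairs (fun l l' => Cexp (l * h) <> Cexp (l' * h)) ls.
Proof.
  intros (Hh & Hnd & H).
  apply (NoDup_ForallOrdPairs (fun l => Cexp (l * h))); auto.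
  intros l l' Hl Hl' E.
  destruct (H l Hl) as [_ H1], (H l' Hl') as [_ H2].
  apply Cexp_inj in E.
  - assert (RtoC h <> 0) by (apply RtoC_neq_0; lra).
    replace l with (l * h / h)%C by (field; auto); rewrite E; field; auto.
  - rewrite !Im_mult_real.
    replace (Im l * h - Im l' * h) with (Im l * h + (- Im l' * h)) by ring.
    eapply Rle_lt_trans; [apply Rabs_triang|].
    rewrite !Rabs_mult, Rabs_Ropp, (Rabs_pos_eq h) by lra; lra.
Qed.

Lemma admissible_node_neq_1 (ls : list C) (h : R) : admissible ls h ->
  forall l, In l ls -> Cexp (l * h) <> 1.
Proof.
  intros (Hh & Hnd & H) l Hl E; destruct (H l Hl) as [H0 H1].
  apply Cexp_eq_1 in E.
  - apply (Cmult_neq_0 l h); auto; apply RtoC_neq_0; lra.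
  - rewrite Im_mult_real, Rabs_mult, (Rabs_pos_eq h) by lra; lra.
Qed.

Lemma avg_factor_neq_0 (ls : list C) (h : R) : admissible ls h ->
  forall l, In l ls -> avg_factor h l <> 0.
Proof.
  intros (Hh & Hnd & H) l Hl E; destruct (H l Hl) as [H0 H1].
  assert (Hlh : (l * h)%C <> 0) by (apply Cmult_neq_0; auto; apply RtoC_neq_0; lra).
  unfold avg_factor in E.
  revert E; apply Cmult_neq_0.
  - apply Cpow_nz, Cminus_neq_0; intros E.
    apply Cexp_inj in E.
    + apply Hlh; rewrite RtoC_div in E by lra.
      replace (l * h)%C with (l * (h / 2) - - l * (h / 2))%C by (field; apply C2_neq_0).
      rewrite E; ring.
    + rewrite !Im_mult_real.
      replace (Im l * (h / 2) - Im (- l) * (h / 2)) with (Im l * h)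
        by (destruct l; simpl; field).
      rewrite Rabs_mult, (Rabs_pos_eq h) by lra; lra.
  - intros E. apply (Cpow_nz _ 3 Hlh).
    replace ((l * h) ^ 3)%C with ((l * h) ^ 3 * ((l * h) ^ 3 * / (l * h) ^ 3))%C
      by (field; split; auto; apply RtoC_neq_0; lra).
    rewrite E; ring.
Qed.

Lemma expspan_interp_exists (ls : list C) (h x0 : R) (y : nat -> C) :
  admissible ls h ->
  exists q, expspan ls q /\
    forall k, (k < length ls + 3)%nat -> triple_avg h q (x0 + INR k * h) = y k.
Proof.
  intros Had; assert (Hh : 0 < h) by apply Had.
  assert (Hhc : RtoC h <> 0) by (apply RtoC_neq_0; lra).
  destruct (pseq_exists (fun l => Cexp (l * h)) ls (admissible_nodes_inj ls h Had)
    (admissible_node_neq_1 ls h Had) y) as (a0 & a1 & a2 & b & H).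
  destruct (esum_rescale ls b (fun l => / avg_factor h l)%C) as [b' Hb'].
  set (c2 := (a2 / (h * h))%C).
  (* The constant is lowered by what averaging the square adds, and each exponential coefficient is
     divided by its averaging factor. *)
  set (q := fun x : R => (a0 - c2 * (h ^ 2 / 4)%R + a1 / h * (x - x0)%R + c2 * ((x - x0) * (x - x0))%R
                    + esum ls b' (fun l => Cexp (l * (x - x0)%R)))%C).
  exists q; split.
  - apply (expspan_ext ls (fun x => (fun z : R => a0 - c2 * (h ^ 2 / 4)%R + a1 / h * z + c2 * (z * z)
                    + esum ls b' (fun l => Cexp (l * z)))%C (x + - x0))).
    + intros x; unfold q; rewrite !RtoC_mult; unfold Rminus; reflexivity.
    + apply (expspan_shift ls (fun z : R => a0 - c2 * (h ^ 2 / 4)%R + a1 / h * z + c2 * (z * z)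
                    + esum ls b' (fun l => Cexp (l * z)))%C).
      eexists _, _, _, _; intros; reflexivity.
  - intros k Hk; rewrite <- (H k Hk).
    rewrite (triple_avg_expspan ls h x0 (a0 - c2 * (h ^ 2 / 4)%R) (a1 / h) c2 b' q);
      [|lra|apply Had|reflexivity].
    rewrite Hb', (esum_ext ls b _ (fun l => Cexp (l * h) ^ k)%C).
    + unfold pseq, c2.
      replace (x0 + INR k * h - x0) with (INR k * h) by ring.
      rewrite !RtoC_mult; field; auto.
    + intros l Hl; rewrite Cexp_pow.
      replace (x0 + INR k * h - x0) with (INR k * h) by ring.
      replace (l * h * INR k)%C with (l * (INR k * h)%R)%C by (rewrite RtoC_mult; ring).
      field; apply (avg_factor_neq_0 ls); auto.
Qed.

Lemma expspan_centered (ls : list C) (q : R -> C) (x0 : R) : expspan ls q ->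
  exists a0 a1 a2 b, forall x, q x = (a0 + a1 * (x - x0)%R + a2 * ((x - x0) * (x - x0))%R
                    + esum ls b (fun l => Cexp (l * (x - x0)%R)))%C.
Proof.
  intros H; apply (expspan_shift ls q x0) in H.
  destruct H as (a0 & a1 & a2 & b & H); exists a0, a1, a2, b; intros x.
  rewrite RtoC_mult, <- H; f_equal; ring.
Qed.

Lemma expspan_interp_unique (ls : list C) (h x0 : R) (q : R -> C) :
  admissible ls h -> expspan ls q ->
  (forall k, (k < length ls + 3)%nat -> triple_avg h q (x0 + INR k * h) = 0) ->
  forall x, q x = 0.
Proof.
  intros Had Hq H; assert (Hh : 0 < h) by apply Had.
  assert (Hhc : RtoC h <> 0) by (apply RtoC_neq_0; lra).
  destruct (expspan_centered ls q x0 Hq) as (a0 & a1 & a2 & b & E).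
  destruct (esum_rescale ls b (avg_factor h)) as [b' Hb'].
  destruct (pseq_unique (fun l => Cexp (l * h)) ls (admissible_nodes_inj ls h Had)
    (admissible_node_neq_1 ls h Had) (a0 + a2 * (h ^ 2 / 4)%R)%C (a1 * h)%C (a2 * (h * h))%C b')
    as (Z0 & Z1 & Z2 & Zb).
  - intros k Hk; rewrite <- (H k Hk).
    rewrite (triple_avg_expspan ls h x0 a0 a1 a2 b q); [|lra|apply Had|exact E].
    replace (x0 + INR k * h - x0) with (INR k * h) by ring.
    unfold pseq; rewrite Hb'.
    rewrite (esum_ext ls b _ (fun l => avg_factor h l * Cexp (l * (INR k * h)%R))%C).
    + rewrite !RtoC_mult; ring.
    + intros l Hl; rewrite Cexp_pow, RtoC_mult; do 2 f_equal; ring.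
  - assert (A1 : a1 = 0).
    { replace a1 with (a1 * h / h)%C by (field; auto); rewrite Z1; field; auto. }
    assert (A2 : a2 = 0).
    { replace a2 with (a2 * (h * h) / (h * h))%C by (field; auto); rewrite Z2; field; auto. }
    assert (A0 : a0 = 0) by (rewrite <- Z0, A2; ring).
    intros x; rewrite E, A0, A1, A2.
    replace (esum ls b (fun l => Cexp (l * (x - x0)%R))) with (RtoC 0); [ring|].
    rewrite <- (Zb (fun l => Cexp (l * (x - x0)%R) / avg_factor h l)%C), Hb'.
    apply esum_ext; intros l Hl; field; apply (avg_factor_neq_0 ls); auto.
Qed.

Lemma triple_avg_lin (ls : list C) (h x : R) (q q' : R -> C) (c d : C) :
  h <> 0 -> (forall l, In l ls -> l <> 0) -> expspan ls q -> expspan ls q' ->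
  triple_avg h (fun x => c * q x + d * q' x)%C x
  = (c * triple_avg h q x + d * triple_avg h q' x)%C.
Proof.
  intros Hh Hls Hq Hq'.
  destruct (expspan_centered ls q x Hq) as (a0 & a1 & a2 & b & E).
  destruct (expspan_centered ls q' x Hq') as (a0' & a1' & a2' & b' & E').
  rewrite (triple_avg_expspan ls h x a0 a1 a2 b q Hh Hls E).
  rewrite (triple_avg_expspan ls h x a0' a1' a2' b' q' Hh Hls E').
  rewrite (triple_avg_expspan ls h x (c * a0 + d * a0') (c * a1 + d * a1')
    (c * a2 + d * a2') (fun n => c * b n + d * b' n)%C); auto.
  - rewrite esum_coef_lin; ring.
  - intros; rewrite E, E', esum_coef_lin; ring.
Qed.

Lemma node_add (h xi : R) (lo : Z) (k : nat) :
  node h xi (lo + Z.of_nat k) = node h xi lo + INR k * h.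
Proof. unfold node; rewrite plus_IZR, <- INR_IZR_INZ; ring. Qed.

(** By uniqueness in the span, the function selected by [epsilon] is any solution one can
    exhibit. *)
Lemma interpolant_eq (ls : list C) (G : (R -> C) -> Prop) (h xi : R) (lo : Z)
    (N : nat) (v : R -> R) (q : R -> C) :
  admissible ls h -> (forall f, G f <-> expspan ls f) -> (N = length ls + 2)%nat ->
  expspan ls q ->
  (forall k, (k <= N)%nat -> triple_avg h q (node h xi (lo + Z.of_nat k))
       = RtoC (v (node h xi (lo + Z.of_nat k)))) ->
  interpolant G h xi lo N v = q.
Proof.
  intros Had HG HN Hq H.
  assert (HS : exists f, G f /\ forall k, (k <= N)%nat ->
    triple_avg h f (node h xi (lo + Z.of_nat k)) = RtoC (v (node h xi (lo + Z.of_nat k)))).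
  { exists q; split; auto; apply HG; exact Hq. }
  apply (epsilon_spec (inhabits (fun _ : R => RtoC 0))) in HS.
  change (epsilon _ _) with (interpolant G h xi lo N v) in HS.
  destruct HS as [HS1 HS2]; set (p := interpolant G h xi lo N v) in *.
  apply HG in HS1.
  apply functional_extensionality; intros x.
  assert (E : (1 * p x + (-1) * q x)%C = 0).
  { apply (expspan_interp_unique ls h (node h xi lo) (fun x => 1 * p x + (-1) * q x)%C Had).
    - apply expspan_lin; auto.
    - intros k Hk.
      rewrite (triple_avg_lin ls); auto; [|assert (0 < h) by apply Had; lra|apply Had].
      rewrite <- node_add, HS2, H by lia; ring. }
  replace (p x) with (1 * p x + (-1) * q x + q x)%C by ring; rewrite E; ring.
Qed.

Ltac eq_as_C := match goal with |- @eq _ ?a ?b => change (@eq C a b) end.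

Lemma sum_n_delta (f : nat -> C) (j n : nat) :
  sum_n (fun k => f k * (if Nat.eq_dec j k then RtoC 1 else RtoC 0))%C n
  = if le_dec j n then f j else RtoC 0.
Proof.
  induction n as [|n IH].
  - rewrite sum_O; destruct (Nat.eq_dec j 0), (le_dec j 0); subst; try lia; eq_as_C; ring.
  - rewrite sum_Sn, IH; change plus with Cplus.
    destruct (Nat.eq_dec j (S n)), (le_dec j (S n)), (le_dec j n); subst; try lia; eq_as_C; ring.
Qed.

Lemma expspan_sum_n (ls : list C) (h : R) (a : nat -> C) (p : nat -> R -> C) (n : nat) :
  h <> 0 -> (forall l, In l ls -> l <> 0) -> (forall k, expspan ls (p k)) ->
  expspan ls (fun x => sum_n (fun k => a k * p k x)%C n) /\
  forall x, triple_avg h (fun x => sum_n (fun k => a k * p k x)%C n) x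
    = sum_n (fun k => a k * triple_avg h (p k) x)%C n.
Proof.
  intros Hh Hls Hp; induction n as [|n [IH1 IH2]].
  - assert (E : (fun x => sum_n (fun k => a k * p k x)%C 0)
      = (fun x => a O * p O x + 0 * p O x)%C)
      by (apply functional_extensionality; intros x; rewrite sum_O; eq_as_C; ring).
    rewrite E; split; [apply expspan_lin; auto|].
    intros x; rewrite (triple_avg_lin ls), sum_O; auto; eq_as_C; ring.
  - assert (E : (fun x => sum_n (fun k => a k * p k x)%C (S n))
      = (fun x => 1 * sum_n (fun k => a k * p k x)%C n + a (S n) * p (S n) x)%C)
      by (apply functional_extensionality; intros x; rewrite sum_Sn;
          change plus with Cplus; eq_as_C; ring).
    rewrite E; split; [apply expspan_lin; auto|].
    intros x; rewrite (triple_avg_lin ls), IH2, sum_Sn; auto.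
    change plus with Cplus; eq_as_C; ring.
Qed.

Lemma second_diff_sum_n (h xi : R) (a : nat -> C) (p : nat -> R -> C) (n : nat) :
  second_diff h xi (fun x => sum_n (fun k => a k * p k x)%C n)
  = sum_n (fun k => second_diff h xi (p k) * a k)%C n.
Proof.
  unfold second_diff; induction n as [|n IH].
  - rewrite !sum_O; eq_as_C; ring.
  - rewrite !sum_Sn, <- IH; change plus with Cplus; eq_as_C; ring.
Qed.

Lemma stencil_coef_spec (ls : list C) (G : (R -> C) -> Prop) (h xi : R) (lo : Z) (N : nat) :
  admissible ls h -> (forall f, G f <-> expspan ls f) -> (N = length ls + 2)%nat ->
  forall v : R -> R,
    second_diff h xi (interpolant G h xi lo N v)
    = sum_n (fun k => (stencil_coef G h xi lo N k
                       * RtoC (v (node h xi (lo + Z.of_nat k))))%C) N.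
Proof.
  intros Had HG HN; unfold stencil_coef.
  apply (epsilon_spec (inhabits (fun _ : nat => RtoC 0))
    (fun c : nat -> C => forall v : R -> R, second_diff h xi (interpolant G h xi lo N v)
       = sum_n (fun k => (c k * RtoC (v (node h xi (lo + Z.of_nat k))))%C) N)).
  assert (Hh : h <> 0) by (assert (0 < h) by apply Had; lra).
  (* [P j] characterizes the cardinal function of node [j]. Its second difference is the coefficient
     sought, since the interpolant of any data is the combination of cardinal functions. *)
  set (P := fun (j : nat) q => expspan ls q /\ forall k, (k < length ls + 3)%nat ->
     triple_avg h q (node h xi lo + INR k * h) = if Nat.eq_dec k j then RtoC 1 else RtoC 0).
  assert (HP : forall j, exists q, P j q)
    by (intros j; apply (expspan_interp_exists ls h (node h xi lo)); exact Had).
  set (p := fun j => proj1_sig (constructive_indefinite_description _ (HP j))).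
  assert (Hp : forall j, P j (p j)) by (intros j; unfold p; destruct constructive_indefinite_description; auto).
  exists (fun k => second_diff h xi (p k)); intros v.
  destruct (expspan_sum_n ls h (fun k => RtoC (v (node h xi (lo + Z.of_nat k)))) p N Hh
    ltac:(apply Had) ltac:(apply Hp)) as [H1 H2].
  rewrite (interpolant_eq ls G h xi lo N v _ Had HG HN H1).
  - apply second_diff_sum_n.
  - intros j Hj; rewrite H2.
    rewrite (sum_n_ext_loc _ (fun k => RtoC (v (node h xi (lo + Z.of_nat k)))
      * (if Nat.eq_dec j k then RtoC 1 else RtoC 0))%C).
    + rewrite sum_n_delta; destruct (le_dec j N); [reflexivity|lia].
    + intros k Hk; rewrite (node_add h xi lo j); destruct (Hp k) as [_ E]; rewrite E by lia.
      reflexivity.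
Qed.

Lemma stencil_coef_exact (ls : list C) (G : (R -> C) -> Prop) (h xi : R) (lo : Z)
    (N : nat) (q : R -> C) (v : R -> R) :
  admissible ls h -> (forall f, G f <-> expspan ls f) -> (N = length ls + 2)%nat ->
  expspan ls q ->
  (forall x, triple_avg h q x = RtoC (v x)) ->
  second_diff h xi q = sum_n (fun k => (stencil_coef G h xi lo N k
                       * RtoC (v (node h xi (lo + Z.of_nat k))))%C) N.
Proof.
  intros Had HG HN Hq Hv; rewrite <- (stencil_coef_spec ls) by auto.
  rewrite (interpolant_eq ls G h xi lo N v q) by auto; reflexivity.
Qed.

(** * Real exponential families *)

(** The mean value theorem gives up the factor [1/(n+1)] that integration would yield; only the
    power of the distance matters in the estimates below. *)
Lemma mvt_pow_bound (f df : R -> R) (y r K : R) (n : nat) :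
  (forall x, Rabs (x - y) <= r -> is_derive f x (df x)) ->
  (forall x, Rabs (x - y) <= r -> Rabs (df x) <= K * Rabs (x - y) ^ n) ->
  0 <= K -> f y = 0 ->
  forall x, Rabs (x - y) <= r -> Rabs (f x) <= K * Rabs (x - y) ^ S n.
Proof.
  intros Hd Hb HK Hy x Hx.
  assert (Hc : forall c, Rmin y x <= c <= Rmax y x -> Rabs (c - y) <= Rabs (x - y)).
  { intros c; unfold Rmin, Rmax, Rabs; destruct (Rle_dec y x), (Rcase_abs (c - y)), (Rcase_abs (x - y)); lra. }
  destruct (MVT_gen f y x df) as (c & Hcc & E).
  - intros z Hz; apply Hd; eapply Rle_trans; [apply Hc; lra|exact Hx].
  - intros z Hz; apply continuity_pt_filterlim, (ex_derive_continuous (V := R_NormedModule)).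
    exists (df z); apply Hd; eapply Rle_trans; [apply Hc; lra|exact Hx].
  - rewrite Hy, Rminus_0_r in E; rewrite E, Rabs_mult.
    simpl; rewrite (Rmult_comm (Rabs (x - y))), <- Rmult_assoc.
    apply Rmult_le_compat_r; [apply Rabs_pos|].
    eapply Rle_trans; [apply Hb; eapply Rle_trans; [apply Hc; lra|exact Hx]|].
    apply Rmult_le_compat_l; auto.
    apply pow_incr; split; [apply Rabs_pos|apply Hc; lra].
Qed.

Lemma derive_unique_primitive (f g d : R -> R) :
  (forall x, is_derive f x (d x)) -> (forall x, is_derive g x (d x)) ->
  f 0 = g 0 -> forall x, f x = g x.
Proof.
  intros Hf Hg H0 x.
  assert (H : Rabs (f x - g x) <= 0 * Rabs (x - 0) ^ 1).
  { apply (mvt_pow_bound (fun x => f x - g x) (fun x => 0) 0 (Rabs (x - 0))); try lra.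
    - intros z _; replace 0 with (d z - d z) by ring; apply @is_derive_minus; auto.
    - intros z _; rewrite Rabs_R0; lra. }
  rewrite Rmult_0_l in H; assert (H1 := Rabs_pos (f x - g x)).
  destruct (Req_dec (f x - g x) 0) as [E|E]; [lra|].
  apply Rabs_no_R0 in E; lra.
Qed.

(* [F n] is the series sum_k s^k x^(n+pk) / (n+pk)!. *)
Definition exp_family (p : nat) (s : R) (F : nat -> R -> R) : Prop :=
  (forall n x, is_derive (F (S n)) x (F n x)) /\ (forall n, F (S n) 0 = 0) /\
  (forall n x, F n x = x ^ n / INR (fact n) + s * F (p + n)%nat x).

Lemma is_derive_monomial (n : nat) (x : R) :
  is_derive (fun x => x ^ S n / INR (fact (S n))) x (x ^ n / INR (fact n)).
Proof.
  assert (H := INR_fact_neq_0 n).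
  assert (Hn : INR (S n) <> 0) by (apply not_0_INR; lia).
  replace (x ^ n / INR (fact n))
    with (/ INR (fact (S n)) * (INR (S n) * 1 * x ^ pred (S n)))
    by (rewrite fact_simpl, mult_INR; simpl pred; field; auto).
  apply (is_derive_ext (fun x => / INR (fact (S n)) * x ^ S n));
    [intros; apply Rmult_comm|].
  apply is_derive_scal, is_derive_pow, @is_derive_id.
Qed.

(** Closed forms are supplied up to index [p], so that the functional equation at index 0 can be
    checked directly. Later members are integrals from 0, and the equation passes from [n] to [S n]
    because both sides have equal derivatives and equal values at 0. *)
Lemma exp_family_exists (p : nat) (s : R) (f : nat -> R -> R) :
  (0 < p)%nat ->
  (forall n x, (n < p)%nat -> is_derive (f (S n)) x (f n x)) ->
  (forall n, (n < p)%nat -> f (S n) 0 = 0) ->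
  (forall x, f O x = 1 + s * f p x) ->
  exists F, exp_family p s F /\ forall n x, (n <= p)%nat -> F n x = f n x.
Proof.
  intros Hp Hd H0 Hf.
  set (F := fix F n := match n with O => f O
    | S m => if le_dec (S m) p then f (S m) else fun x => RInt (F m) 0 x end).
  assert (Ff : forall n x, (n <= p)%nat -> F n x = f n x).
  { intros [|n] x Hn; [reflexivity|].
    change (F (S n)) with (if le_dec (S n) p then f (S n) else fun x => RInt (F n) 0 x).
    destruct (le_dec (S n) p); [reflexivity|lia]. }
  assert (HD : forall n, (forall x, ex_derive (F n) x) /\
                         (forall x, is_derive (F (S n)) x (F n x))).
  { induction n as [|n [IH1 IH2]].
    - assert (A : forall x, ex_derive (F O) x).
      { intros x; apply (ex_derive_ext (fun x => 1 + s * f p x)); [intros; symmetry; apply Hf|].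
        destruct p as [|p]; [lia|]; auto_derive; repeat split; exists (f p x); auto. }
      split; auto; intros x.
      apply (is_derive_ext (f 1%nat)); [intros; rewrite Ff; auto; lia|].
      apply Hd; lia.
    - assert (A : forall x, ex_derive (F (S n)) x) by (intros x; exists (F n x); auto).
      split; auto; intros x.
      destruct (le_dec (S (S n)) p) as [L|L].
      + apply (is_derive_ext (f (S (S n)))); [intros; rewrite Ff; auto; lia|].
        rewrite Ff by lia; apply Hd; lia.
      + apply (is_derive_ext (fun x => RInt (F (S n)) 0 x)).
        { intros t; change (F (S (S n))) with (if le_dec (S (S n)) p then f (S (S n))
            else fun x => RInt (F (S n)) 0 x).
          destruct (le_dec (S (S n)) p); [lia|reflexivity]. }
        assert (Hc : forall x, continuous (F (S n)) x)
          by (intros; apply (ex_derive_continuous (V := R_NormedModule)); auto).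
        apply (is_derive_RInt (V := R_NormedModule) (F (S n)) _ 0 x); auto.
        apply filter_forall; intros b; apply (RInt_correct (V := R_CompleteNormedModule)).
        apply (ex_RInt_continuous (V := R_CompleteNormedModule)); auto. }
  assert (HZ : forall n, F (S n) 0 = 0).
  { intros n; destruct (le_dec (S n) p) as [L|L].
    - rewrite Ff by lia; apply H0; lia.
    - change (F (S n)) with (if le_dec (S n) p then f (S n) else fun x => RInt (F n) 0 x).
      destruct (le_dec (S n) p); [lia|]; apply (RInt_point (V := R_CompleteNormedModule)). }
  exists F; split; auto; split; [apply HD|split; auto].
  induction n as [|n IH]; intros x.
  - rewrite Nat.add_0_r, !Ff, Hf by lia; simpl; field.
  - revert x; apply derive_unique_primitive with (F n).
    + apply HD.
    + intros x; rewrite IH.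
      apply @is_derive_plus; [apply is_derive_monomial|].
      apply is_derive_scal.
      replace (p + S n)%nat with (S (p + n)) by lia; apply HD.
    + rewrite HZ; replace (p + S n)%nat with (S (p + n)) by lia.
      rewrite HZ; simpl pow; field; apply INR_fact_neq_0.
Qed.

(** [F 0] is bounded on [-1, 1] by continuity; repeated integration gives [F n] the factor [|x|^n]
    with the same constant for all [n], and the functional equation expresses the remainder as
    [s * F (p + n)]. *)
Lemma exp_family_bound (p : nat) (s : R) (F : nat -> R -> R) :
  exp_family p s F -> (0 < p)%nat ->
  exists K, 0 <= K /\ forall n x, Rabs x <= 1 ->
    Rabs (F n x - x ^ n / INR (fact n)) <= K * Rabs x ^ (p + n).
Proof.
  intros (HD & HZ & HF) Hp.
  assert (Hc : forall x, continuous (F O) x).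
  { intros x; apply (ex_derive_continuous (V := R_NormedModule)).
    apply (ex_derive_ext (fun x => 1 + s * F (p + 0)%nat x));
      [intros; rewrite (HF O); simpl; field|].
    rewrite Nat.add_0_r; destruct p as [|p]; [lia|].
    auto_derive; repeat split; exists (F p x); auto. }
  destruct (continuity_ab_maj (fun x => Rabs (F O x)) (-1) 1) as (xm & Hm & _); [lra| |].
  { intros c _; apply continuity_pt_filterlim.
    apply continuous_comp; [apply Hc|apply continuous_Rabs]. }
  set (K := Rabs (F O xm)).
  assert (HK : 0 <= K) by apply Rabs_pos.
  assert (HB : forall n x, Rabs (x - 0) <= 1 -> Rabs (F n x) <= K * Rabs (x - 0) ^ n).
  { induction n as [|n IH]; intros x Hx.
    - simpl; rewrite Rmult_1_r; apply Hm; rewrite Rminus_0_r in Hx.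
      apply Rabs_le_between in Hx; lra.
    - apply (mvt_pow_bound (F (S n)) (F n) 0 1); auto. }
  exists (Rabs s * K); split; [apply Rmult_le_pos; auto; apply Rabs_pos|].
  intros n x Hx; rewrite (HF n x).
  replace (x ^ n / INR (fact n) + s * F (p + n)%nat x - x ^ n / INR (fact n))
    with (s * F (p + n)%nat x) by ring.
  rewrite Rabs_mult, Rmult_assoc; apply Rmult_le_compat_l; [apply Rabs_pos|].
  rewrite <- (Rminus_0_r x) at 2; apply HB; rewrite Rminus_0_r; auto.
Qed.

Lemma esum_unit (ls : list C) (l : C) : In l ls ->
  exists b, forall f, esum ls b f = f l.
Proof.
  assert (Z : forall ls f, esum ls (fun _ => RtoC 0) f = 0).
  { clear; intros ls f; induction ls as [|l ls IH]; simpl; [reflexivity|].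
    rewrite IH; ring. }
  induction ls as [|l' ls IH]; intros H; [destruct H|destruct H as [E|H]].
  - subst l'; exists (fun n => match n with O => RtoC 1 | _ => RtoC 0 end).
    intros f; simpl; rewrite Z; ring.
  - destruct (IH H) as [b Hb].
    exists (fun n => match n with O => RtoC 0 | S n => b n end).
    intros f; simpl; change (fun n => b n) with b; rewrite Hb; ring.
Qed.

Lemma expspan_Cexp (ls : list C) (l : C) : In l ls ->
  expspan ls (fun x => Cexp (l * x)).
Proof.
  intros H; destruct (esum_unit ls l H) as [b Hb].
  exists 0, 0, 0, b; intros x; rewrite Hb; ring.
Qed.

(** The functional equation is solved for [F (p + m)], which lies in the span as long as [x^m] does.
    Quadratics are available, so the range ends at [p + 2]. *)
Lemma exp_family_expspan (ls : list C) (p : nat) (s : R) (F : nat -> R -> R) :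
  exp_family p s F -> s <> 0 -> (0 < p)%nat ->
  (forall n, (n < p)%nat -> expspan ls (fun x => RtoC (F n x))) ->
  forall n, (n <= p + 2)%nat -> expspan ls (fun x => RtoC (F n x)).
Proof.
  intros (HD & HZ & HF) Hs Hp Hb n.
  induction n as [n IH] using (well_founded_induction lt_wf); intros Hn.
  destruct (lt_dec n p) as [L|L]; [auto|].
  set (m := (n - p)%nat); assert (Em : n = (p + m)%nat) by lia.
  assert (Hm : expspan ls (fun x => RtoC (F m x))) by (apply IH; lia).
  apply (expspan_ext ls (fun x => (RtoC (/ s) * RtoC (F m x)
      + RtoC (- / s) * RtoC (x ^ m / INR (fact m)))%C)).
  - intros x; rewrite <- !RtoC_mult, <- RtoC_plus; f_equal.
    rewrite (HF m x), Em; field; split; auto; apply INR_fact_neq_0.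
  - apply expspan_lin; auto.
    assert (Hm2 : (m <= 2)%nat) by lia.
    destruct m as [|[|[|m]]]; [| | |lia].
    + apply (expspan_ext ls (fun x : R => 1 + 0 * x + 0 * (x * x))%C);
        [|apply expspan_quadratic].
      intros x; simpl; unfold Rdiv; rewrite Rinv_1, Rmult_1_r; ring.
    + apply (expspan_ext ls (fun x : R => 0 + 1 * x + 0 * (x * x))%C);
        [|apply expspan_quadratic].
      intros x; simpl; unfold Rdiv; rewrite Rinv_1, !Rmult_1_r; ring.
    + apply (expspan_ext ls (fun x : R => 0 + 0 * x + / 2 * (x * x))%C);
        [|apply expspan_quadratic].
      intros x; replace (x ^ 2 / INR (fact 2)) with (/ 2 * (x * x)) by (simpl; field).
      rewrite !RtoC_mult, RtoC_inv by lra; ring.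
Qed.

(** * Hyperbolic and trigonometric families *)

Lemma Cexp_real (r : R) : Cexp r = RtoC (exp r).
Proof.
  unfold Cexp; simpl; rewrite cos_0, sin_0; apply injective_projections; simpl; ring.
Qed.

Lemma Cexp_imag (r : R) : Cexp (Ci * r) = (cos r + Ci * sin r)%C.
Proof.
  unfold Cexp; simpl.
  replace (0 * r - 1 * 0) with 0 by ring; replace (0 * 0 + 1 * r) with r by ring.
  rewrite exp_0; apply injective_projections; simpl; ring.
Qed.

Lemma expspan_cosh_sinh (ls : list C) (nu : R) : nu <> 0 ->
  In (RtoC nu) ls -> In (RtoC (- nu)) ls ->
  expspan ls (fun x => RtoC ((exp (nu * x) + exp (- (nu * x))) / 2)) /\
  expspan ls (fun x => RtoC ((exp (nu * x) - exp (- (nu * x))) / (2 * nu))).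
Proof.
  intros Hnu H1 H2; apply expspan_Cexp in H1; apply expspan_Cexp in H2.
  assert (E : forall (r x : R), Cexp (r * x) = RtoC (exp (r * x)))
    by (intros; rewrite <- RtoC_mult; apply Cexp_real).
  split.
  - eapply expspan_ext; [|apply (expspan_lin _ _ _ (/ 2) (/ 2) H1 H2)].
    intros x; simpl; rewrite !E.
    replace (- nu * x) with (- (nu * x)) by ring.
    rewrite RtoC_div, RtoC_plus by lra; field; apply C2_neq_0.
  - eapply expspan_ext; [|apply (expspan_lin _ _ _ (/ (2 * nu)) (- / (2 * nu)) H1 H2)].
    intros x; simpl; rewrite !E.
    replace (- nu * x) with (- (nu * x)) by ring.
    rewrite RtoC_div, RtoC_minus, RtoC_mult by lra; field.
    apply RtoC_neq_0; auto.
Qed.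

Lemma expspan_cos_sin (ls : list C) (nu : R) : nu <> 0 ->
  In (Ci * nu)%C ls -> In (- (Ci * nu))%C ls ->
  expspan ls (fun x => RtoC (cos (nu * x))) /\
  expspan ls (fun x => RtoC (sin (nu * x) / nu)).
Proof.
  intros Hnu H1 H2; apply expspan_Cexp in H1; apply expspan_Cexp in H2.
  assert (E1 : forall x : R, Cexp (Ci * nu * x) = (cos (nu * x) + Ci * sin (nu * x))%C)
    by (intros; rewrite <- Cexp_imag, RtoC_mult; f_equal; ring).
  assert (E2 : forall x : R, Cexp (- (Ci * nu) * x) = (cos (nu * x) - Ci * sin (nu * x))%C).
  { intros; replace (- (Ci * nu) * x)%C with (Ci * RtoC (- (nu * x)))%C
      by (rewrite RtoC_opp, RtoC_mult; ring).
    rewrite Cexp_imag, cos_neg, sin_neg, RtoC_opp; ring. }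
  split.
  - eapply expspan_ext; [|apply (expspan_lin _ _ _ (/ 2) (/ 2) H1 H2)].
    intros x; simpl; rewrite E1, E2; field; apply C2_neq_0.
  - eapply expspan_ext; [|apply (expspan_lin _ _ _ (/ (2 * Ci * nu)) (- / (2 * Ci * nu)) H1 H2)].
    intros x; simpl; rewrite E1, E2, RtoC_div by lra; field.
    repeat split; try apply Ci_neq_0; apply RtoC_neq_0; auto; lra.
Qed.

Lemma exp_family_real (lam : R) : lam <> 0 ->
  exists F, exp_family 2 (lam * lam) F /\
   (forall x, F 0%nat x = (exp (lam * x) + exp (- (lam * x))) / 2) /\
   (forall x, F 1%nat x = (exp (lam * x) - exp (- (lam * x))) / (2 * lam)).
Proof.
  intros H.
  destruct (exp_family_exists 2 (lam * lam) (fun n x => match n with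
    | O => (exp (lam * x) + exp (- (lam * x))) / 2
    | 1%nat => (exp (lam * x) - exp (- (lam * x))) / (2 * lam)
    | _ => ((exp (lam * x) + exp (- (lam * x))) / 2 - 1) / (lam * lam) end))
    as (F & HF & E).
  - lia.
  - intros [|[|n]] x Hn; [| |lia]; auto_derive; auto; field; auto.
  - intros [|[|n]] Hn; [| |lia]; rewrite Rmult_0_r, Ropp_0, exp_0; field; auto.
  - intros x; field; auto.
  - exists F; split; [exact HF|]; repeat match goal with |- _ /\ _ => split end;
      intros x; rewrite E by lia; reflexivity.
Qed.

Lemma exp_family_imag (lam : R) : lam <> 0 ->
  exists F, exp_family 2 (- (lam * lam)) F /\
   (forall x, F 0%nat x = cos (lam * x)) /\
   (forall x, F 1%nat x = sin (lam * x) / lam).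
Proof.
  intros H.
  destruct (exp_family_exists 2 (- (lam * lam)) (fun n x => match n with
    | O => cos (lam * x)
    | 1%nat => sin (lam * x) / lam
    | _ => (1 - cos (lam * x)) / (lam * lam) end)) as (F & HF & E).
  - lia.
  - intros [|[|n]] x Hn; [| |lia]; auto_derive; auto; field; auto.
  - intros [|[|n]] Hn; [| |lia]; rewrite Rmult_0_r, ?sin_0, ?cos_0; field; auto.
  - intros x; field; auto.
  - exists F; split; [exact HF|]; repeat match goal with |- _ /\ _ => split end;
      intros x; rewrite E by lia; reflexivity.
Qed.

(** Half sums and half differences of the hyperbolic and trigonometric families keep every fourth
    power of the series. *)
Lemma exp_family_four (nu : R) : nu <> 0 ->
  exists F, exp_family 4 (nu ^ 4) F /\
   (forall x, F 0%nat x = ((exp (nu * x) + exp (- (nu * x))) / 2 + cos (nu * x)) / 2) /\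
   (forall x, F 1%nat x = ((exp (nu * x) - exp (- (nu * x))) / (2 * nu) + sin (nu * x) / nu) / 2) /\
   (forall x, F 2%nat x = ((exp (nu * x) + exp (- (nu * x))) / 2 - cos (nu * x)) / (2 * nu ^ 2)) /\
   (forall x, F 3%nat x = ((exp (nu * x) - exp (- (nu * x))) / (2 * nu) - sin (nu * x) / nu) / (2 * nu ^ 2)).
Proof.
  intros H.
  destruct (exp_family_exists 4 (nu ^ 4) (fun n x => match n with
    | O => ((exp (nu * x) + exp (- (nu * x))) / 2 + cos (nu * x)) / 2
    | 1%nat => ((exp (nu * x) - exp (- (nu * x))) / (2 * nu) + sin (nu * x) / nu) / 2
    | 2%nat => ((exp (nu * x) + exp (- (nu * x))) / 2 - cos (nu * x)) / (2 * nu ^ 2)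
    | 3%nat => ((exp (nu * x) - exp (- (nu * x))) / (2 * nu) - sin (nu * x) / nu) / (2 * nu ^ 2)
    | _ => (((exp (nu * x) + exp (- (nu * x))) / 2 + cos (nu * x)) / 2 - 1) / nu ^ 4 end))
    as (F & HF & E).
  - lia.
  - intros [|[|[|[|n]]]] x Hn; [| | | |lia]; auto_derive; auto; field; auto.
  - intros [|[|[|[|n]]]] Hn; [| | | |lia];
      rewrite Rmult_0_r, Ropp_0, exp_0, ?sin_0, ?cos_0; field; auto.
  - intros x; field; auto.
  - exists F; split; [exact HF|]; repeat match goal with |- _ /\ _ => split end;
      intros x; rewrite E by lia; reflexivity.
Qed.

Definition exponents5 (lam : C) : list C := lam :: (- lam)%C :: nil.
Definition exponents7 (lam : C) : list C :=
  lam :: (- lam)%C :: (Ci * lam)%C :: (- (Ci * lam))%C :: nil.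

Lemma expspan5_family (lam : C) : lam <> 0 -> Im lam = 0 \/ Re lam = 0 ->
  exists s F, exp_family 2 s F /\
    forall n, (n <= 4)%nat -> expspan (exponents5 lam) (fun x => RtoC (F n x)).
Proof.
  intros H0 [H|H].
  - destruct lam as [nu i]; simpl in H; subst i.
    assert (Hnu : nu <> 0) by (intros E; apply H0; rewrite E; reflexivity).
    change (nu, 0) with (RtoC nu).
    destruct (exp_family_real nu Hnu) as (F & HF & E0 & E1).
    exists (nu * nu), F; split; auto; intros n0 Hn0.
    apply (exp_family_expspan _ 2 (nu * nu)); auto; try nra.
    destruct (expspan_cosh_sinh (exponents5 nu) nu Hnu) as [S0 S1];
      [left; auto | right; left; rewrite RtoC_opp; auto|].
    intros [|[|n]] Hn; [| |lia]; eapply expspan_ext; [|apply S0| |apply S1];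
      intros x; simpl; rewrite ?E0, ?E1; reflexivity.
  - destruct lam as [r nu]; simpl in H; subst r.
    assert (Hnu : nu <> 0) by (intros E; apply H0; rewrite E; reflexivity).
    replace (0, nu) with (Ci * nu)%C by (apply injective_projections; simpl; ring).
    destruct (exp_family_imag nu Hnu) as (F & HF & E0 & E1).
    exists (- (nu * nu)), F; split; auto; intros n0 Hn0.
    apply (exp_family_expspan _ 2 (- (nu * nu))); auto; try nra.
    destruct (expspan_cos_sin (exponents5 (Ci * nu)) nu Hnu) as [S0 S1];
      [left; auto | right; left; auto|].
    intros [|[|n]] Hn; [| |lia]; eapply expspan_ext; [|apply S0| |apply S1];
      intros x; simpl; rewrite ?E0, ?E1; reflexivity.
Qed.

(** The exponent set is invariant under multiplication by [i], so the imaginary case has the same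
    set as a real one and needs no separate family. *)
Lemma list7_nu (lam : C) : lam <> 0 -> Im lam = 0 \/ Re lam = 0 ->
  exists nu : R, nu <> 0 /\ In (RtoC nu) (exponents7 lam) /\ In (RtoC (- nu)) (exponents7 lam) /\
    In (Ci * nu)%C (exponents7 lam) /\ In (- (Ci * nu))%C (exponents7 lam).
Proof.
  intros H0 [H|H].
  - destruct lam as [nu i]; simpl in H; subst i.
    assert (Hnu : nu <> 0) by (intros E; apply H0; rewrite E; reflexivity).
    change (nu, 0) with (RtoC nu).
    exists nu; rewrite RtoC_opp; simpl; tauto.
  - destruct lam as [r nu]; simpl in H; subst r.
    assert (Hnu : nu <> 0) by (intros E; apply H0; rewrite E; reflexivity).
    replace (0, nu) with (Ci * nu)%C by (apply injective_projections; simpl; ring).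
    exists nu; rewrite RtoC_opp; unfold exponents7.
    replace (Ci * (Ci * nu))%C with (- nu)%C
      by (apply injective_projections; simpl; ring).
    replace (- - nu)%C with (RtoC nu) by ring.
    simpl; tauto.
Qed.

Lemma expspan7_family (lam : C) : lam <> 0 -> Im lam = 0 \/ Re lam = 0 ->
  exists s F, exp_family 4 s F /\
    forall n, (n <= 6)%nat -> expspan (exponents7 lam) (fun x => RtoC (F n x)).
Proof.
  intros H0 H.
  destruct (list7_nu lam H0 H) as (nu & Hnu & I1 & I2 & I3 & I4).
  destruct (exp_family_four nu Hnu) as (F & HF & E0 & E1 & E2 & E3).
  assert (Hn4 : nu ^ 4 <> 0) by (apply pow_nonzero; auto).
  exists (nu ^ 4), F; split; auto; intros n0 Hn0.
  apply (exp_family_expspan _ 4 (nu ^ 4)); auto; try lia.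
  destruct (expspan_cosh_sinh _ nu Hnu I1 I2) as [A0 A1].
  destruct (expspan_cos_sin _ nu Hnu I3 I4) as [B0 B1].
  assert (HL : forall f g (c d : R), expspan (exponents7 lam) (fun x => RtoC (f x)) ->
    expspan (exponents7 lam) (fun x => RtoC (g x)) ->
    expspan (exponents7 lam) (fun x => RtoC (c * f x + d * g x))).
  { intros f g c d Hf Hg.
    apply (expspan_ext _ _ _ (fun x => eq_sym (eq_trans (RtoC_plus _ _)
      (f_equal2 Cplus (RtoC_mult _ _) (RtoC_mult _ _))))).
    apply expspan_lin; auto. }
  intros [|[|[|[|n]]]] Hn; [| | | |lia].
  - eapply expspan_ext; [|apply (HL _ _ (/ 2) (/ 2) A0 B0)].
    intros x; rewrite E0; f_equal; field; auto.
  - eapply expspan_ext; [|apply (HL _ _ (/ 2) (/ 2) A1 B1)].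
    intros x; rewrite E1; f_equal; field; auto.
  - eapply expspan_ext; [|apply (HL _ _ (/ (2 * nu ^ 2)) (- / (2 * nu ^ 2)) A0 B0)].
    intros x; rewrite E2; f_equal; field; auto.
  - eapply expspan_ext; [|apply (HL _ _ (/ (2 * nu ^ 2)) (- / (2 * nu ^ 2)) A1 B1)].
    intros x; rewrite E3; f_equal; field; auto.
Qed.

(** * Moments of exact stencils *)

(** Written out, so that moments become explicit linear forms in the coefficients, within reach of
    [ring] and [lra]. *)
Definition dot (e : nat -> R) (g : R -> R) : R :=
  e 0%nat * g (-2) + e 1%nat * g (-1) + e 2%nat * g 0 + e 3%nat * g 1
  + e 4%nat * g 2 + e 5%nat * g 3 + e 6%nat * g 4.

(* Stencils live on the seven offsets -2, ..., 4; [pad m] places the five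
   coefficients of substencil [m] there. *)
Definition pad (m : nat) (c : nat -> R) (k : nat) : R :=
  if le_dec m k then if le_dec k (m + 4) then c (k - m)%nat else 0 else 0.

Definition rdiff3 (h : R) (f : R -> R) (x : R) : R :=
  f (x + 3 / 2 * h) - 3 * f (x + h / 2) + 3 * f (x - h / 2) - f (x - 3 / 2 * h).

Definition rdiff2 (h : R) (f : R -> R) : R :=
  f (3 / 2 * h) - 2 * f (h / 2) + f (- (h / 2)).

Definition mono (n : nat) (x : R) : R := x ^ n / INR (fact n).

(* [theta] is 1 for the stencils themselves, 0 for imaginary parts and for
   differences of two stencils, and [1 - sum_m d_m] for the defect of the ideal
   weights. *)
Definition exact_on (h theta : R) (e : nat -> R) (f0 f3 : R -> R) : Prop :=
  dot e (fun j => rdiff3 h f3 (j * h)) = theta * (h ^ 3 * rdiff2 h f0).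

Lemma Re_sum_n (c : nat -> C) (v : nat -> R) (n : nat) :
  Re (sum_n (fun k => c k * RtoC (v k))%C n) = sum_n (fun k => Re (c k) * v k) n.
Proof.
  assert (E : forall (a : C) (r : R), Re (a * RtoC r)%C = Re a * r)
    by (intros [a b] r; simpl; ring).
  induction n as [|n IH]; [rewrite !sum_O; apply E|].
  rewrite !sum_Sn, <- IH; rewrite <- E; reflexivity.
Qed.

Lemma Im_sum_n (c : nat -> C) (v : nat -> R) (n : nat) :
  Im (sum_n (fun k => c k * RtoC (v k))%C n) = sum_n (fun k => Im (c k) * v k) n.
Proof.
  assert (E : forall (a : C) (r : R), Im (a * RtoC r)%C = Im a * r)
    by (intros [a b] r; simpl; ring).
  induction n as [|n IH]; [rewrite !sum_O; apply E|].
  rewrite !sum_Sn, <- IH; rewrite <- E; reflexivity.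
Qed.

Lemma sum_n_pad (m : nat) (c : nat -> R) (g : R -> R) : (m <= 2)%nat ->
  sum_n (fun k => c k * g (IZR (-2 + Z.of_nat m + Z.of_nat k))) 4 = dot (pad m c) g.
Proof.
  intros Hm; rewrite !sum_Sn, sum_O.
  destruct m as [|[|[|m]]]; [| | |lia]; unfold dot, pad; simpl; change plus with Rplus; ring.
Qed.

Lemma sum_n_dot (c : nat -> R) (g : R -> R) :
  sum_n (fun k => c k * g (IZR (-2 + Z.of_nat k))) 6 = dot c g.
Proof.
  rewrite !sum_Sn, sum_O; unfold dot; simpl; change plus with Rplus; ring.
Qed.

(** Real test functions separate the two parts of the coefficients: the real parts reproduce the
    flux, the imaginary parts give zero. Multiplying by [h^3] clears the averaging denominator. *)
Lemma stencil_coef_exact_real (ls : list C) (G : (R -> C) -> Prop) (h xi : R)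
    (lo : Z) (N : nat) (f0 f1 f2 f3 : R -> R) :
  admissible ls h -> (forall f, G f <-> expspan ls f) -> (N = length ls + 2)%nat ->
  expspan ls (fun x => RtoC (f0 x)) ->
  (forall x, ex_derive f0 x) -> (forall x, is_derive f1 x (f0 x)) ->
  (forall x, is_derive f2 x (f1 x)) -> (forall x, is_derive f3 x (f2 x)) ->
  let c := stencil_coef G h xi lo N in
  let g := fun j => rdiff3 h f3 (j * h) in
  sum_n (fun k => Re (c k) * g (IZR (lo + Z.of_nat k))) N = h ^ 3 * rdiff2 h f0 /\
  sum_n (fun k => Im (c k) * g (IZR (lo + Z.of_nat k))) N = 0.
Proof.
  intros Had HG HN Hf0 D0 D1 D2 D3 c g.
  assert (Hh : 0 < h) by apply Had.
  assert (Hh3 : h ^ 3 <> 0) by (apply pow_nonzero; lra).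
  assert (Hs : forall f f', (forall x, is_derive f x (f' x)) ->
    is_cderive (fun x => RtoC (f (x + - xi))) (fun x => RtoC (f' (x + - xi)))).
  { intros f f' Hf; apply (is_cderive_shift (fun x => RtoC (f x)) (fun x => RtoC (f' x))).
    apply is_cderive_RtoC; auto. }
  assert (E := stencil_coef_exact ls G h xi lo N (fun x => RtoC (f0 (x + - xi)))
    (fun x => rdiff3 h f3 (x + - xi) / h ^ 3) Had HG HN
    (expspan_shift ls (fun x => RtoC (f0 x)) (- xi) Hf0)).
  assert (E0 : second_diff h xi (fun x => RtoC (f0 (x + - xi))) = RtoC (rdiff2 h f0)).
  { unfold second_diff, rdiff2.
    rewrite RtoC_plus, RtoC_minus, RtoC_mult.
    replace (xi + 3 / 2 * h + - xi) with (3 / 2 * h) by ring.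
    replace (xi + h / 2 + - xi) with (h / 2) by ring.
    replace (xi - h / 2 + - xi) with (- (h / 2)) by ring; reflexivity. }
  rewrite E0 in E; clear E0.
  assert (EM : forall x, triple_avg h (fun x => RtoC (f0 (x + - xi))) x
     = RtoC (rdiff3 h f3 (x + - xi) / h ^ 3)).
  { intros x.
    rewrite (triple_avg_primitive h _ _ _ _ (fun x => RtoC (Derive f0 (x + - xi))) x
      (Hs f3 f2 D3) (Hs f2 f1 D2) (Hs f1 f0 D1)
      (Hs f0 (Derive f0) (fun x => Derive_correct f0 x (D0 x)))).
    rewrite RtoC_div by auto; f_equal; unfold diff3, rdiff3.
    rewrite !RtoC_minus, !RtoC_plus, !RtoC_minus, !RtoC_mult.
    replace (x + 3 / 2 * h + - xi) with (x + - xi + 3 / 2 * h) by ring.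
    replace (x + h / 2 + - xi) with (x + - xi + h / 2) by ring.
    replace (x - h / 2 + - xi) with (x + - xi - h / 2) by ring.
    replace (x - 3 / 2 * h + - xi) with (x + - xi - 3 / 2 * h) by ring.
    reflexivity. }
  specialize (E EM).
  assert (Eg : forall k, rdiff3 h f3 (node h xi (lo + Z.of_nat k) + - xi) / h ^ 3
    = g (IZR (lo + Z.of_nat k)) / h ^ 3).
  { intros k; unfold g, node; do 2 f_equal; ring. }
  assert (ER := f_equal Re E); assert (EI := f_equal Im E).
  rewrite Re_sum_n in ER; rewrite Im_sum_n in EI; simpl in ER, EI.
  assert (HM : forall u : nat -> R,
     sum_n (fun k => u k * (rdiff3 h f3 (node h xi (lo + Z.of_nat k) + - xi) / h ^ 3)) N
     = / h ^ 3 * sum_n (fun k => u k * g (IZR (lo + Z.of_nat k))) N).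
  { intros u; rewrite <- (sum_n_mult_l (K := R_AbsRing)).
    apply sum_n_ext; intros k; rewrite Eg; change mult with Rmult.
    match goal with |- @eq _ ?a ?b => change (@eq R a b) end; field; lra. }
  simpl in HM; rewrite HM in ER, EI; fold c in ER, EI.
  split.
  - change (h ^ 3) with (h * (h * (h * 1))); rewrite ER; symmetry.
    match goal with |- @eq _ ?a ?b => change (@eq R a b) end; field; lra.
  - assert (Hi : / (h * (h * (h * 1))) <> 0) by (apply Rinv_neq_0_compat; exact Hh3).
    symmetry in EI; apply Rmult_integral in EI; destruct EI; [contradiction|auto].
Qed.

Definition norm1 (e : nat -> R) : R :=
  Rabs (e 0%nat) + Rabs (e 1%nat) + Rabs (e 2%nat) + Rabs (e 3%nat)
  + Rabs (e 4%nat) + Rabs (e 5%nat) + Rabs (e 6%nat).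

Lemma norm1_pos (e : nat -> R) : 0 <= norm1 e.
Proof. unfold norm1; repeat apply Rplus_le_le_0_compat; apply Rabs_pos. Qed.

Lemma Rabs_mult_le (a b B : R) : Rabs b <= B -> Rabs (a * b) <= B * Rabs a.
Proof.
  intros H; rewrite Rabs_mult, Rmult_comm; apply Rmult_le_compat_r; auto; apply Rabs_pos.
Qed.

Lemma dot_bound (e : nat -> R) (g : R -> R) (B : R) :
  (forall j, -2 <= j <= 4 -> Rabs (g j) <= B) -> Rabs (dot e g) <= B * norm1 e.
Proof.
  intros H; unfold dot, norm1.
  assert (H' : forall k j, -2 <= j <= 4 -> Rabs (e k * g j) <= B * Rabs (e k))
    by (intros; apply Rabs_mult_le; auto).
  assert (A0 := H' 0%nat (-2) ltac:(lra)); assert (A1 := H' 1%nat (-1) ltac:(lra)).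
  assert (A2 := H' 2%nat 0 ltac:(lra)); assert (A3 := H' 3%nat 1 ltac:(lra)).
  assert (A4 := H' 4%nat 2 ltac:(lra)); assert (A5 := H' 5%nat 3 ltac:(lra)).
  assert (A6 := H' 6%nat 4 ltac:(lra)).
  rewrite !Rmult_plus_distr_l.
  repeat (eapply Rle_trans; [apply Rabs_triang|apply Rplus_le_compat; [|assumption]]).
  assumption.
Qed.

Lemma dot_plus (e : nat -> R) (f g : R -> R) :
  dot e (fun j => f j + g j) = dot e f + dot e g.
Proof. unfold dot; ring. Qed.

Lemma dot_scal (e : nat -> R) (c : R) (f : R -> R) :
  dot e (fun j => c * f j) = c * dot e f.
Proof. unfold dot; ring. Qed.

Lemma dot_ext (e : nat -> R) (f g : R -> R) : (forall j, f j = g j) -> dot e f = dot e g.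
Proof. intros H; unfold dot; rewrite !H; reflexivity. Qed.

Lemma mono_scal (n : nat) (h x : R) : mono n (x * h) = h ^ n * mono n x.
Proof. unfold mono; rewrite Rpow_mult_distr; unfold Rdiv; ring. Qed.

Lemma rdiff3_mono (n : nat) (h j : R) :
  rdiff3 h (mono n) (j * h) = h ^ n * rdiff3 1 (mono n) j.
Proof.
  unfold rdiff3.
  replace (j * h + 3 / 2 * h) with ((j + 3 / 2 * 1) * h) by field.
  replace (j * h + h / 2) with ((j + 1 / 2) * h) by field.
  replace (j * h - h / 2) with ((j - 1 / 2) * h) by field.
  replace (j * h - 3 / 2 * h) with ((j - 3 / 2 * 1) * h) by field.
  rewrite !mono_scal; ring.
Qed.

Lemma rdiff2_mono (n : nat) (h : R) : rdiff2 h (mono n) = h ^ n * rdiff2 1 (mono n).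
Proof.
  unfold rdiff2.
  replace (3 / 2 * h) with ((3 / 2 * 1) * h) by field.
  replace (h / 2) with (1 / 2 * h) by field.
  replace (- (1 / 2 * h)) with (- (1 / 2) * h) by field.
  rewrite !mono_scal; ring.
Qed.

Lemma moment_estimate (p : nat) (s : R) (F : nat -> R -> R) (n : nat) :
  exp_family p s F -> (0 < p)%nat ->
  exists K, 0 <= K /\ forall h theta e, 0 < h <= 1 / 6 ->
    exact_on h theta e (F n) (F (3 + n)%nat) ->
    Rabs (dot e (rdiff3 1 (mono (3 + n))) - theta * rdiff2 1 (mono n))
    <= K * h ^ p * (norm1 e + Rabs theta).
Proof.
  intros HF Hp; destruct (exp_family_bound p s F HF Hp) as (K0 & HK0 & HB).
  (* Here 8 = 1 + 3 + 3 + 1 is the total weight of [rdiff3], above the weight 4 of [rdiff2]. All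
     evaluation points lie within [(4 + 3/2) * h <= 6 * h], hence in [-1, 1] when [h <= 1/6]. *)
  exists (8 * K0 * 6 ^ (p + (3 + n))); split.
  { apply Rmult_le_pos; [lra|apply pow_le; lra]. }
  intros h theta e Hh HE.
  set (r := fun m x => F m x - mono m x).
  assert (Hr : forall m x, Rabs x <= 6 * h -> Rabs (r m x) <= K0 * (6 * h) ^ (p + m)).
  { intros m x Hx; eapply Rle_trans; [apply (HB m x); lra|].
    apply Rmult_le_compat_l; auto; apply pow_incr; split; auto; apply Rabs_pos. }
  assert (E3 : dot e (fun j => rdiff3 h (F (3 + n)%nat) (j * h))
    = h ^ (3 + n) * dot e (rdiff3 1 (mono (3 + n)))
      + dot e (fun j => rdiff3 h (r (3 + n)%nat) (j * h))).
  { rewrite <- dot_scal, <- dot_plus; apply dot_ext; intros j.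
    rewrite <- rdiff3_mono; unfold rdiff3, r; ring. }
  assert (E2 : rdiff2 h (F n) = h ^ n * rdiff2 1 (mono n) + rdiff2 h (r n)).
  { rewrite <- rdiff2_mono; unfold rdiff2, r; ring. }
  set (B := K0 * (6 * h) ^ (p + (3 + n))).
  assert (HB0 : 0 <= B) by (apply Rmult_le_pos; auto; apply pow_le; lra).
  assert (R3 : Rabs (dot e (fun j => rdiff3 h (r (3 + n)%nat) (j * h))) <= 8 * B * norm1 e).
  { apply dot_bound; intros j Hj.
    assert (Hx : forall t, -3/2 <= t <= 3/2 -> Rabs (j * h + t * h) <= 6 * h).
    { intros t Ht; replace (j * h + t * h) with ((j + t) * h) by ring.
      rewrite Rabs_mult, (Rabs_pos_eq h) by lra.
      apply Rmult_le_compat_r; [lra|]; apply Rabs_le; lra. }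
    unfold rdiff3.
    assert (X1 := Hr (3 + n)%nat _ (Hx (3 / 2) ltac:(lra))).
    assert (X2 := Hr (3 + n)%nat _ (Hx (1 / 2) ltac:(lra))).
    assert (X3 := Hr (3 + n)%nat _ (Hx (- (1 / 2)) ltac:(lra))).
    assert (X4 := Hr (3 + n)%nat _ (Hx (- (3 / 2)) ltac:(lra))).
    replace (j * h + h / 2) with (j * h + 1 / 2 * h) by field.
    replace (j * h - h / 2) with (j * h + - (1 / 2) * h) by field.
    replace (j * h - 3 / 2 * h) with (j * h + - (3 / 2) * h) by field.
    fold B in X1, X2, X3, X4.
    apply Rabs_le_between in X1; apply Rabs_le_between in X2.
    apply Rabs_le_between in X3; apply Rabs_le_between in X4.
    apply Rabs_le; lra. }
  assert (R2 : Rabs (h ^ 3 * rdiff2 h (r n)) <= 8 * B).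
  { set (B' := K0 * (6 * h) ^ (p + n)).
    assert (HB' : 0 <= B') by (apply Rmult_le_pos; auto; apply pow_le; lra).
    assert (EB : 8 * B = h ^ 3 * (8 * 216 * B')).
    { unfold B, B'; replace (p + (3 + n))%nat with (p + n + 3)%nat by lia.
      rewrite (pow_add _ _ 3); ring. }
    rewrite EB, Rabs_mult, (Rabs_pos_eq (h ^ 3)) by (apply pow_le; lra).
    apply Rmult_le_compat_l; [apply pow_le; lra|].
    assert (Hx : forall t, -3/2 <= t <= 3/2 -> Rabs (t * h) <= 6 * h).
    { intros t Ht; rewrite Rabs_mult, (Rabs_pos_eq h) by lra.
      apply Rmult_le_compat_r; [lra|]; apply Rabs_le; lra. }
    unfold rdiff2.
    assert (X1 := Hr n _ (Hx (3 / 2) ltac:(lra))).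
    assert (X2 := Hr n _ (Hx (1 / 2) ltac:(lra))).
    assert (X3 := Hr n _ (Hx (- (1 / 2)) ltac:(lra))).
    replace (h / 2) with (1 / 2 * h) by field.
    replace (- (1 / 2 * h)) with (- (1 / 2) * h) by field.
    fold B' in X1, X2, X3.
    apply Rabs_le_between in X1; apply Rabs_le_between in X2; apply Rabs_le_between in X3.
    apply Rabs_le; lra. }
  unfold exact_on in HE; rewrite E3, E2 in HE.
  set (X := dot e (rdiff3 1 (mono (3 + n)))) in *.
  set (Y := rdiff2 1 (mono n)) in *.
  assert (Hhp : 0 < h ^ (3 + n)) by (apply pow_lt; lra).
  apply Rmult_le_reg_l with (h ^ (3 + n)); auto.
  rewrite <- (Rabs_pos_eq (h ^ (3 + n))) at 1 by lra.
  rewrite <- Rabs_mult.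
  (* Exactness on [F n] turns the error on the monomial into the two remainders. *)
  replace (h ^ (3 + n) * (X - theta * Y))
    with (theta * (h ^ 3 * rdiff2 h (r n))
          - dot e (fun j => rdiff3 h (r (3 + n)%nat) (j * h)))
    by (rewrite pow_add in *; lra).
  replace (h ^ (3 + n) * (8 * K0 * 6 ^ (p + (3 + n)) * h ^ p * (norm1 e + Rabs theta)))
    with (8 * B * Rabs theta + 8 * B * norm1 e)
    by (unfold B; rewrite Rpow_mult_distr, !pow_add; ring).
  eapply Rle_trans; [apply Rabs_triang|]; rewrite Rabs_Ropp.
  apply Rplus_le_compat; auto.
  apply Rabs_mult_le; auto.
Qed.

Definition moment (n : nat) (e : nat -> R) : R := dot e (fun j => j ^ n).

Lemma exact_on_mono (h theta : R) (e : nat -> R) (n : nat) : h <> 0 ->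
  exact_on h theta e (mono n) (mono (3 + n)) ->
  dot e (rdiff3 1 (mono (3 + n))) = theta * rdiff2 1 (mono n).
Proof.
  unfold exact_on; intros Hh H.
  apply Rmult_eq_reg_l with (h ^ (3 + n)); [|apply pow_nonzero; auto].
  rewrite <- dot_scal, (dot_ext e _ (fun j => rdiff3 h (mono (3 + n)) (j * h))), H, rdiff2_mono, pow_add.
  - ring.
  - intros j; symmetry; apply rdiff3_mono.
Qed.

Lemma mono_0 (x : R) : mono 0 x = 1.
Proof. unfold mono; simpl; field. Qed.

Lemma mono_S (n : nat) (x : R) : mono (S n) x = x / INR (S n) * mono n x.
Proof.
  unfold mono; rewrite fact_simpl, mult_INR; simpl pow; field.
  split; [apply INR_fact_neq_0|apply not_0_INR; lia].
Qed.

(** [rdiff3 1 (mono (3 + n))] is the unit-step triple average of [x^n / n!]. So 1/4, 13/80 and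
    205/1344, up to binomial factors, are the second, fourth and sixth moments of a sum of three
    independent uniform variables on [-1/2, 1/2]. *)
Lemma dot_rdiff3_mono (e : nat -> R) :
  dot e (rdiff3 1 (mono 3)) = moment 0 e /\
  dot e (rdiff3 1 (mono 4)) = moment 1 e /\
  dot e (rdiff3 1 (mono 5)) = moment 2 e / 2 + moment 0 e / 8 /\
  dot e (rdiff3 1 (mono 6)) = (moment 3 e + 3 / 4 * moment 1 e) / 6 /\
  dot e (rdiff3 1 (mono 7)) = (moment 4 e + 3 / 2 * moment 2 e + 13 / 80 * moment 0 e) / 24 /\
  dot e (rdiff3 1 (mono 8))
    = (moment 5 e + 5 / 2 * moment 3 e + 13 / 16 * moment 1 e) / 120 /\
  dot e (rdiff3 1 (mono 9))
    = (moment 6 e + 15 / 4 * moment 4 e + 39 / 16 * moment 2 e + 205 / 1344 * moment 0 e) / 720.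
Proof.
  unfold moment, dot, rdiff3; repeat split; rewrite ?mono_S, ?mono_0, ?INR_IZR_INZ;
    simpl Z.of_nat; field.
Qed.

Lemma rdiff2_mono_values :
  rdiff2 1 (mono 0) = 0 /\ rdiff2 1 (mono 1) = 0 /\ rdiff2 1 (mono 2) = 1 /\
  rdiff2 1 (mono 3) = 1 / 2 /\ rdiff2 1 (mono 4) = 5 / 24 /\
  rdiff2 1 (mono 5) = 1 / 16 /\ rdiff2 1 (mono 6) = 91 / 5760.
Proof.
  unfold rdiff2; repeat split; rewrite ?mono_S, ?mono_0, ?INR_IZR_INZ;
    simpl Z.of_nat; field.
Qed.

(** These are [p + 3] tests, as many as the dimension of the space. In degrees up to 2 the monomials
    themselves belong to the span, so the first three moments carry no error. *)
Definition exact_family (p : nat) (F : nat -> R -> R) (h theta : R) (e : nat -> R) : Prop :=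
  (forall n, (n <= 2)%nat -> exact_on h theta e (mono n) (mono (3 + n))) /\
  (forall n, (3 <= n <= p + 2)%nat -> exact_on h theta e (F n) (F (3 + n)%nat)).

Lemma low_moments (p : nat) (F : nat -> R -> R) (h theta : R) (e : nat -> R) :
  h <> 0 -> exact_family p F h theta e ->
  moment 0 e = 0 /\ moment 1 e = 0 /\ moment 2 e = 2 * theta.
Proof.
  intros Hh [H _].
  assert (E0 := exact_on_mono h theta e 0 Hh (H 0%nat ltac:(lia))).
  assert (E1 := exact_on_mono h theta e 1 Hh (H 1%nat ltac:(lia))).
  assert (E2 := exact_on_mono h theta e 2 Hh (H 2%nat ltac:(lia))).
  destruct (dot_rdiff3_mono e) as (M0 & M1 & M2 & _).
  destruct rdiff2_mono_values as (V0 & V1 & V2 & _).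
  simpl Nat.add in *; rewrite M0, V0 in E0; rewrite M1, V1 in E1; rewrite M2, V2 in E2.
  lra.
Qed.

Lemma moments5 (s : R) (F : nat -> R -> R) : exp_family 2 s F ->
  exists K, 0 <= K /\ forall h theta e, 0 < h <= 1 / 6 ->
    exact_family 2 F h theta e ->
    Rabs (moment 3 e - 3 * theta) <= K * h ^ 2 * (norm1 e + Rabs theta) /\
    Rabs (moment 4 e - 2 * theta) <= K * h ^ 2 * (norm1 e + Rabs theta).
Proof.
  intros HF.
  destruct (moment_estimate 2 s F 3 HF ltac:(lia)) as (K3 & P3 & H3).
  destruct (moment_estimate 2 s F 4 HF ltac:(lia)) as (K4 & P4 & H4).
  exists (24 * (K3 + K4)); split; [lra|].
  intros h theta e Hh HE.
  destruct (low_moments 2 F h theta e ltac:(lra) HE) as (A0 & A1 & A2).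
  destruct HE as [_ HE].
  assert (E3 := H3 h theta e Hh (HE 3%nat ltac:(lia))).
  assert (E4 := H4 h theta e Hh (HE 4%nat ltac:(lia))).
  destruct (dot_rdiff3_mono e) as (_ & _ & _ & M3 & M4 & _).
  destruct rdiff2_mono_values as (_ & _ & _ & V3 & V4 & _).
  simpl Nat.add in *; rewrite M3, V3, A1 in E3; rewrite M4, V4, A0, A2 in E4.
  set (W := norm1 e + Rabs theta) in *.
  assert (HW : 0 <= h ^ 2 * W).
  { apply Rmult_le_pos; [apply pow_le; lra|].
    apply Rplus_le_le_0_compat; [apply norm1_pos|apply Rabs_pos]. }
  rewrite Rmult_assoc in E3, E4; rewrite !Rmult_assoc.
  set (z := h ^ 2 * W) in *.
  assert (Q3 := Rmult_le_pos _ _ P3 HW); assert (Q4 := Rmult_le_pos _ _ P4 HW).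
  apply Rabs_le_between in E3; apply Rabs_le_between in E4.
  split; apply Rabs_le; lra.
Qed.

Lemma moments7 (s : R) (F : nat -> R -> R) : exp_family 4 s F ->
  exists K, 0 <= K /\ forall h theta e, 0 < h <= 1 / 6 ->
    exact_family 4 F h theta e ->
    Rabs (moment 3 e - 3 * theta) <= K * h ^ 4 * (norm1 e + Rabs theta) /\
    Rabs (moment 4 e - 2 * theta) <= K * h ^ 4 * (norm1 e + Rabs theta) /\
    Rabs (moment 5 e) <= K * h ^ 4 * (norm1 e + Rabs theta) /\
    Rabs (moment 6 e + theta) <= K * h ^ 4 * (norm1 e + Rabs theta).
Proof.
  intros HF.
  destruct (moment_estimate 4 s F 3 HF ltac:(lia)) as (K3 & P3 & H3).
  destruct (moment_estimate 4 s F 4 HF ltac:(lia)) as (K4 & P4 & H4).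
  destruct (moment_estimate 4 s F 5 HF ltac:(lia)) as (K5 & P5 & H5).
  destruct (moment_estimate 4 s F 6 HF ltac:(lia)) as (K6 & P6 & H6).
  (* 1000 exceeds 720, the largest factorial cleared, together with the lower moments fed back into
     degrees 5 and 6. *)
  exists (1000 * (K3 + K4 + K5 + K6)); split; [lra|].
  intros h theta e Hh HE.
  destruct (low_moments 4 F h theta e ltac:(lra) HE) as (A0 & A1 & A2).
  destruct HE as [_ HE].
  assert (E3 := H3 h theta e Hh (HE 3%nat ltac:(lia))).
  assert (E4 := H4 h theta e Hh (HE 4%nat ltac:(lia))).
  assert (E5 := H5 h theta e Hh (HE 5%nat ltac:(lia))).
  assert (E6 := H6 h theta e Hh (HE 6%nat ltac:(lia))).
  destruct (dot_rdiff3_mono e) as (_ & _ & _ & M3 & M4 & M5 & M6).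
  destruct rdiff2_mono_values as (_ & _ & _ & V3 & V4 & V5 & V6).
  simpl Nat.add in *; rewrite M3, V3, A1 in E3; rewrite M4, V4, A0, A2 in E4.
  rewrite M5, V5, A1 in E5; rewrite M6, V6, A0, A2 in E6.
  set (W := norm1 e + Rabs theta) in *.
  assert (HW : 0 <= h ^ 4 * W).
  { apply Rmult_le_pos; [apply pow_le; lra|].
    apply Rplus_le_le_0_compat; [apply norm1_pos|apply Rabs_pos]. }
  rewrite Rmult_assoc in E3, E4, E5, E6; rewrite !Rmult_assoc.
  set (z := h ^ 4 * W) in *.
  assert (Q3 := Rmult_le_pos _ _ P3 HW); assert (Q4 := Rmult_le_pos _ _ P4 HW).
  assert (Q5 := Rmult_le_pos _ _ P5 HW); assert (Q6 := Rmult_le_pos _ _ P6 HW).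
  apply Rabs_le_between in E3; apply Rabs_le_between in E4.
  apply Rabs_le_between in E5; apply Rabs_le_between in E6.
  repeat split; apply Rabs_le; lra.
Qed.

(** * Size and uniqueness of exact stencils *)

Lemma norm1_le (e : nat -> R) (B : R) :
  (forall k, (k < 7)%nat -> Rabs (e k) <= B) -> norm1 e <= 7 * B.
Proof.
  intros H; unfold norm1.
  assert (H0 := H 0%nat ltac:(lia)); assert (H1 := H 1%nat ltac:(lia)).
  assert (H2 := H 2%nat ltac:(lia)); assert (H3 := H 3%nat ltac:(lia)).
  assert (H4 := H 4%nat ltac:(lia)); assert (H5 := H 5%nat ltac:(lia)).
  assert (H6 := H 6%nat ltac:(lia)); lra.
Qed.

Lemma le_norm1 (e : nat -> R) (k : nat) : (k < 7)%nat -> Rabs (e k) <= norm1 e.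
Proof.
  intros Hk; unfold norm1.
  assert (P := fun k => Rabs_pos (e k)).
  assert (P0 := P 0%nat); assert (P1 := P 1%nat); assert (P2 := P 2%nat).
  assert (P3 := P 3%nat); assert (P4 := P 4%nat); assert (P5 := P 5%nat).
  assert (P6 := P 6%nat).
  destruct k as [|[|[|[|[|[|[|k]]]]]]]; try lra; lia.
Qed.

(** Each coefficient is recovered through the Lagrange polynomial of its node; 4 bounds the absolute
    coefficient sums of these seven polynomials, and 28 = 7 * 4. *)
Lemma norm1_le_moments (e : nat -> R) (A : R) :
  (forall n, (n <= 6)%nat -> Rabs (moment n e) <= A) -> norm1 e <= 28 * A.
Proof.
  intros H.
  assert (H0 := H 0%nat ltac:(lia)); assert (H1 := H 1%nat ltac:(lia)).
  assert (H2 := H 2%nat ltac:(lia)); assert (H3 := H 3%nat ltac:(lia)).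
  assert (H4 := H 4%nat ltac:(lia)); assert (H5 := H 5%nat ltac:(lia)).
  assert (H6 := H 6%nat ltac:(lia)).
  apply Rabs_le_between in H0; apply Rabs_le_between in H1; apply Rabs_le_between in H2.
  apply Rabs_le_between in H3; apply Rabs_le_between in H4; apply Rabs_le_between in H5.
  apply Rabs_le_between in H6.
  unfold moment, dot in *; simpl in *.
  replace (28 * A) with (7 * (4 * A)) by ring; apply norm1_le; intros k Hk.
  destruct k as [|[|[|[|[|[|[|k]]]]]]]; try lia; apply Rabs_le; lra.
Qed.

Lemma norm1_pad_le_moments (m : nat) (c : nat -> R) (A : R) : (m <= 2)%nat ->
  (forall n, (n <= 4)%nat -> Rabs (moment n (pad m c)) <= A) ->
  norm1 (pad m c) <= 70 * A.
Proof.
  intros Hm H.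
  assert (H0 := H 0%nat ltac:(lia)); assert (H1 := H 1%nat ltac:(lia)).
  assert (H2 := H 2%nat ltac:(lia)); assert (H3 := H 3%nat ltac:(lia)).
  assert (H4 := H 4%nat ltac:(lia)).
  apply Rabs_le_between in H0; apply Rabs_le_between in H1; apply Rabs_le_between in H2.
  apply Rabs_le_between in H3; apply Rabs_le_between in H4.
  replace (70 * A) with (7 * (10 * A)) by ring; apply norm1_le; intros k Hk.
  destruct m as [|[|[|m]]]; [| | |lia]; unfold moment, dot, pad in *; simpl in *;
  destruct k as [|[|[|[|[|[|[|k]]]]]]]; try lia; simpl; apply Rabs_le; lra.
Qed.

(* The limits of [C^m_0] as [h] tends to 0. *)
Definition lead (m : nat) : R :=
  match m with O => - 1 / 4 | 1%nat => 1 / 4 | _ => 7 / 4 end.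

(** The Lagrange polynomial of the leftmost node of substencil [m], applied to the limiting moments,
    gives [lead m]. These values are nonzero, which makes the divisions defining the ideal weights
    legitimate. *)
Lemma pad_lead (m : nat) (c : nat -> R) (theta x : R) : (m <= 2)%nat ->
  moment 0 (pad m c) = 0 -> moment 1 (pad m c) = 0 -> moment 2 (pad m c) = 2 * theta ->
  Rabs (moment 3 (pad m c) - 3 * theta) <= x ->
  Rabs (moment 4 (pad m c) - 2 * theta) <= x ->
  Rabs (c 0%nat - lead m * theta) <= x.
Proof.
  intros Hm H0 H1 H2 H3 H4.
  apply Rabs_le_between in H3; apply Rabs_le_between in H4.
  destruct m as [|[|[|m]]]; [| | |lia]; unfold moment, dot, pad, lead in *; simpl in *;
    apply Rabs_le; lra.
Qed.

(** The polynomial (j-1)(j-2)(j-3)(j-4) = j^4 - 10 j^3 + 35 j^2 - 50 j + 24 vanishes on the four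
    remaining nodes, while the limiting moments give it the value (2 - 30 + 70) theta = 42 theta. So
    [theta] is controlled by the moment errors, and then so are the four coefficients. *)
Lemma tail_defect (e : nat -> R) (theta x : R) :
  e 0%nat = 0 -> e 1%nat = 0 -> e 2%nat = 0 ->
  moment 0 e = 0 -> moment 1 e = 0 -> moment 2 e = 2 * theta ->
  Rabs (moment 3 e - 3 * theta) <= x -> Rabs (moment 4 e - 2 * theta) <= x ->
  norm1 e + Rabs theta <= 10 * x.
Proof.
  intros E0 E1 E2 H0 H1 H2 H3 H4.
  apply Rabs_le_between in H3; apply Rabs_le_between in H4.
  assert (Ht : Rabs theta <= x) by (unfold moment, dot in *; simpl in *; apply Rabs_le; lra).
  assert (A3 : Rabs (e 3%nat) <= 5 / 4 * x) by (unfold moment, dot in *; simpl in *; apply Rabs_le; lra).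
  assert (A4 : Rabs (e 4%nat) <= 5 / 4 * x) by (unfold moment, dot in *; simpl in *; apply Rabs_le; lra).
  assert (A5 : Rabs (e 5%nat) <= 5 / 4 * x) by (unfold moment, dot in *; simpl in *; apply Rabs_le; lra).
  assert (A6 : Rabs (e 6%nat) <= 5 / 4 * x) by (unfold moment, dot in *; simpl in *; apply Rabs_le; lra).
  unfold norm1; rewrite E0, E1, E2, Rabs_R0.
  assert (Px := Rabs_pos theta); lra.
Qed.

Lemma pow_small (K h : R) (n : nat) : 0 <= K -> 0 < h <= 1 -> h * (K + 1) <= 1 ->
  K * h ^ S n <= 1.
Proof.
  intros HK Hh H.
  assert (Hn : h ^ n <= 1) by (rewrite <- (pow1 n); apply pow_incr; lra).
  assert (0 <= h ^ n) by (apply pow_le; lra).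
  simpl.
  assert (h * h ^ n <= h * 1) by (apply Rmult_le_compat_l; lra).
  assert (K * (h * h ^ n) <= K * h) by (apply Rmult_le_compat_l; lra).
  lra.
Qed.

Lemma inv_bound (K h : R) : 0 <= K -> 0 < h < / (K + 1) -> h * (K + 1) <= 1.
Proof.
  intros HK [H1 H2].
  apply Rmult_lt_compat_r with (r := K + 1) in H2; [|lra].
  rewrite Rinv_l in H2; lra.
Qed.

(** The moment errors involve [norm1 e] itself, which is absorbed for small [h]. All bounds are
    proportional to [theta], so [theta = 0] yields uniqueness. *)
Lemma exact_big_bound (s : R) (F : nat -> R -> R) : exp_family 4 s F ->
  exists K delta, 0 <= K /\ 0 < delta /\ forall h theta e, 0 < h < delta ->
    exact_family 4 F h theta e ->
    norm1 e <= K * Rabs theta /\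
    Rabs (moment 3 e - 3 * theta) <= K * Rabs theta * h ^ 4 /\
    Rabs (moment 4 e - 2 * theta) <= K * Rabs theta * h ^ 4 /\
    Rabs (moment 5 e) <= K * Rabs theta * h ^ 4 /\
    Rabs (moment 6 e + theta) <= K * Rabs theta * h ^ 4.
Proof.
  intros HF; destruct (moments7 s F HF) as (K & HK & H).
  exists (201 + 202 * K), (Rmin (1 / 6) (/ (56 * K + 1))); split; [lra|]; split.
  { apply Rmin_glb_lt; [lra|apply Rinv_0_lt_compat; lra]. }
  intros h theta e [Hh0 Hh] HE.
  assert (Hh1 := Rmin_l (1 / 6) (/ (56 * K + 1))).
  assert (Hh2 := Rmin_r (1 / 6) (/ (56 * K + 1))).
  assert (Hs := pow_small (56 * K) h 3 ltac:(lra) ltac:(lra)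
    (inv_bound (56 * K) h ltac:(lra) ltac:(lra))).
  destruct (low_moments 4 F h theta e ltac:(lra) HE) as (M0 & M1 & M2).
  destruct (H h theta e ltac:(lra) HE) as (M3 & M4 & M5 & M6).
  assert (N := norm1_pos e); assert (T := Rabs_pos theta).
  assert (Hp : 0 <= h ^ 4) by (apply pow_le; lra).
  set (W := norm1 e + Rabs theta) in *.
  assert (HW : 0 <= W) by (unfold W; lra).
  set (x := K * h ^ 4 * W) in *.
  (* 56 = 2 * 28: in [norm1 e <= 28 * (3 * Rabs theta + x)] the term [28 * x] then costs at most
     half of [W]. The factor 3 is the largest limiting moment. *)
  assert (Hx : 56 * x <= W).
  { replace (56 * x) with (56 * K * h ^ 4 * W) by (unfold x; ring).
    rewrite <- (Rmult_1_l W) at 2; apply Rmult_le_compat_r; auto. }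
  assert (HA : norm1 e <= 28 * (3 * Rabs theta + x)).
  { apply norm1_le_moments.
    assert (0 <= x) by (eapply Rle_trans; [apply Rabs_pos|exact M5]).
    assert (U1 := Rle_abs theta); assert (U2 := Rle_abs (- theta)); rewrite Rabs_Ropp in U2.
    apply Rabs_le_between in M3; apply Rabs_le_between in M4.
    apply Rabs_le_between in M5; apply Rabs_le_between in M6.
    intros n Hn; destruct n as [|[|[|[|[|[|[|n]]]]]]]; try lia; apply Rabs_le; lra. }
  assert (HN : norm1 e <= 169 * Rabs theta) by (unfold W in Hx; lra).
  assert (HX : x <= (201 + 202 * K) * Rabs theta * h ^ 4).
  { assert (W <= 170 * Rabs theta) by (unfold W; lra).
    replace x with (h ^ 4 * (K * W)) by (unfold x; ring).
    rewrite (Rmult_comm _ (h ^ 4)); apply Rmult_le_compat_l; auto.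
    apply Rle_trans with (K * (170 * Rabs theta)); [apply Rmult_le_compat_l; auto|].
    assert (0 <= K * Rabs theta) by (apply Rmult_le_pos; auto); lra. }
  assert (0 <= K * Rabs theta) by (apply Rmult_le_pos; auto).
  repeat split; try lra.
Qed.

Lemma exact_sub_bound (s : R) (F : nat -> R -> R) : exp_family 2 s F ->
  exists K delta, 0 <= K /\ 0 < delta /\ forall h theta m c, 0 < h < delta ->
    (m <= 2)%nat -> exact_family 2 F h theta (pad m c) ->
    norm1 (pad m c) <= K * Rabs theta /\
    Rabs (moment 3 (pad m c) - 3 * theta) <= K * Rabs theta * h ^ 2 /\
    Rabs (moment 4 (pad m c) - 2 * theta) <= K * Rabs theta * h ^ 2.
Proof.
  intros HF; destruct (moments5 s F HF) as (K & HK & H).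
  exists (500 + 500 * K), (Rmin (1 / 6) (/ (140 * K + 1))); split; [lra|]; split.
  { apply Rmin_glb_lt; [lra|apply Rinv_0_lt_compat; lra]. }
  intros h theta m c [Hh0 Hh] Hm HE; set (e := pad m c) in *.
  assert (Hh1 := Rmin_l (1 / 6) (/ (140 * K + 1))).
  assert (Hh2 := Rmin_r (1 / 6) (/ (140 * K + 1))).
  assert (Hs := pow_small (140 * K) h 1 ltac:(lra) ltac:(lra)
    (inv_bound (140 * K) h ltac:(lra) ltac:(lra))).
  destruct (low_moments 2 F h theta e ltac:(lra) HE) as (M0 & M1 & M2).
  destruct (H h theta e ltac:(lra) HE) as (M3 & M4).
  assert (N := norm1_pos e); assert (T := Rabs_pos theta).
  assert (Hp : 0 <= h ^ 2) by (apply pow_le; lra).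
  set (W := norm1 e + Rabs theta) in *.
  assert (HW : 0 <= W) by (unfold W; lra).
  set (x := K * h ^ 2 * W) in *.
  (* 140 = 2 * 70 plays the same absorbing role for five nodes. *)
  assert (Hx : 140 * x <= W).
  { replace (140 * x) with (140 * K * h ^ 2 * W) by (unfold x; ring).
    rewrite <- (Rmult_1_l W) at 2; apply Rmult_le_compat_r; auto. }
  assert (HA : norm1 e <= 70 * (3 * Rabs theta + x)).
  { apply norm1_pad_le_moments; auto; fold e.
    assert (0 <= x) by (eapply Rle_trans; [apply Rabs_pos|exact M4]).
    assert (U1 := Rle_abs theta); assert (U2 := Rle_abs (- theta)); rewrite Rabs_Ropp in U2.
    apply Rabs_le_between in M3; apply Rabs_le_between in M4.
    intros n Hn; destruct n as [|[|[|[|[|n]]]]]; try lia; apply Rabs_le; lra. }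
  assert (HN : norm1 e <= 421 * Rabs theta) by (unfold W in Hx; lra).
  assert (HX : x <= (500 + 500 * K) * Rabs theta * h ^ 2).
  { assert (W <= 422 * Rabs theta) by (unfold W; lra).
    replace x with (h ^ 2 * (K * W)) by (unfold x; ring).
    rewrite (Rmult_comm _ (h ^ 2)); apply Rmult_le_compat_l; auto.
    apply Rle_trans with (K * (422 * Rabs theta)); [apply Rmult_le_compat_l; auto|].
    assert (0 <= K * Rabs theta) by (apply Rmult_le_pos; auto); lra. }
  assert (0 <= K * Rabs theta) by (apply Rmult_le_pos; auto).
  repeat split; try lra.
Qed.

(** [tail_defect] gives [W <= 10 * x] and small [h] gives [20 * x <= W], so [W] vanishes. *)
Lemma exact_tail_zero (s : R) (F : nat -> R -> R) : exp_family 2 s F ->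
  exists delta, 0 < delta /\ forall h theta e, 0 < h < delta ->
    e 0%nat = 0 -> e 1%nat = 0 -> e 2%nat = 0 -> exact_family 2 F h theta e ->
    theta = 0 /\ norm1 e = 0.
Proof.
  intros HF; destruct (moments5 s F HF) as (K & HK & H).
  exists (Rmin (1 / 6) (/ (20 * K + 1))); split.
  { apply Rmin_glb_lt; [lra|apply Rinv_0_lt_compat; lra]. }
  intros h theta e [Hh0 Hh] E0 E1 E2 HE.
  assert (Hh1 := Rmin_l (1 / 6) (/ (20 * K + 1))).
  assert (Hh2 := Rmin_r (1 / 6) (/ (20 * K + 1))).
  assert (Hs := pow_small (20 * K) h 1 ltac:(lra) ltac:(lra)
    (inv_bound (20 * K) h ltac:(lra) ltac:(lra))).
  destruct (low_moments 2 F h theta e ltac:(lra) HE) as (M0 & M1 & M2).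
  destruct (H h theta e ltac:(lra) HE) as (M3 & M4).
  assert (N := norm1_pos e); assert (T := Rabs_pos theta).
  assert (HW := tail_defect e theta _ E0 E1 E2 M0 M1 M2 M3 M4).
  set (W := norm1 e + Rabs theta) in *.
  assert (HW0 : 0 <= W) by (unfold W; lra).
  assert (Hx : 20 * (K * h ^ 2 * W) <= W).
  { replace (20 * (K * h ^ 2 * W)) with (20 * K * h ^ 2 * W) by ring.
    rewrite <- (Rmult_1_l W) at 2; apply Rmult_le_compat_r; auto. }
  assert (W = 0) by lra.
  split; [|unfold W in *; lra].
  destruct (Req_dec theta 0) as [|Ht]; auto; apply Rabs_no_R0 in Ht; unfold W in *; lra.
Qed.

Lemma exact_family_lin (p : nat) (F : nat -> R -> R) (h a b t t' : R) (e e' : nat -> R) :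
  exact_family p F h t e -> exact_family p F h t' e' ->
  exact_family p F h (a * t + b * t') (fun k => a * e k + b * e' k).
Proof.
  intros [H1 H2] [H1' H2']; unfold exact_family, exact_on in *.
  assert (E : forall g, dot (fun k => a * e k + b * e' k) g = a * dot e g + b * dot e' g)
    by (intros; unfold dot; ring).
  split; intros n Hn; rewrite E.
  - rewrite H1, H1' by auto; ring.
  - rewrite H2, H2' by auto; ring.
Qed.

Lemma exact_family_ext (p : nat) (F : nat -> R -> R) (h t t' : R) (e e' : nat -> R) :
  (forall k, (k < 7)%nat -> e k = e' k) -> t = t' ->
  exact_family p F h t e -> exact_family p F h t' e'.
Proof.
  intros H Ht [H1 H2]; subst t'.
  assert (E : forall g, dot e' g = dot e g)
    by (intros; unfold dot; rewrite !H by lia; reflexivity).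
  split; intros n Hn; unfold exact_on; rewrite E; [apply H1|apply H2]; auto.
Qed.

Lemma expspan_list5_list7 (lam : C) (q : R -> C) :
  expspan (exponents5 lam) q -> expspan (exponents7 lam) q.
Proof.
  intros (a0 & a1 & a2 & b & H).
  exists a0, a1, a2, (fun n => match n with O => b 0%nat | 1%nat => b 1%nat | _ => RtoC 0 end).
  intros x; rewrite H; simpl; ring.
Qed.

Lemma expspan_mono (ls : list C) (n : nat) : (n <= 2)%nat ->
  expspan ls (fun x => RtoC (mono n x)).
Proof.
  intros Hn; destruct n as [|[|[|n]]]; [| | |lia].
  - eapply expspan_ext; [|apply (expspan_quadratic ls 1 0 0)].
    intros x; simpl; rewrite mono_0; ring.
  - eapply expspan_ext; [|apply (expspan_quadratic ls 0 1 0)].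
    intros x; simpl; rewrite mono_S, mono_0; simpl INR.
    replace (x / 1 * 1) with x by field; ring.
  - eapply expspan_ext; [|apply (expspan_quadratic ls 0 0 (/ 2)%R)].
    intros x; simpl; rewrite !mono_S, mono_0; simpl INR.
    replace (x / (1 + 1) * (x / 1 * 1)) with (/ 2 * (x * x)) by field.
    rewrite !RtoC_mult; ring.
Qed.

Lemma list5_admissible (lam : C) (h : R) : lam <> 0 -> 0 < h -> h * (2 * Cmod lam + 1) <= 1 ->
  admissible (exponents5 lam) h.
Proof.
  intros H0 Hh Hs.
  assert (HM : 0 <= Cmod lam) by apply Cmod_ge_0.
  assert (Hi : Rabs (Im lam) * h < 1 / 2).
  { assert (A := Rmax_Cmod lam); assert (B := Rmax_r (Rabs (fst lam)) (Rabs (snd lam))).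
    change (Im lam) with (snd lam).
    assert (Rabs (snd lam) * h <= Cmod lam * h) by (apply Rmult_le_compat_r; lra); lra. }
  split; [auto|split].
  - constructor; [|constructor; [intros []|constructor]].
    intros [E|[]]; apply H0; destruct lam as [a b]; injection E; intros.
    apply injective_projections; simpl; lra.
  - intros l [E|[E|[]]]; subst l; split; auto.
    + intros E; apply H0; replace lam with (- - lam)%C by ring; rewrite E; ring.
    + replace (Im (- lam)) with (- Im lam) by reflexivity; rewrite Rabs_Ropp; auto.
Qed.

Lemma list7_admissible (lam : C) (h : R) : lam <> 0 -> 0 < h -> h * (2 * Cmod lam + 1) <= 1 ->
  admissible (exponents7 lam) h.
Proof.
  intros H0 Hh Hs.
  assert (HM : 0 <= Cmod lam) by apply Cmod_ge_0.
  assert (A := Rmax_Cmod lam); assert (B := Rmax_r (Rabs (fst lam)) (Rabs (snd lam))).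
  assert (B' := Rmax_l (Rabs (fst lam)) (Rabs (snd lam))).
  assert (Hi : Rabs (snd lam) * h < 1 / 2).
  { assert (Rabs (snd lam) * h <= Cmod lam * h) by (apply Rmult_le_compat_r; lra); lra. }
  assert (Hr : Rabs (fst lam) * h < 1 / 2).
  { assert (Rabs (fst lam) * h <= Cmod lam * h) by (apply Rmult_le_compat_r; lra); lra. }
  destruct lam as [a b]; simpl fst in *; simpl snd in *.
  assert (Hab : ~ (a = 0 /\ b = 0)) by (intros [-> ->]; apply H0; reflexivity).
  split; [auto|split].
  - repeat constructor; simpl; intros HI; repeat destruct HI as [HI|HI]; try tauto;
      injection HI; intros; apply Hab; lra.
  - intros l HI; repeat destruct HI as [HI|HI]; try tauto; subst l; simpl; split;
      try (intros E; injection E; intros; apply Hab; lra).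
    + auto.
    + rewrite Rabs_Ropp; auto.
    + replace (0 * b + 1 * a) with a by ring; auto.
    + replace (0 * b + 1 * a) with a by ring; rewrite Rabs_Ropp; auto.
Qed.

(** * Coefficients and ideal weights *)

(** The vectors [e], [e'] are any rewriting of the stencil on seven offsets, which covers padded
    substencils and the big stencil at once. *)
Lemma stencil_coef_exact_family (ls : list C) (G : (R -> C) -> Prop) (h xi : R)
    (lo : Z) (N p : nat) (s : R) (F : nat -> R -> R) :
  admissible ls h -> (forall f, G f <-> expspan ls f) -> (N = length ls + 2)%nat ->
  exp_family p s F ->
  (forall n, (3 <= n <= p + 2)%nat -> expspan ls (fun x => RtoC (F n x))) ->
  let c := stencil_coef G h xi lo N in
  forall e e' : nat -> R,
  (forall g : R -> R, sum_n (fun k => Re (c k) * g (IZR (lo + Z.of_nat k))) N = dot e g) ->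
  (forall g : R -> R, sum_n (fun k => Im (c k) * g (IZR (lo + Z.of_nat k))) N = dot e' g) ->
  exact_family p F h 1 e /\ exact_family p F h 0 e'.
Proof.
  intros Had HG HN (HD & _) HF c e e' He He'.
  assert (HM : forall n, (n <= 2)%nat ->
    exact_on h 1 e (mono n) (mono (3 + n)) /\ exact_on h 0 e' (mono n) (mono (3 + n))).
  { intros n Hn.
    destruct (stencil_coef_exact_real ls G h xi lo N (mono n) (mono (1 + n))
      (mono (2 + n)) (mono (3 + n)) Had HG HN (expspan_mono ls n Hn)) as [E1 E2].
    - intros x; destruct n as [|n]; [|eexists; apply is_derive_monomial].
      apply (ex_derive_ext (fun _ => 1)); [intros; symmetry; apply mono_0|apply @ex_derive_const].
    - intros; apply is_derive_monomial.
    - intros; apply is_derive_monomial.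
    - intros; apply is_derive_monomial.
    - unfold exact_on; rewrite <- (He (fun j => rdiff3 h (mono (3 + n)) (j * h))).
      rewrite <- (He' (fun j => rdiff3 h (mono (3 + n)) (j * h))).
      rewrite Rmult_1_l, Rmult_0_l; split; assumption. }
  assert (HE : forall n, (3 <= n <= p + 2)%nat ->
    exact_on h 1 e (F n) (F (3 + n)%nat) /\ exact_on h 0 e' (F n) (F (3 + n)%nat)).
  { intros n Hn.
    destruct (stencil_coef_exact_real ls G h xi lo N (F n) (F (1 + n)%nat)
      (F (2 + n)%nat) (F (3 + n)%nat) Had HG HN (HF n Hn)) as [E1 E2].
    - intros x; destruct n as [|n]; [lia|exists (F n x); apply HD].
    - intros; apply HD.
    - intros; apply HD.
    - intros; apply HD.
    - unfold exact_on; rewrite <- (He (fun j => rdiff3 h (F (3 + n)%nat) (j * h))).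
      rewrite <- (He' (fun j => rdiff3 h (F (3 + n)%nat) (j * h))).
      rewrite Rmult_1_l, Rmult_0_l; split; assumption. }
  split; split; intros n Hn; try apply HM; try apply HE; auto.
Qed.

Lemma norm1_zero (e : nat -> R) (k : nat) : norm1 e <= 0 -> (k < 7)%nat -> e k = 0.
Proof.
  intros H Hk; assert (A := le_norm1 e k Hk); assert (B := Rabs_pos (e k)).
  destruct (Req_dec (e k) 0) as [|E]; auto; apply Rabs_no_R0 in E; lra.
Qed.

Lemma pad_at (m k : nat) (c : nat -> R) : (k <= 4)%nat -> pad m c (m + k)%nat = c k.
Proof.
  intros Hk; unfold pad; destruct (le_dec m (m + k)), (le_dec (m + k) (m + 4)); try lia.
  f_equal; lia.
Qed.

Lemma dot_ext_l (e e' : nat -> R) (g : R -> R) :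
  (forall k, (k < 7)%nat -> e k = e' k) -> dot e g = dot e' g.
Proof. intros H; unfold dot; rewrite !H by lia; reflexivity. Qed.

Lemma C_eq_RtoC (z : C) (r : R) : Re z = r -> Im z = 0 -> z = RtoC r.
Proof. intros H1 H2; apply injective_projections; auto. Qed.

Lemma sub_coefficients (lam : C) : lam <> 0 -> Im lam = 0 \/ Re lam = 0 ->
  exists K delta, 0 <= K /\ 0 < delta /\ forall h, 0 < h < delta ->
  forall m, (m <= 2)%nat ->
  let e := pad m (fun k => Re (subC lam h 0 m k)) in
  norm1 e <= K /\ moment 0 e = 0 /\ moment 1 e = 0 /\ moment 2 e = 2 /\
  Rabs (moment 3 e - 3) <= K * h ^ 2 /\ Rabs (moment 4 e - 2) <= K * h ^ 2 /\
  Rabs (Re (subC lam h 0 m 0) - lead m) <= K * h ^ 2 /\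
  forall xi k, (k <= 4)%nat -> subC lam h xi m k = RtoC (Re (subC lam h 0 m k)).
Proof.
  intros H0 Hri.
  destruct (expspan5_family lam H0 Hri) as (s & F & HF & HS).
  destruct (exact_sub_bound s F HF) as (K & d & HK & Hd & HB).
  assert (HC : 0 < 2 * Cmod lam + 1) by (assert (A := Cmod_ge_0 lam); lra).
  exists K, (Rmin d (/ (2 * Cmod lam + 1))); split; auto; split.
  { apply Rmin_glb_lt; auto; apply Rinv_0_lt_compat; auto. }
  intros h [Hh Hhd] m Hm e.
  assert (Hh1 := Rmin_l d (/ (2 * Cmod lam + 1))).
  assert (Hh2 := Rmin_r d (/ (2 * Cmod lam + 1))).
  assert (Had : admissible (exponents5 lam) h).
  { apply list5_admissible; auto; apply inv_bound; [assert (A := Cmod_ge_0 lam)|]; lra. }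
  assert (HE : forall xi,
    exact_family 2 F h 1 (pad m (fun k => Re (subC lam h xi m k))) /\
    exact_family 2 F h 0 (pad m (fun k => Im (subC lam h xi m k)))).
  { intros xi; apply (stencil_coef_exact_family (exponents5 lam) (Gamma5 lam) h xi
      (-2 + Z.of_nat m) 4 2 s F); auto.
    - apply Gamma5_expspan.
    - intros n Hn; apply HS; lia.
    - intros g; apply (sum_n_pad m (fun k => Re (subC lam h xi m k))); auto.
    - intros g; apply (sum_n_pad m (fun k => Im (subC lam h xi m k))); auto. }
  destruct (HE 0) as [E1 _]; fold e in E1.
  destruct (HB h 1 m _ ltac:(lra) Hm E1) as (B1 & B3 & B4).
  destruct (low_moments 2 F h 1 e ltac:(lra) E1) as (M0 & M1 & M2).
  fold e in B1, B3, B4; rewrite Rabs_R1, !Rmult_1_r in *.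
  repeat split; auto.
  - assert (L := pad_lead m (fun k => Re (subC lam h 0 m k)) 1 (K * h ^ 2) Hm M0 M1).
    rewrite !Rmult_1_r in L; apply L; auto.
  - intros xi k Hk; destruct (HE xi) as [EX EI].
    apply C_eq_RtoC.
    (* The difference of the real parts at two base points is exact with [theta = 0], hence zero;
       the imaginary parts below vanish for the same reason. *)
    + assert (E := exact_family_lin 2 F h 1 (-1) 1 1 _ _ EX E1).
      apply (exact_family_ext 2 F h _ 0 _ (pad m (fun k => Re (subC lam h xi m k)
        - Re (subC lam h 0 m k)))) in E; [|intros i Hi; unfold e, pad;
        destruct (le_dec m i), (le_dec i (m + 4)); ring | ring].
      destruct (HB h 0 m _ ltac:(lra) Hm E) as (Z & _).
      rewrite Rabs_R0, Rmult_0_r in Z.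
      assert (Q := norm1_zero _ (m + k) Z ltac:(lia)); rewrite pad_at in Q by auto; lra.
    + destruct (HB h 0 m _ ltac:(lra) Hm EI) as (Z & _).
      rewrite Rabs_R0, Rmult_0_r in Z.
      assert (Q := norm1_zero _ (m + k) Z ltac:(lia)); rewrite pad_at in Q by auto; auto.
Qed.

Lemma big_coefficients (lam : C) : lam <> 0 -> Im lam = 0 \/ Re lam = 0 ->
  exists K delta, 0 <= K /\ 0 < delta /\ forall h, 0 < h < delta ->
  let e := fun k => Re (bigC lam h 0 k) in
  norm1 e <= K /\ moment 0 e = 0 /\ moment 1 e = 0 /\ moment 2 e = 2 /\
  Rabs (moment 3 e - 3) <= K * h ^ 4 /\ Rabs (moment 4 e - 2) <= K * h ^ 4 /\
  Rabs (moment 5 e) <= K * h ^ 4 /\ Rabs (moment 6 e + 1) <= K * h ^ 4 /\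
  forall xi k, (k <= 6)%nat -> bigC lam h xi k = RtoC (Re (bigC lam h 0 k)).
Proof.
  intros H0 Hri.
  destruct (expspan7_family lam H0 Hri) as (s & F & HF & HS).
  destruct (exact_big_bound s F HF) as (K & d & HK & Hd & HB).
  assert (HC : 0 < 2 * Cmod lam + 1) by (assert (A := Cmod_ge_0 lam); lra).
  exists K, (Rmin d (/ (2 * Cmod lam + 1))); split; auto; split.
  { apply Rmin_glb_lt; auto; apply Rinv_0_lt_compat; auto. }
  intros h [Hh Hhd] e.
  assert (Hh1 := Rmin_l d (/ (2 * Cmod lam + 1))).
  assert (Hh2 := Rmin_r d (/ (2 * Cmod lam + 1))).
  assert (Had : admissible (exponents7 lam) h).
  { apply list7_admissible; auto; apply inv_bound; [assert (A := Cmod_ge_0 lam)|]; lra. }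
  assert (HE : forall xi,
    exact_family 4 F h 1 (fun k => Re (bigC lam h xi k)) /\
    exact_family 4 F h 0 (fun k => Im (bigC lam h xi k))).
  { intros xi; apply (stencil_coef_exact_family (exponents7 lam) (Gamma7 lam) h xi (-2) 6 4 s F); auto.
    - apply Gamma7_expspan.
    - intros n Hn; apply HS; lia.
    - intros g; apply (sum_n_dot (fun k => Re (bigC lam h xi k))).
    - intros g; apply (sum_n_dot (fun k => Im (bigC lam h xi k))). }
  destruct (HE 0) as [E1 _]; fold e in E1.
  destruct (HB h 1 _ ltac:(lra) E1) as (B1 & B3 & B4 & B5 & B6).
  destruct (low_moments 4 F h 1 e ltac:(lra) E1) as (M0 & M1 & M2).
  rewrite Rabs_R1, !Rmult_1_r in *.
  repeat split; auto.
  intros xi k Hk; destruct (HE xi) as [EX EI].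
  apply C_eq_RtoC.
  - assert (E := exact_family_lin 4 F h 1 (-1) 1 1 _ _ EX E1).
    replace (1 * 1 + -1 * 1) with 0 in E by ring.
    destruct (HB h 0 _ ltac:(lra) E) as (Z & _).
    rewrite Rabs_R0, Rmult_0_r in Z.
    assert (Q := norm1_zero _ k Z ltac:(lia)); unfold e in Q; lra.
  - destruct (HB h 0 _ ltac:(lra) EI) as (Z & _).
    rewrite Rabs_R0, Rmult_0_r in Z.
    exact (norm1_zero _ k Z ltac:(lia)).
Qed.

(** The defect of the ideal weights mixes both kinds of stencil, so it has to be tested on the
    smaller space, where the big stencil is exact too. *)
Lemma big_exact_family5 (lam : C) (s : R) (F : nat -> R -> R) (h : R) :
  admissible (exponents7 lam) h -> exp_family 2 s F ->
  (forall n, (n <= 4)%nat -> expspan (exponents5 lam) (fun x => RtoC (F n x))) ->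
  exact_family 2 F h 1 (fun k => Re (bigC lam h 0 k)).
Proof.
  intros Had HF HS.
  apply (stencil_coef_exact_family (exponents7 lam) (Gamma7 lam) h 0 (-2) 6 2 s F Had) with
    (e' := fun k => Im (bigC lam h 0 k)); auto.
  - apply Gamma7_expspan.
  - intros n Hn; apply expspan_list5_list7, HS; lia.
  - intros g; apply (sum_n_dot (fun k => Re (bigC lam h 0 k))).
  - intros g; apply (sum_n_dot (fun k => Im (bigC lam h 0 k))).
Qed.

Lemma Rabs_div_lower (a b B : R) : Rabs a <= B -> 1 / 8 <= Rabs b -> Rabs (a / b) <= 8 * B.
Proof.
  intros Ha Hb; unfold Rdiv; rewrite Rabs_mult, Rabs_inv.
  assert (Hi : / Rabs b <= 8).
  { replace 8 with (/ (1 / 8)) by field; apply Rinv_le_contravar; lra. }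
  rewrite Rmult_comm; apply Rmult_le_compat; auto.
  - left; apply Rinv_0_lt_compat; lra.
  - apply Rabs_pos.
Qed.

(** The system is triangular, since substencil [m] starts at offset index [m]. The nested factors
    [1 *] are the form produced by iterating [exact_family_lin]. *)
Lemma ideal_weight_defect (c0 c1 c2 Cb : nat -> R) :
  c0 0%nat <> 0 -> c1 0%nat <> 0 -> c2 0%nat <> 0 ->
  let w0 := Cb 0%nat / c0 0%nat in
  let w1 := (Cb 1%nat - w0 * c0 1%nat) / c1 0%nat in
  let w2 := (Cb 2%nat - w0 * c0 2%nat - w1 * c1 1%nat) / c2 0%nat in
  let e := fun k => 1 * (1 * (1 * Cb k + - w0 * pad 0 c0 k) + - w1 * pad 1 c1 k)
                    + - w2 * pad 2 c2 k in
  e 0%nat = 0 /\ e 1%nat = 0 /\ e 2%nat = 0.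
Proof.
  intros N0 N1 N2 w0 w1 w2 e; unfold e, pad; simpl.
  split; [|split].
  - unfold w0; field; auto.
  - unfold w1; field; auto.
  - unfold w2; field; auto.
Qed.

(** An interface to the asymptotics: from here on, the scheme at step [h] is known only through real
    vectors [c], [Cb], [d], with one bound for all small [h] and no dependence on the base point. *)
Lemma scheme_structure (lam : C) : lam <> 0 -> Im lam = 0 \/ Re lam = 0 ->
  exists K delta, 0 <= K /\ 0 < delta /\ forall h, 0 < h < delta ->
  exists (c : nat -> nat -> R) (Cb d : nat -> R),
    (forall m, (m <= 2)%nat -> let e := pad m (c m) in
       norm1 e <= K /\ moment 0 e = 0 /\ moment 1 e = 0 /\ moment 2 e = 2 /\
       Rabs (moment 3 e - 3) <= K * h ^ 2 /\ Rabs (moment 4 e - 2) <= K * h ^ 2) /\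
    (norm1 Cb <= K /\ moment 0 Cb = 0 /\ moment 1 Cb = 0 /\ moment 2 Cb = 2 /\
     Rabs (moment 3 Cb - 3) <= K * h ^ 4 /\ Rabs (moment 4 Cb - 2) <= K * h ^ 4 /\
     Rabs (moment 5 Cb) <= K * h ^ 4 /\ Rabs (moment 6 Cb + 1) <= K * h ^ 4) /\
    (forall m, (m <= 2)%nat -> Rabs (d m) <= K) /\
    d 0%nat + d 1%nat + d 2%nat = 1 /\
    (forall g, dot Cb g = d 0%nat * dot (pad 0 (c 0%nat)) g
       + d 1%nat * dot (pad 1 (c 1%nat)) g + d 2%nat * dot (pad 2 (c 2%nat)) g) /\
    (forall xi m, (m <= 2)%nat -> ideal_weight lam h xi m = RtoC (d m)) /\
    (forall xi v m, (m <= 2)%nat ->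
       subflux lam v h xi m = RtoC (dot (pad m (c m)) (fun j => v (xi + j * h)))).
Proof.
  intros H0 Hri.
  destruct (sub_coefficients lam H0 Hri) as (K1 & dl1 & HK1 & Hd1 & HS).
  destruct (big_coefficients lam H0 Hri) as (K2 & dl2 & HK2 & Hd2 & HB).
  destruct (expspan5_family lam H0 Hri) as (s & F & HF & HM).
  destruct (exact_tail_zero s F HF) as (dl3 & Hd3 & HT).
  assert (HC : 0 < 2 * Cmod lam + 1) by (assert (A := Cmod_ge_0 lam); lra).
  assert (HC2 : 0 < 8 * K1 + 1) by lra.
  set (L := K1 + K2).
  (* Successive bounds for the ideal weights; each division by a leading coefficient of absolute
     value at least 1/8 costs a factor 8. *)
  set (W0 := 8 * L). set (W1 := 8 * (L + W0 * L)).
  set (W2 := 8 * (L + W0 * L + W1 * L)).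
  assert (PL : 0 <= L) by (unfold L; lra).
  assert (PW0 : 0 <= W0) by (unfold W0; lra).
  assert (PWL : 0 <= W0 * L) by (apply Rmult_le_pos; auto).
  assert (PW1 : 0 <= W1) by (unfold W1; lra).
  assert (PWL1 : 0 <= W1 * L) by (apply Rmult_le_pos; auto).
  assert (PW2 : 0 <= W2) by (unfold W2; lra).
  exists (L + W0 + W1 + W2),
    (Rmin (Rmin dl1 dl2) (Rmin dl3 (Rmin (Rmin 1 (/ (2 * Cmod lam + 1))) (/ (8 * K1 + 1))))).
  split; [lra|split].
  { repeat apply Rmin_glb_lt; auto; try lra; apply Rinv_0_lt_compat; auto. }
  intros h [Hh Hhd].
  assert (D1 := Rmin_l (Rmin dl1 dl2) (Rmin dl3 (Rmin (Rmin 1 (/ (2 * Cmod lam + 1))) (/ (8 * K1 + 1))))).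
  assert (D2 := Rmin_r (Rmin dl1 dl2) (Rmin dl3 (Rmin (Rmin 1 (/ (2 * Cmod lam + 1))) (/ (8 * K1 + 1))))).
  assert (D3 := Rmin_l dl1 dl2). assert (D4 := Rmin_r dl1 dl2).
  assert (D5 := Rmin_l dl3 (Rmin (Rmin 1 (/ (2 * Cmod lam + 1))) (/ (8 * K1 + 1)))).
  assert (D6 := Rmin_r dl3 (Rmin (Rmin 1 (/ (2 * Cmod lam + 1))) (/ (8 * K1 + 1)))).
  assert (D7 := Rmin_l (Rmin 1 (/ (2 * Cmod lam + 1))) (/ (8 * K1 + 1))).
  assert (D8 := Rmin_r (Rmin 1 (/ (2 * Cmod lam + 1))) (/ (8 * K1 + 1))).
  assert (D9 := Rmin_l 1 (/ (2 * Cmod lam + 1))).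
  assert (D10 := Rmin_r 1 (/ (2 * Cmod lam + 1))).
  assert (Hh' : 0 < h < dl1) by lra. assert (Hh'' : 0 < h < dl2) by lra.
  specialize (HS h Hh'); specialize (HB h Hh'').
  assert (Had7 : admissible (exponents7 lam) h).
  { apply list7_admissible; auto; apply inv_bound; [assert (A := Cmod_ge_0 lam)|]; lra. }
  assert (Had5 : admissible (exponents5 lam) h).
  { apply list5_admissible; auto; apply inv_bound; [assert (A := Cmod_ge_0 lam)|]; lra. }
  set (c := fun m k => Re (subC lam h 0 m k)).
  set (Cb := fun k => Re (bigC lam h 0 k)).
  (* The limits of the leading coefficients are -1/4, 1/4 and 7/4; an error of 1/8 keeps them at
     least 1/8 away from zero. *)
  assert (Hsmall : K1 * h ^ 2 <= 1 / 8).
  { assert (P := pow_small (8 * K1) h 1 ltac:(lra) ltac:(lra)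
      (inv_bound (8 * K1) h ltac:(lra) ltac:(lra))); lra. }
  assert (Hlead : forall m, (m <= 2)%nat -> 1 / 8 <= Rabs (c m 0%nat)).
  { intros m Hm; destruct (HS m Hm) as (_ & _ & _ & _ & _ & _ & Q & _).
    fold (c m 0%nat) in Q; apply Rabs_le_between in Q.
    destruct m as [|[|[|m]]]; [| | |lia]; unfold lead in Q;
      [rewrite Rabs_left by lra | rewrite Rabs_pos_eq by lra | rewrite Rabs_pos_eq by lra]; lra. }
  assert (Hc0 : forall m, (m <= 2)%nat -> c m 0%nat <> 0).
  { intros m Hm E; assert (Q := Hlead m Hm); rewrite E, Rabs_R0 in Q; lra. }
  set (w0 := Cb 0%nat / c 0%nat 0%nat).
  set (w1 := (Cb 1%nat - w0 * c 0%nat 1%nat) / c 1%nat 0%nat).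
  set (w2 := (Cb 2%nat - w0 * c 0%nat 2%nat - w1 * c 1%nat 1%nat) / c 2%nat 0%nat).
  set (d := fun m => match m with O => w0 | 1%nat => w1 | _ => w2 end).
  set (e := fun k => 1 * (1 * (1 * Cb k + - w0 * pad 0 (c 0%nat) k) + - w1 * pad 1 (c 1%nat) k)
                    + - w2 * pad 2 (c 2%nat) k).
  assert (Hsub : forall m, (m <= 2)%nat -> exact_family 2 F h 1 (pad m (c m))).
  { intros m Hm; apply (stencil_coef_exact_family (exponents5 lam) (Gamma5 lam) h 0
      (-2 + Z.of_nat m) 4 2 s F Had5) with (e' := pad m (fun k => Im (subC lam h 0 m k))); auto.
    - apply Gamma5_expspan.
    - intros n Hn; apply HM; lia.
    - intros g; apply (sum_n_pad m (fun k => Re (subC lam h 0 m k))); auto.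
    - intros g; apply (sum_n_pad m (fun k => Im (subC lam h 0 m k))); auto. }
  assert (He := exact_family_lin 2 F h 1 (- w2) _ _ _ _
    (exact_family_lin 2 F h 1 (- w1) _ _ _ _
      (exact_family_lin 2 F h 1 (- w0) _ _ _ _
        (big_exact_family5 lam s F h Had7 HF HM) (Hsub 0%nat ltac:(lia)))
      (Hsub 1%nat ltac:(lia))) (Hsub 2%nat ltac:(lia))).
  fold Cb in He; change (exact_family 2 F h (1 * (1 * (1 * 1 + - w0 * 1) + - w1 * 1) + - w2 * 1) e) in He.
  destruct (ideal_weight_defect (c 0%nat) (c 1%nat) (c 2%nat) Cb (Hc0 0%nat ltac:(lia))
    (Hc0 1%nat ltac:(lia)) (Hc0 2%nat ltac:(lia))) as (Z0 & Z1 & Z2).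
  destruct (HT h _ e ltac:(lra) Z0 Z1 Z2 He) as [Hsum HN].
  destruct HB as (B0 & B1 & B2 & B3 & B4 & B5 & B6 & B7 & B8).
  fold Cb in B0, B1, B2, B3, B4, B5, B6, B7.
  assert (Hcb : forall m k, (m <= 2)%nat -> (k <= 4)%nat -> Rabs (c m k) <= L).
  { intros m k Hm Hk; destruct (HS m Hm) as (Q & _).
    fold (c m) in Q; change (fun k => Re (subC lam h 0 m k)) with (c m) in Q.
    assert (Q2 := le_norm1 (pad m (c m)) (m + k) ltac:(lia)).
    rewrite pad_at in Q2 by auto; unfold L; lra. }
  assert (HCbb : forall k, (k < 7)%nat -> Rabs (Cb k) <= L).
  { intros k Hk; assert (Q := le_norm1 Cb k Hk); unfold L; lra. }
  assert (Hw0 : Rabs w0 <= W0) by (apply Rabs_div_lower; [apply HCbb; lia|apply Hlead; lia]).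
  assert (Hmul : forall a b A, 0 <= A -> Rabs a <= A -> Rabs b <= L -> Rabs (a * b) <= A * L).
  { intros; rewrite Rabs_mult; apply Rmult_le_compat; auto; apply Rabs_pos. }
  assert (Hsub2 : forall a b A B, Rabs a <= A -> Rabs b <= B -> Rabs (a - b) <= A + B).
  { intros a b A B Ha Hb; eapply Rle_trans; [apply Rabs_triang|].
    rewrite Rabs_Ropp; lra. }
  assert (Hw1 : Rabs w1 <= W1).
  { apply Rabs_div_lower; [|apply Hlead; lia].
    apply Hsub2; [apply HCbb; lia|apply Hmul; auto; apply Hcb; lia]. }
  assert (Hw2 : Rabs w2 <= W2).
  { apply Rabs_div_lower; [|apply Hlead; lia].
    apply Hsub2; [apply Hsub2; [apply HCbb; lia|]|]; apply Hmul; auto; apply Hcb; lia. }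
  exists c, Cb, d.
  assert (Hh2 : 0 <= h ^ 2) by (apply pow_le; lra).
  assert (Hh4 : 0 <= h ^ 4) by (apply pow_le; lra).
  assert (HLK : forall a b, 0 <= b -> a <= L * b -> a <= (L + W0 + W1 + W2) * b).
  { intros a b Hb Ha; eapply Rle_trans; [exact Ha|]; apply Rmult_le_compat_r; lra. }
  assert (HL1 : forall a b, 0 <= b -> a <= K1 * b -> a <= (L + W0 + W1 + W2) * b).
  { intros a b Hb Ha; apply HLK; auto; eapply Rle_trans; [exact Ha|].
    apply Rmult_le_compat_r; auto; unfold L; lra. }
  assert (HL2 : forall a b, 0 <= b -> a <= K2 * b -> a <= (L + W0 + W1 + W2) * b).
  { intros a b Hb Ha; apply HLK; auto; eapply Rle_trans; [exact Ha|].
    apply Rmult_le_compat_r; auto; unfold L; lra. }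
  split; [|split; [|split; [|split; [|split; [|split]]]]].
  - intros m Hm em; destruct (HS m Hm) as (Q0 & Q1 & Q2 & Q3 & Q4 & Q5 & _).
    repeat split; auto.
    apply Rle_trans with K1; [exact Q0|unfold L; lra].
  - repeat split; auto.
    apply Rle_trans with K2; [exact B0|unfold L; lra].
  - intros m Hm; destruct m as [|[|[|m]]]; [| | |lia]; simpl; lra.
  - simpl; lra.
  - intros g; assert (Ez : dot e g = 0).
    { rewrite (dot_ext_l e (fun _ => 0)); [unfold dot; ring|].
      intros k Hk; apply norm1_zero; auto; lra. }
    assert (Eg : dot e g = dot Cb g - w0 * dot (pad 0 (c 0%nat)) g
       - w1 * dot (pad 1 (c 1%nat)) g - w2 * dot (pad 2 (c 2%nat)) g)
      by (unfold e, dot; ring).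
    simpl d; lra.
  - intros xi m Hm.
    assert (S : forall m k, (m <= 2)%nat -> (k <= 4)%nat -> subC lam h xi m k = RtoC (c m k)).
    { intros m' k Hm' Hk; apply HS; auto. }
    assert (SB : forall k, (k <= 6)%nat -> bigC lam h xi k = RtoC (Cb k)) by (intros; apply B8; auto).
    assert (X0 : Defs.d0 lam h xi = RtoC w0).
    { unfold Defs.d0, w0; rewrite S, SB, RtoC_div by (auto; lia); reflexivity. }
    assert (X1 : Defs.d1 lam h xi = RtoC w1).
    { unfold Defs.d1, w1; rewrite X0, !S, SB by lia.
      rewrite RtoC_div, RtoC_minus, RtoC_mult by (auto; lia); reflexivity. }
    destruct m as [|[|[|m]]]; [exact X0|exact X1| |lia].
    simpl; unfold Defs.d2, w2; rewrite X0, X1, !S, SB by lia.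
    rewrite RtoC_div, !RtoC_minus, !RtoC_mult by (auto; lia); reflexivity.
  - intros xi v m Hm; unfold subflux.
    rewrite (stencil_coef_spec (exponents5 lam)); auto; [|apply Gamma5_expspan].
    rewrite <- (sum_n_pad m (c m)) by auto.
    fold (subC lam h xi m).
    apply C_eq_RtoC.
    + rewrite Re_sum_n; apply sum_n_ext_loc; intros k Hk.
      destruct (HS m Hm) as (_ & _ & _ & _ & _ & _ & _ & Q).
      rewrite (Q xi k Hk); reflexivity.
    + rewrite Im_sum_n.
      rewrite (sum_n_ext_loc _ (fun _ => 0)).
      * rewrite sum_n_const; simpl; ring.
      * intros k Hk; destruct (HS m Hm) as (_ & _ & _ & _ & _ & _ & _ & Q).
        rewrite (Q xi k Hk); simpl; ring.
Qed.

(** * Taylor expansion of the fluxes *)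

(** [N] counts terms, so the degree is [N - 1]. Keeping the derivative order [m] as a parameter
    makes the derivative of one Taylor polynomial another of the same form. *)
Fixpoint taylor (D : nat -> R -> R) (y : R) (N m : nat) (x : R) : R :=
  match N with
  | O => 0
  | S N' => taylor D y N' m x + D (m + N')%nat y * mono N' (x - y)
  end.

Lemma is_derive_mono_shift (n : nat) (y x : R) :
  is_derive (fun x => mono (S n) (x - y)) x (mono n (x - y)).
Proof.
  replace (mono n (x - y)) with (scal 1 (mono n (x - y))) by apply Rmult_1_l.
  apply (is_derive_comp (mono (S n)) (fun x => x - y)); [apply is_derive_monomial|].
  auto_derive; auto; ring.
Qed.

Lemma is_derive_taylor (D : nat -> R -> R) (y : R) (N m : nat) (x : R) :
  is_derive (taylor D y (S N) m) x (taylor D y N (S m) x).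
Proof.
  revert m; induction N as [|N IH]; intros m.
  - apply (is_derive_ext (fun _ => D (m + 0)%nat y)).
    + intros t; simpl; rewrite mono_0; ring.
    + apply @is_derive_const.
  - change (taylor D y (S N) (S m) x)
      with (taylor D y N (S m) x + D (S m + N)%nat y * mono N (x - y)).
    apply (is_derive_ext (fun x => taylor D y (S N) m x
      + D (m + S N)%nat y * mono (S N) (x - y))); [reflexivity|].
    apply @is_derive_plus; [apply IH|].
    replace (m + S N)%nat with (S m + N)%nat by lia.
    apply is_derive_scal, is_derive_mono_shift.
Qed.

Lemma taylor_at_center (D : nat -> R -> R) (y : R) (N m : nat) :
  taylor D y (S N) m y = D m y.
Proof.
  induction N as [|N IH].
  - simpl; rewrite mono_0, Nat.add_0_r; ring.
  - change (taylor D y (S (S N)) m y)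
      with (taylor D y (S N) m y + D (m + S N)%nat y * mono (S N) (y - y)).
    rewrite IH; unfold mono; rewrite Rminus_diag, pow_i by lia.
    unfold Rdiv; ring.
Qed.

Lemma taylor_remainder (D : nat -> R -> R) (xi r K : R) : 0 <= K -> 0 <= r ->
  (forall m x, Rabs (x - xi) <= 2 * r -> is_derive (D m) x (D (S m) x)) ->
  forall N m, (forall x, Rabs (x - xi) <= 2 * r -> Rabs (D (m + N)%nat x) <= K) ->
  forall y x, Rabs (y - xi) <= r -> Rabs (x - y) <= r ->
    Rabs (D m x - taylor D y N m x) <= K * Rabs (x - y) ^ N.
Proof.
  intros HK Hr HD.
  assert (Hin : forall x y, Rabs (y - xi) <= r -> Rabs (x - y) <= r -> Rabs (x - xi) <= 2 * r).
  { intros x y Hy Hx; replace (x - xi) with ((x - y) + (y - xi)) by ring.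
    eapply Rle_trans; [apply Rabs_triang|lra]. }
  induction N as [|N IH]; intros m HB y x Hy Hx.
  - simpl; rewrite Rminus_0_r, Rmult_1_r.
    rewrite <- (Nat.add_0_r m); apply HB, (Hin x y); auto.
  - apply (mvt_pow_bound (fun x => D m x - taylor D y (S N) m x)
      (fun x => D (S m) x - taylor D y N (S m) x) y r); auto.
    + intros z Hz; apply @is_derive_minus; [apply HD, (Hin z y); auto|apply is_derive_taylor].
    + intros z Hz; apply IH; auto.
      intros t Ht; replace (S m + N)%nat with (m + S N)%nat by lia; auto.
    + rewrite taylor_at_center; ring.
Qed.

Lemma derivatives_bounded (D : nat -> R -> R) (xi r : R) : 0 < r ->
  (forall m x, Rabs (x - xi) <= 2 * r -> is_derive (D m) x (D (S m) x)) ->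
  forall N, exists K, 0 <= K /\ forall n x, (n <= N)%nat -> Rabs (x - xi) <= 2 * r ->
    Rabs (D n x) <= K.
Proof.
  intros Hr HD.
  assert (H1 : forall n, exists K, 0 <= K /\ forall x, Rabs (x - xi) <= 2 * r -> Rabs (D n x) <= K).
  { intros n.
    destruct (continuity_ab_maj (fun x => Rabs (D n x)) (xi - 2 * r) (xi + 2 * r))
      as (xm & Hm & _); [lra| |].
    - intros c Hc; apply continuity_pt_filterlim.
      apply continuous_comp; [|apply continuous_Rabs].
      apply (ex_derive_continuous (V := R_NormedModule)).
      exists (D (S n) c); apply HD, Rabs_le; lra.
    - exists (Rabs (D n xm)); split; [apply Rabs_pos|].
      intros x Hx; apply Hm; apply Rabs_le_between in Hx; lra. }
  induction N as [|N (K & HK & H)].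
  - destruct (H1 O) as (K & HK & H); exists K; split; auto.
    intros n x Hn; replace n with O by lia; auto.
  - destruct (H1 (S N)) as (K' & HK' & H'); exists (K + K'); split; [lra|].
    intros n x Hn Hx; destruct (le_lt_dec n N) as [L|L].
    + assert (Q := H n x L Hx); lra.
    + replace n with (S N) by lia; assert (Q := H' x Hx); lra.
Qed.

(** The constants are uniform over centers [y] near [xi], because the flux at the left interface is
    expanded about its own moving base point [xi - h]. *)
Lemma smooth_taylor (a b xi : R) (v : R -> R) : a < xi < b -> smooth_on a b v ->
  exists K r, 0 <= K /\ 0 < r <= 1 /\ forall y, Rabs (y - xi) <= r ->
    (forall n, (n <= 8)%nat -> Rabs (Derive_n v n y) <= K) /\
    forall N x, (N <= 8)%nat -> Rabs (x - y) <= r ->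
      Rabs (v x - taylor (Derive_n v) y N 0 x) <= K * Rabs (x - y) ^ N.
Proof.
  intros Hx Hs.
  (* With this [r], points within [r] of a center that is itself within [r] of [xi] stay inside the
     interval. *)
  set (r := Rmin 1 (Rmin (xi - a) (b - xi) / 4)).
  assert (R1 := Rmin_l 1 (Rmin (xi - a) (b - xi) / 4)).
  assert (R2 := Rmin_r 1 (Rmin (xi - a) (b - xi) / 4)).
  assert (R3 := Rmin_l (xi - a) (b - xi)). assert (R4 := Rmin_r (xi - a) (b - xi)).
  fold r in R1, R2.
  assert (Hr : 0 < r).
  { apply Rmin_glb_lt; [lra|]; assert (0 < Rmin (xi - a) (b - xi)) by (apply Rmin_glb_lt; lra); lra. }
  assert (HD : forall m x, Rabs (x - xi) <= 2 * r ->
    is_derive (Derive_n v m) x (Derive_n v (S m) x)).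
  { intros m x H; apply Derive_correct, (Hs (S m) x).
    apply Rabs_le_between in H; lra. }
  destruct (derivatives_bounded (Derive_n v) xi r Hr HD 8) as (K & HK & HB).
  exists K, r; split; auto; split; [lra|].
  intros y Hy; split.
  - intros n Hn; apply HB; auto; lra.
  - intros N x HN Hxy.
    apply (taylor_remainder (Derive_n v) xi r K HK ltac:(lra) HD N 0); auto.
Qed.

Definition poly_part (D : nat -> R) (h : R) (N : nat) (j : R) : R :=
  sum_f_R0 (fun n => D n * h ^ n * (j ^ n / INR (fact n))) N.

Lemma taylor_node (D : nat -> R -> R) (y h j : R) (N : nat) :
  taylor D y (S N) 0 (y + j * h) = poly_part (fun n => D n y) h N j.
Proof.
  unfold poly_part; induction N as [|N IH].
  - simpl; rewrite mono_0; field.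
  - change (taylor D y (S (S N)) 0 (y + j * h))
      with (taylor D y (S N) 0 (y + j * h) + D (S N) y * mono (S N) (y + j * h - y)).
    rewrite IH; simpl sum_f_R0.
    replace (y + j * h - y) with (j * h) by ring.
    rewrite mono_scal; unfold mono; rewrite <- Rmult_assoc; reflexivity.
Qed.

Lemma dot_sum (e : nat -> R) (a : nat -> R) (g : nat -> R -> R) (N : nat) :
  dot e (fun j => sum_f_R0 (fun n => a n * g n j) N)
  = sum_f_R0 (fun n => a n * dot e (g n)) N.
Proof.
  induction N as [|N IH]; simpl sum_f_R0.
  - apply dot_scal.
  - rewrite dot_plus, IH, dot_scal; reflexivity.
Qed.

Lemma INR_fact_values :
  INR (fact 0) = 1 /\ INR (fact 1) = 1 /\ INR (fact 2) = 2 /\ INR (fact 3) = 6 /\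
  INR (fact 4) = 24 /\ INR (fact 5) = 120 /\ INR (fact 6) = 720 /\ INR (fact 7) = 5040.
Proof.
  repeat split; rewrite ?fact_simpl, ?mult_INR; change (fact 0) with 1%nat;
    rewrite !INR_IZR_INZ; simpl; ring.
Qed.

Lemma poly_part_4 (D : nat -> R) (h j : R) :
  poly_part D h 4 j = D 0%nat + D 1%nat * h * j + D 2%nat * h ^ 2 / 2 * j ^ 2
    + D 3%nat * h ^ 3 / 6 * j ^ 3 + D 4%nat * h ^ 4 / 24 * j ^ 4.
Proof.
  destruct INR_fact_values as (F0 & F1 & F2 & F3 & F4 & _).
  unfold poly_part; cbn [sum_f_R0]; rewrite F0, F1, F2, F3, F4; field.
Qed.

(** * Fluxes and nonlinear weights on smooth data *)

Lemma Rabs_mult_le2 (a b A B : R) : Rabs a <= A -> Rabs b <= B -> Rabs (a * b) <= A * B.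
Proof.
  intros; rewrite Rabs_mult; apply Rmult_le_compat; auto; apply Rabs_pos.
Qed.

(** The limiting moments 2, 3, 2 divided by 2!, 3!, 4! give 1, 1/2, 1/12, whatever the substencil.
    Their [h^2] errors first matter next to [h^3], hence the order 5. *)
Lemma sub_flux_expansion (e D f : nat -> R) (g : R -> R) (h K K1 B : R) :
  0 < h <= 1 -> 0 <= K -> 0 <= K1 -> (forall n, (n <= 4)%nat -> Rabs (D n) <= K) ->
  (forall j, -2 <= j <= 4 -> Rabs (g j - poly_part D h 4 j) <= B) ->
  norm1 e <= K1 -> moment 0 e = 0 -> moment 1 e = 0 -> moment 2 e = 2 ->
  Rabs (moment 3 e - 3) <= K1 * h ^ 2 -> Rabs (moment 4 e - 2) <= K1 * h ^ 2 ->
  Rabs (dot e g - (D 2%nat * h ^ 2 + D 3%nat * h ^ 3 / 2 + D 4%nat * h ^ 4 / 12))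
  <= K * K1 * h ^ 5 + B * K1.
Proof.
  intros Hh HK HK1 HD Hg HN M0 M1 M2 M3 M4.
  assert (HB : 0 <= B) by (eapply Rle_trans; [apply Rabs_pos|apply (Hg 0); lra]).
  assert (Eg : dot e g = dot e (poly_part D h 4) + dot e (fun j => g j - poly_part D h 4 j))
    by (rewrite <- dot_plus; apply dot_ext; intros; ring).
  assert (Ep : dot e (poly_part D h 4) = D 0%nat * moment 0 e + D 1%nat * h * moment 1 e
    + D 2%nat * h ^ 2 / 2 * moment 2 e + D 3%nat * h ^ 3 / 6 * moment 3 e
    + D 4%nat * h ^ 4 / 24 * moment 4 e).
  { rewrite (dot_ext e _ _ (poly_part_4 D h)); unfold moment, dot; ring. }
  rewrite Eg, Ep, M0, M1, M2.
  assert (R0 : Rabs (dot e (fun j => g j - poly_part D h 4 j)) <= B * K1).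
  { eapply Rle_trans; [apply dot_bound; exact Hg|]; apply Rmult_le_compat_l; auto. }
  assert (Hp : 0 <= h ^ 5) by (apply pow_le; lra).
  assert (R3 : Rabs (h ^ 3 * (D 3%nat * (moment 3 e - 3))) <= K * K1 * h ^ 5).
  { replace (K * K1 * h ^ 5) with (h ^ 3 * (K * (K1 * h ^ 2))) by ring.
    rewrite Rabs_mult, (Rabs_pos_eq (h ^ 3)) by (apply pow_le; lra).
    apply Rmult_le_compat_l; [apply pow_le; lra|apply Rabs_mult_le2; auto]. }
  assert (R4 : Rabs (h ^ 4 * (D 4%nat * (moment 4 e - 2))) <= K * K1 * h ^ 5).
  { apply Rle_trans with (h ^ 4 * (K * (K1 * h ^ 2))).
    - rewrite Rabs_mult, (Rabs_pos_eq (h ^ 4)) by (apply pow_le; lra).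
      apply Rmult_le_compat_l; [apply pow_le; lra|apply Rabs_mult_le2; auto].
    - replace (h ^ 4 * (K * (K1 * h ^ 2))) with (h * (K * K1 * h ^ 5)) by ring.
      assert (0 <= K * K1 * h ^ 5) by (apply Rmult_le_pos; auto; apply Rmult_le_pos; auto).
      rewrite <- (Rmult_1_l (K * K1 * h ^ 5)) at 2; apply Rmult_le_compat_r; lra. }
  apply Rabs_le_between in R0; apply Rabs_le_between in R3; apply Rabs_le_between in R4.
  apply Rabs_le; lra.
Qed.

(** Both fluxes are expanded about the same point. Paired with [j^n - (j-1)^n], the limiting moments
    0, 0, 2, 3, 2, 0, -1 give 6 for n = 3 and 0 for every other n up to 7. From n = 4 on, the moment
    error [h^4] meets a factor [h^n], so each term is of order 8. *)
Lemma big_flux_difference (C D : nat -> R) (g : R -> R) (h K K1 B : R) :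
  0 < h <= 1 -> 0 <= K -> 0 <= K1 -> (forall n, (n <= 7)%nat -> Rabs (D n) <= K) ->
  (forall j, -3 <= j <= 4 -> Rabs (g j - poly_part D h 7 j) <= B) ->
  norm1 C <= K1 -> moment 0 C = 0 -> moment 1 C = 0 -> moment 2 C = 2 ->
  Rabs (moment 3 C - 3) <= K1 * h ^ 4 -> Rabs (moment 4 C - 2) <= K1 * h ^ 4 ->
  Rabs (moment 5 C) <= K1 * h ^ 4 -> Rabs (moment 6 C + 1) <= K1 * h ^ 4 ->
  Rabs (dot C g - dot C (fun j => g (j - 1)) - h ^ 3 * D 3%nat)
  <= 400 * K * K1 * h ^ 8 + 2 * B * K1.
Proof.
  intros Hh HK HK1 HD Hg HN M0 M1 M2 M3 M4 M5 M6.
  assert (HB : 0 <= B) by (eapply Rle_trans; [apply Rabs_pos|apply (Hg 0); lra]).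
  set (p := poly_part D h 7) in *.
  assert (Eg : dot C g - dot C (fun j => g (j - 1))
     = dot C (fun j => p j - p (j - 1))
       + dot C (fun j => (g j - p j) - (g (j - 1) - p (j - 1))))
    by (unfold dot; ring).
  set (q := fun n => dot C (fun j => j ^ n - (j - 1) ^ n)).
  assert (Ep : dot C (fun j => p j - p (j - 1))
     = sum_f_R0 (fun n => D n * h ^ n / INR (fact n) * q n) 7).
  { unfold q; rewrite <- dot_sum; apply dot_ext; intros j.
    unfold p, poly_part; rewrite <- minus_sum; apply sum_eq; intros n Hn.
    field; apply INR_fact_neq_0. }
  assert (R0 : Rabs (dot C (fun j => (g j - p j) - (g (j - 1) - p (j - 1)))) <= 2 * B * K1).
  { eapply Rle_trans; [apply (dot_bound _ _ (2 * B))|apply Rmult_le_compat_l; auto; lra].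
    intros j Hj; assert (A1 := Hg j ltac:(lra)); assert (A2 := Hg (j - 1) ltac:(lra)).
    apply Rabs_le_between in A1; apply Rabs_le_between in A2; apply Rabs_le; lra. }
  set (x := K1 * h ^ 4) in *.
  assert (Q0 : q 0%nat = 0) by (unfold q, dot; simpl; ring).
  assert (Q1 : q 1%nat = 0) by (rewrite <- M0; unfold q, moment, dot; ring).
  assert (Q2 : q 2%nat = 0).
  { replace 0 with (2 * moment 1 C - moment 0 C) by lra; unfold q, moment, dot; ring. }
  assert (Q3 : q 3%nat = 6).
  { replace 6 with (3 * moment 2 C - 3 * moment 1 C + moment 0 C) by lra; unfold q, moment, dot; ring. }
  assert (Q4 : q 4%nat = 4 * moment 3 C - 6 * moment 2 C + 4 * moment 1 C - moment 0 C)
    by (unfold q, moment, dot; ring).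
  assert (Q5 : q 5%nat = 5 * moment 4 C - 10 * moment 3 C + 10 * moment 2 C
      - 5 * moment 1 C + moment 0 C) by (unfold q, moment, dot; ring).
  assert (Q6 : q 6%nat = 6 * moment 5 C - 15 * moment 4 C + 20 * moment 3 C
      - 15 * moment 2 C + 6 * moment 1 C - moment 0 C) by (unfold q, moment, dot; ring).
  assert (Q7 : q 7%nat = 7 * moment 6 C - 21 * moment 5 C + 35 * moment 4 C
      - 35 * moment 3 C + 21 * moment 2 C - 7 * moment 1 C + moment 0 C)
    by (unfold q, moment, dot; ring).
  (* The worst case is n = 7, where the coefficients 7, 21, 35, 35 of the inexact moments add up to
     98. *)
  assert (HQ : forall n, (4 <= n <= 7)%nat -> Rabs (q n) <= 100 * x).
  { apply Rabs_le_between in M3; apply Rabs_le_between in M4.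
    apply Rabs_le_between in M5; apply Rabs_le_between in M6.
    intros n Hn; assert (E : n = 4%nat \/ n = 5%nat \/ n = 6%nat \/ n = 7%nat) by lia.
    destruct E as [->|[->|[->| ->]]]; [rewrite Q4|rewrite Q5|rewrite Q6|rewrite Q7];
      rewrite M0, M1, M2; apply Rabs_le; lra. }
  assert (HT : forall n, (4 <= n <= 7)%nat -> Rabs (D n * h ^ n * q n) <= 100 * K * K1 * h ^ 8).
  { intros n Hn.
    assert (Hn4 : Rabs (h ^ n) <= h ^ 4).
    { rewrite Rabs_pos_eq by (apply pow_le; lra).
      replace n with (4 + (n - 4))%nat by lia; rewrite pow_add.
      rewrite <- (Rmult_1_r (h ^ 4)) at 2; apply Rmult_le_compat_l; [apply pow_le; lra|].
      rewrite <- (pow1 (n - 4)); apply pow_incr; lra. }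
    replace (100 * K * K1 * h ^ 8) with (K * h ^ 4 * (100 * x)) by (unfold x; ring).
    apply Rabs_mult_le2; [apply Rabs_mult_le2; [apply HD; lia|auto]|apply HQ; auto]. }
  destruct INR_fact_values as (F0 & F1 & F2 & F3 & F4 & F5 & F6 & F7).
  rewrite Eg, Ep; cbn [sum_f_R0].
  rewrite F0, F1, F2, F3, F4, F5, F6, F7, Q0, Q1, Q2, Q3.
  assert (T4 := HT 4%nat ltac:(lia)); assert (T5 := HT 5%nat ltac:(lia)).
  assert (T6 := HT 6%nat ltac:(lia)); assert (T7 := HT 7%nat ltac:(lia)).
  apply Rabs_le_between in R0; apply Rabs_le_between in T4; apply Rabs_le_between in T5.
  apply Rabs_le_between in T6; apply Rabs_le_between in T7.
  apply Rabs_le; lra.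
Qed.

(** For both pairs, the differences on substencils 0 and 2 agree on polynomials of degree 4, so only
    the data error remains. Absolute weights: 8 + 24 for the third differences and 16 + 16 for the
    fourth. The bound is unaffected by derivatives of [v] that vanish. *)
Lemma zeta_bound (D : nat -> R) (v : R -> R) (h y B : R) :
  (forall j, -2 <= j <= 4 -> Rabs (v (y + j * h) - poly_part D h 4 j) <= B) ->
  zeta v h y <= 64 * B.
Proof.
  intros H; unfold zeta, beta.
  assert (A1 := H (-2) ltac:(lra)); assert (A2 := H (-1) ltac:(lra)).
  assert (A3 := H 0 ltac:(lra)); assert (A4 := H 1 ltac:(lra)).
  assert (A5 := H 2 ltac:(lra)); assert (A6 := H 3 ltac:(lra)).
  assert (A7 := H 4 ltac:(lra)).
  rewrite poly_part_4 in *.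
  apply Rabs_le_between in A1; apply Rabs_le_between in A2; apply Rabs_le_between in A3.
  apply Rabs_le_between in A4; apply Rabs_le_between in A5; apply Rabs_le_between in A6.
  apply Rabs_le_between in A7.
  assert (H3 : Rabs (Defs.D3 v h y 0 - Defs.D3 v h y 2) <= 32 * B).
  { unfold Defs.D3, node; apply Rabs_le; lra. }
  assert (H4 : Rabs (Defs.D4 v h y 0 - Defs.D4 v h y 2) <= 32 * B).
  { unfold Defs.D4, node; simpl Z.of_nat; simpl Z.add; apply Rabs_le; lra. }
  assert (T3 := Rabs_triang_inv2 (Defs.D3 v h y 0) (Defs.D3 v h y 2)).
  assert (T4 := Rabs_triang_inv2 (Defs.D4 v h y 0) (Defs.D4 v h y 2)).
  set (a := Rabs (Defs.D3 v h y 0)) in *; set (b := Rabs (Defs.D3 v h y 2)) in *.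
  set (c := Rabs (Defs.D4 v h y 0)) in *; set (d := Rabs (Defs.D4 v h y 2)) in *.
  assert (U3 := Rle_trans _ _ _ T3 H3); assert (U4 := Rle_trans _ _ _ T4 H4).
  apply Rabs_le_between in U3; apply Rabs_le_between in U4.
  apply Rabs_le; lra.
Qed.

(** With [S] the sum of the [d e], a nonlinear weight differs from the ideal one by [d (e - S) / A].
    These differences add up to zero, so the common part [P] of the fluxes drops out. No sign is
    assumed for the ideal weights; [6 K E <= 1] is what keeps [A] above 1/2. *)
Lemma nonlinear_weights_close (d0 d1 d2 e0 e1 e2 f0 f1 f2 K E P B : R) :
  d0 + d1 + d2 = 1 -> Rabs d0 <= K -> Rabs d1 <= K -> Rabs d2 <= K ->
  0 <= e0 <= E -> 0 <= e1 <= E -> 0 <= e2 <= E -> 6 * K * E <= 1 ->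
  Rabs (f0 - P) <= B -> Rabs (f1 - P) <= B -> Rabs (f2 - P) <= B ->
  let A := d0 * (1 + e0) + d1 * (1 + e1) + d2 * (1 + e2) in
  1 / 2 <= A /\
  Rabs (d0 * (1 + e0) / A * f0 + d1 * (1 + e1) / A * f1 + d2 * (1 + e2) / A * f2
        - (d0 * f0 + d1 * f1 + d2 * f2)) <= 6 * K * (1 + 3 * K) * E * B.
Proof.
  intros Hd H0 H1 H2 E0 E1 E2 HKE F0 F1 F2 A.
  assert (HE : 0 <= E) by lra.
  assert (HK : 0 <= K) by (eapply Rle_trans; [apply Rabs_pos|exact H0]).
  assert (HB : 0 <= B) by (eapply Rle_trans; [apply Rabs_pos|exact F0]).
  assert (Hde : forall d e, Rabs d <= K -> 0 <= e <= E -> Rabs (d * e) <= K * E).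
  { intros d e Hd' He; apply Rabs_mult_le2; auto; rewrite Rabs_pos_eq; lra. }
  assert (S0 := Hde d0 e0 H0 E0); assert (S1 := Hde d1 e1 H1 E1).
  assert (S2 := Hde d2 e2 H2 E2).
  set (S := d0 * e0 + d1 * e1 + d2 * e2).
  assert (HS : Rabs S <= 3 * K * E).
  { apply Rabs_le_between in S0; apply Rabs_le_between in S1; apply Rabs_le_between in S2.
    unfold S; apply Rabs_le; lra. }
  assert (EA : A = 1 + S) by (unfold A, S; lra).
  assert (HA : 1 / 2 <= A) by (apply Rabs_le_between in HS; lra).
  split; auto.
  assert (T : forall d e f, Rabs d <= K -> 0 <= e <= E -> Rabs (f - P) <= B ->
    Rabs (d * (e - S) / A * (f - P)) <= 2 * K * (1 + 3 * K) * E * B).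
  { intros d e f Hd' He Hf.
    apply Rabs_mult_le2; auto; unfold Rdiv.
    replace (2 * K * (1 + 3 * K) * E) with (K * ((1 + 3 * K) * E) * 2) by ring.
    apply Rabs_mult_le2.
    - apply Rabs_mult_le2; auto.
      apply Rabs_le_between in HS; apply Rabs_le; lra.
    - rewrite Rabs_pos_eq by (left; apply Rinv_0_lt_compat; lra).
      replace 2 with (/ (1 / 2)) by field; apply Rinv_le_contravar; lra. }
  assert (T0 := T d0 e0 f0 H0 E0 F0); assert (T1 := T d1 e1 f1 H1 E1 F1).
  assert (T2 := T d2 e2 f2 H2 E2 F2).
  assert (EQ : d0 * (1 + e0) / A * f0 + d1 * (1 + e1) / A * f1 + d2 * (1 + e2) / A * f2
        - (d0 * f0 + d1 * f1 + d2 * f2)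
     = d0 * (e0 - S) / A * (f0 - P) + d1 * (e1 - S) / A * (f1 - P) + d2 * (e2 - S) / A * (f2 - P)).
  { assert (Z : d0 * (e0 - S) + d1 * (e1 - S) + d2 * (e2 - S) = 0).
    { replace (d0 * (e0 - S) + d1 * (e1 - S) + d2 * (e2 - S))
        with (S - (d0 + d1 + d2) * S) by (unfold S; ring).
      rewrite Hd; ring. }
    replace (d0 * (e0 - S) / A * (f0 - P) + d1 * (e1 - S) / A * (f1 - P) + d2 * (e2 - S) / A * (f2 - P))
      with (d0 * (e0 - S) / A * f0 + d1 * (e1 - S) / A * f1 + d2 * (e2 - S) / A * f2
        - P / A * (d0 * (e0 - S) + d1 * (e1 - S) + d2 * (e2 - S))) by (field; lra).
    rewrite Z, EA; field; lra. }
  rewrite EQ.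
  apply Rabs_le_between in T0; apply Rabs_le_between in T1; apply Rabs_le_between in T2.
  apply Rabs_le; lra.
Qed.

Lemma Ghat_real (lam : C) (v : R -> R) (h y : R) (d f : nat -> R) :
  (forall m, (m <= 2)%nat -> ideal_weight lam h y m = RtoC (d m)) ->
  (forall m, (m <= 2)%nat -> subflux lam v h y m = RtoC (f m)) ->
  let e := fun m => zeta v h y / (beta v h y m + h ^ 2) in
  let A := d 0%nat * (1 + e 0%nat) + d 1%nat * (1 + e 1%nat) + d 2%nat * (1 + e 2%nat) in
  A <> 0 ->
  Ghat lam v h y = RtoC (d 0%nat * (1 + e 0%nat) / A * f 0%nat
    + d 1%nat * (1 + e 1%nat) / A * f 1%nat + d 2%nat * (1 + e 2%nat) / A * f 2%nat).
Proof.
  intros Hd Hf e A HA.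
  assert (Ha : forall m, (m <= 2)%nat -> alpha lam v h y m = RtoC (d m * (1 + e m))).
  { intros m Hm; unfold alpha; rewrite Hd, <- RtoC_mult by auto; reflexivity. }
  assert (HS : sum_n (fun j => alpha lam v h y j) 2 = RtoC A).
  { rewrite !sum_Sn, sum_O, !Ha by lia; unfold A; rewrite !RtoC_plus; reflexivity. }
  assert (Ho : forall m, (m <= 2)%nat -> omega lam v h y m = RtoC (d m * (1 + e m) / A)).
  { intros m Hm; unfold omega; rewrite HS, Ha, RtoC_div by auto; reflexivity. }
  unfold Ghat; rewrite !sum_Sn, sum_O, !Ho, !Hf by lia.
  rewrite !RtoC_plus, !RtoC_mult; reflexivity.
Qed.

Theorem mainTheorem3 :
  forall (lam : C) (g u : R -> R) (a b xi : R),
    lam <> RtoC 0 ->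
    Im lam = 0 \/ Re lam = 0 ->
    a < xi < b ->
    smooth_on a b (fun x => g (u x)) ->
    exists K delta : R, 0 < delta /\
      forall h : R, 0 < h < delta ->
        Cmod ((Ghat lam (fun x => g (u x)) h xi
               - Ghat lam (fun x => g (u x)) h (xi - h)%R) / RtoC (h ^ 3)
              - RtoC (Derive_n (fun x => g (u x)) 3 xi))%C
        <= K * h ^ 5.
Proof.
  intros lam g u a b xi H0 Hri Hx Hs.
  set (v := fun x => g (u x)) in *.
  destruct (scheme_structure lam H0 Hri) as (K & dl & HK & Hdl & HST).
  destruct (smooth_taylor a b xi v Hx Hs) as (Kv & r & HKv & Hr & HT).
  (* The powers of 4 come from Taylor remainders of orders 5 and 8 at points within [4 * h] of the
     center. *)
  set (Kz := 64 * (Kv * 4 ^ 5)).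
  set (Kf := Kv * K + Kv * 4 ^ 5 * K).
  set (Kw := 6 * K * (1 + 3 * K) * Kz * Kf).
  set (Kb := 400 * Kv * K + 2 * (Kv * 4 ^ 8) * K).
  assert (HKz : 0 <= Kz) by (unfold Kz; lra).
  assert (HK4 : 0 <= Kv * 4 ^ 5 * K) by (apply Rmult_le_pos; lra).
  assert (HKf : 0 <= Kf) by (unfold Kf; assert (0 <= Kv * K) by (apply Rmult_le_pos; auto); lra).
  assert (HKKz : 0 <= 6 * K * Kz) by (apply Rmult_le_pos; lra).
  exists (Kb + 2 * Kw), (Rmin dl (Rmin (r / 4) (/ (6 * K * Kz + 1)))); split.
  { repeat apply Rmin_glb_lt; auto; try lra; apply Rinv_0_lt_compat; lra. }
  intros h [Hh Hhd].
  assert (D1 := Rmin_l dl (Rmin (r / 4) (/ (6 * K * Kz + 1)))).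
  assert (D2 := Rmin_r dl (Rmin (r / 4) (/ (6 * K * Kz + 1)))).
  assert (D3 := Rmin_l (r / 4) (/ (6 * K * Kz + 1))).
  assert (D4 := Rmin_r (r / 4) (/ (6 * K * Kz + 1))).
  destruct (HST h ltac:(lra)) as (c & Cb & d & Hc & HCb & Hd & Hsum & Hdec & Hid & Hfl).
  assert (Hh3 : 0 < h ^ 3) by (apply pow_lt; lra).
  assert (Hnode : forall y N j, Rabs (y - xi) <= r -> (N <= 7)%nat -> -4 <= j <= 4 ->
    Rabs (v (y + j * h) - poly_part (fun n => Derive_n v n y) h N j) <= Kv * 4 ^ S N * h ^ S N).
  { intros y N j Hy HN Hj.
    destruct (HT y Hy) as [_ H].
    assert (Hjh : Rabs (y + j * h - y) <= 4 * h).
    { replace (y + j * h - y) with (j * h) by ring.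
      rewrite Rabs_mult, (Rabs_pos_eq h) by lra.
      apply Rmult_le_compat_r; [lra|apply Rabs_le; lra]. }
    rewrite <- taylor_node.
    eapply Rle_trans; [apply H; [lia|lra]|].
    rewrite Rmult_assoc, <- Rpow_mult_distr; apply Rmult_le_compat_l; auto.
    apply pow_incr; split; auto; apply Rabs_pos. }
  set (lin := fun y => dot Cb (fun j => v (y + j * h))).
  (* Each flux is within [O(h^8)] of the linear big-stencil flux, so the nonlinear parts at the two
     interfaces need not cancel each other to survive division by [h^3]. *)
  assert (HG : forall y, Rabs (y - xi) <= r -> exists G, Ghat lam v h y = RtoC G /\
     Rabs (G - lin y) <= Kw * h ^ 8).
  { intros y Hy.
    set (D := fun n => Derive_n v n y).
    set (B := Kv * 4 ^ 5 * h ^ 5).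
    assert (HB5 : forall j, -2 <= j <= 4 -> Rabs (v (y + j * h) - poly_part D h 4 j) <= B)
      by (intros; apply (Hnode y 4%nat); auto; lra).
    set (f := fun m => dot (pad m (c m)) (fun j => v (y + j * h))).
    set (P := D 2%nat * h ^ 2 + D 3%nat * h ^ 3 / 2 + D 4%nat * h ^ 4 / 12).
    assert (Hf : forall m, (m <= 2)%nat -> Rabs (f m - P) <= Kf * h ^ 5).
    { intros m Hm; destruct (Hc m Hm) as (C0 & C1 & C2 & C3 & C4 & C5).
      replace (Kf * h ^ 5) with (Kv * K * h ^ 5 + B * K) by (unfold Kf, B; ring).
      apply (sub_flux_expansion _ D (fun _ => 0)); auto; [lra|].
      intros n Hn; apply (HT y Hy); lia. }
    assert (Hz : zeta v h y <= Kz * h ^ 5).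
    { replace (Kz * h ^ 5) with (64 * B) by (unfold Kz, B; ring).
      apply (zeta_bound D); auto. }
    assert (Hz0 : 0 <= zeta v h y) by apply Rabs_pos.
    set (e := fun m => zeta v h y / (beta v h y m + h ^ 2)).
    assert (Hh2 : 0 < h ^ 2) by (apply pow_lt; lra).
    assert (He : forall m, 0 <= e m <= Kz * h ^ 3).
    { intros m; assert (Hb : 0 <= beta v h y m) by
        (unfold beta; apply Rplus_le_le_0_compat; apply Rabs_pos).
      unfold e; split.
      - apply Rmult_le_pos; auto; left; apply Rinv_0_lt_compat; lra.
      - apply Rle_trans with (Kz * h ^ 5 * / h ^ 2).
        + apply Rmult_le_compat; auto; [left; apply Rinv_0_lt_compat; lra|].
          apply Rinv_le_contravar; lra.
        + right; field; lra. }
    assert (Hs6 : 6 * K * (Kz * h ^ 3) <= 1).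
    { assert (Q := pow_small (6 * K * Kz) h 2 ltac:(lra) ltac:(lra)
        (inv_bound (6 * K * Kz) h ltac:(lra) ltac:(lra))); lra. }
    destruct (nonlinear_weights_close (d 0%nat) (d 1%nat) (d 2%nat) (e 0%nat) (e 1%nat)
      (e 2%nat) (f 0%nat) (f 1%nat) (f 2%nat) K (Kz * h ^ 3) P (Kf * h ^ 5)
      Hsum (Hd 0%nat ltac:(lia)) (Hd 1%nat ltac:(lia)) (Hd 2%nat ltac:(lia))
      (He 0%nat) (He 1%nat) (He 2%nat) Hs6
      (Hf 0%nat ltac:(lia)) (Hf 1%nat ltac:(lia)) (Hf 2%nat ltac:(lia))) as [HA HW].
    eexists; split.
    - apply (Ghat_real lam v h y d f); auto.
      change (d 0%nat * (1 + e 0%nat) + d 1%nat * (1 + e 1%nat) + d 2%nat * (1 + e 2%nat) <> 0); lra.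
    - unfold lin; rewrite Hdec.
      replace (Kw * h ^ 8) with (6 * K * (1 + 3 * K) * (Kz * h ^ 3) * (Kf * h ^ 5))
        by (unfold Kw; ring).
      exact HW. }
  destruct (HG xi) as (G1 & E1 & B1); [rewrite Rminus_diag, Rabs_R0; lra|].
  destruct (HG (xi - h)) as (G2 & E2 & B2).
  { replace (xi - h - xi) with (- h) by ring; rewrite Rabs_Ropp, Rabs_pos_eq; lra. }
  destruct HCb as (C0 & C1 & C2 & C3 & C4 & C5 & C6 & C7).
  assert (HL : Rabs (lin xi - lin (xi - h) - h ^ 3 * Derive_n v 3 xi) <= Kb * h ^ 8).
  (* Since [Cb] does not depend on the base point, the left flux is the same stencil applied to data
     shifted by one offset. *)
  { assert (Q := big_flux_difference Cb (fun n => Derive_n v n xi) (fun j => v (xi + j * h))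
      h Kv K (Kv * 4 ^ 8 * h ^ 8)).
    replace (Kb * h ^ 8) with (400 * Kv * K * h ^ 8 + 2 * (Kv * 4 ^ 8 * h ^ 8) * K)
      by (unfold Kb; ring).
    replace (lin (xi - h)) with (dot Cb (fun j => v (xi + (j - 1) * h)))
      by (apply dot_ext; intros; f_equal; ring).
    apply Q; auto; try lra.
    - intros n Hn; apply (HT xi); [rewrite Rminus_diag, Rabs_R0; lra|lia].
    - intros j Hj; apply (Hnode xi 7%nat); [rewrite Rminus_diag, Rabs_R0; lra|lia|lra]. }
  rewrite E1, E2, <- RtoC_minus, <- RtoC_div, <- RtoC_minus, Cmod_R by lra.
  apply Rmult_le_reg_l with (h ^ 3); auto.
  rewrite <- (Rabs_pos_eq (h ^ 3)) at 1 by lra; rewrite <- Rabs_mult.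
  replace (h ^ 3 * ((G1 - G2) / h ^ 3 - Derive_n v 3 xi))
    with ((G1 - lin xi) - (G2 - lin (xi - h)) + (lin xi - lin (xi - h) - h ^ 3 * Derive_n v 3 xi))
    by (field; lra).
  replace (h ^ 3 * ((Kb + 2 * Kw) * h ^ 5)) with (Kb * h ^ 8 + 2 * (Kw * h ^ 8)) by ring.
  apply Rabs_le_between in B1; apply Rabs_le_between in B2; apply Rabs_le_between in HL.
  apply Rabs_le; lra.
Qed.
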